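(* Let $k,n\ge 1$. Let $\zeta\in\mathbb R^n$ be a random vector and $Z\in\mathrm{Mat}_{k\times n}$ a random matrix, each with i.i.d. standard Gaussian entries. Assume that for all trees $\mathfrak T$ spanning $\langle k\rangle$ the random matrix $\mathrm{wt}_{\mathfrak T}$ is independent of $Z$. Then for any tame functions $f_1,\dots,f_k:\mathbb R^n\to\mathbb C$ we have $$\kappa(f_1(\zeta),\dots,f_k(\zeta))=\sum_{\substack{\text{trees }\mathfrak T\\ \text{spanning }\langle k\rangle}}\mathbb E\,\big(L_{\mathfrak T}(f_1\otimes\cdots\otimes f_k)\big)\big(\sqrt{\mathrm{wt}_{\mathfrak T}}\,Z\big),$$ where $\kappa(\cdot)$ is the joint cumulant functional.
   Context: $\langle k\rangle=\{1,\dots,k\}$. $\mathrm{Mat}_{k\times n}$ is the space of $k\times n$ real matrices with norm $\|x\|=(\mathrm{tr}\,x^{T}x)^{1/2}$; $D_{ij}$ denotes partial differentiation with respect to the $(i,j)$ entry. A function $f:\mathrm{Mat}_{k\times n}\to\mathbb C$ has exponential growth if there are constants $c_1,c_2$ with $|f(x)|\le c_1e^{c_2\|x\|}$ for all $x$; it is tame if it is infinitely differentiable and its partial derivatives of all orders have exponential growth. The same terminology applies to functions on $\mathbb R^n=\mathrm{Mat}_{1\times n}$. For $f_1,\dots,f_k:\mathbb R^n\to\mathbb C$, the function $f_1\otimes\cdots\otimes f_k:\mathrm{Mat}_{k\times n}\to\mathbb C$ sends the matrix with entries $x_{ij}$ to $\prod_{i=1}^kf_i(x_{i1},\dots,x_{in})$.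 A tree $\mathfrak T$ spanning $\langle k\rangle$ is a connected graph with vertex set $\langle k\rangle$ and $k-1$ unoriented edges, each a two-element subset of $\langle k\rangle$. For smooth $f:\mathrm{Mat}_{k\times n}\to\mathbb C$, $$L_{\mathfrak T}f=\Big(\prod_{\{i,i'\}\text{ edge of }\mathfrak T}\ \sum_{j=1}^nD_{ij}D_{i'j}\Big)f .$$ Given $\mathfrak T$ with edge set $E$, let $\{x_e\}_{e\in E}$ be i.i.d. uniform on $(0,1)$; $\mathrm{wt}_{\mathfrak T}$ is the random $k\times k$ real symmetric matrix with diagonal entries $1$ and, for $i\neq j$, $(i,j)$ entry equal to the minimum of $x_e$ over the edges $e$ of the unique path in $\mathfrak T$ from $i$ to $j$. It is almost surely positive definite, and $\sqrt{\mathrm{wt}_{\mathfrak T}}$ is its positive definite square root. For $\mathbb C$-valued random variables $X_1,\dots,X_k$ with absolute moments of all orders, the joint cumulant is $\kappa(X_1,\dots,X_k)=\sum_{\Pi}\mu(\Pi:\mathbf 1_k)\prod_{A\in\Pi}\mathbb E\prod_{i\in A}X_i$, the sum being over set partitions $\Pi$ of $\langle k\rangle$, where $\mu$ is the Möbius function of the lattice of set partitions of $\langle k\rangle$ ordered by refinement and $\mathbf 1_k=\{\langle k\rangle\}$; explicitly $\mu(\Pi:\mathbf 1_k)=(-1)^{|\Pi|-1}(|\Pi|-1)!$. *)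

(* Defs.v *)
(* An arbitrary R : realType plays the role of the real numbers, and R[i] (from
   mathcomp.real_closed.complex) that of the complex numbers. *)
From HB Require Import structures.
From mathcomp Require Import all_boot all_order all_algebra.
From mathcomp Require Import all_classical all_reals all_analysis.
From mathcomp Require Import complex.

Set Implicit Arguments.
Unset Strict Implicit.
Unset Printing Implicit Defensive.

Import Order.TTheory GRing.Theory Num.Theory.
Import numFieldNormedType.Exports.

Local Open Scope ring_scope.
Local Open Scope complex_scope.
Local Open Scope classical_set_scope.

Section SmoothFunctions.
Variables (R : realType) (k n : nat).
Implicit Type f : 'M[R]_(k, n) -> R[i].

(* The library norm on matrices is the max norm. *)
Definition frobenius_norm (x : 'M[R]_(k, n)) : R := Num.sqrt (\tr (x^T *m x)).

(* D_ij f. The library derivative needs a codomain normed over R, which R[i]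
   is not, so complex-valued functions are differentiated componentwise. *)
Definition partial (i : 'I_k) (j : 'I_n) f : 'M[R]_(k, n) -> R[i] :=
  fun x => 'D_(delta_mx i j) (fun y => complex.Re (f y)) x
        +i* 'D_(delta_mx i j) (fun y => complex.Im (f y)) x.

Definition iter_partial (s : seq ('I_k * 'I_n)) f : 'M[R]_(k, n) -> R[i] :=
  foldr (fun ij g => partial ij.1 ij.2 g) f s.

Definition infinitely_differentiable f : Prop :=
  forall (s : seq ('I_k * 'I_n)) (x : 'M[R]_(k, n)),
    differentiable (fun y => complex.Re (iter_partial s f y)) x /\
    differentiable (fun y => complex.Im (iter_partial s f y)) x.

(* The inequality is in R[i], whose norm is R[i]-valued; a <= b%:C there
   means that a is real and at most b. *)
Definition exponential_growth f : Prop :=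
  exists c1 c2 : R,
    forall x, `|f x| <= (c1 * expR (c2 * frobenius_norm x))%:C.

Definition tame f : Prop :=
  infinitely_differentiable f /\
  forall s : seq ('I_k * 'I_n), exponential_growth (iter_partial s f).

Definition tensor (f : 'I_k -> 'rV[R]_n -> R[i]) : 'M[R]_(k, n) -> R[i] :=
  fun x => \prod_(i < k) f i (row i x).

(* The factor sum_j D_ij D_i'j attached to the edge {i, i'}, whose endpoints
   are listed by enum; only two-element sets are used. *)
Definition edge_operator (e : {set 'I_k}) f : 'M[R]_(k, n) -> R[i] :=
  if enum e is [:: i; i'] then
    fun x => \sum_(j < n) partial i j (partial i' j f) x
  else f.

(* On smooth functions the edge operators commute and are symmetric in the two
   endpoints, so the orders chosen by enum do not matter. *)
Definition tree_operator (E : {set {set 'I_k}}) f : 'M[R]_(k, n) -> R[i] :=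
  foldr edge_operator f (enum E).

End SmoothFunctions.

Section Trees.
Variable k : nat.
Implicit Type E : {set {set 'I_k}}.

Definition adjacent E : rel 'I_k := [rel i j | [set i; j]%SET \in E].

(* A spanning tree is given by its edge set. *)
Definition spanning_tree E : bool :=
  [&& [forall e in E, #|e| == 2%N],
      #|E| == k.-1 &
      [forall i, forall j, connect (adjacent E) i j]].

(* The simple path from i to j, without its first vertex i; it is unique when
   E is a spanning tree. *)
Definition tree_path E (i j : 'I_k) : seq 'I_k :=
  xget [::] [set p | [/\ path (adjacent E) i p, last i p = j & uniq (i :: p)]].

Definition tree_path_edges E (i j : 'I_k) : seq {set 'I_k} :=
  pairmap (fun a b => [set a; b]%SET) i (tree_path E i j).

End Trees.

Section TreeWeight.
Variables (R : realType) (k : nat).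

(* Off the diagonal the list of edges is nonempty, and starting the iterated
   minimum at the value of its head gives the minimum over the list. *)
Definition tree_weight (E : {set {set 'I_k}}) (x : {set 'I_k} -> R) : 'M[R]_k :=
  \matrix_(i, j)
    if i == j then 1
    else let es := tree_path_edges E i j in
         \big[Num.min/x (head finset.set0 es)]_(e <- es) x e.

Definition positive_definite (A : 'M[R]_k) : Prop :=
  A^T = A /\ forall u : 'cV[R]_k, u != 0 -> 0 < (u^T *m A *m u) 0 0.

(* The positive definite square root; 0 if A is not positive definite. *)
Definition sqrt_mx (A : 'M[R]_k) : 'M[R]_k :=
  xget 0 [set B | positive_definite B /\ B *m B = A].

End TreeWeight.

Section RandomVariables.
Context d (T : measurableType d) (R : realType).
Variable P : probability T R.

Definition has_law (X : T -> R) (mu : set R -> \bar R) : Prop :=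
  measurable_fun setT X /\
  forall A : set R, measurable A -> P (X @^-1` A) = mu A.

Definition independent_family (I : finType) (D : {set I}) (X : I -> T -> R) :
    Prop :=
  forall (J : {set I}) (A : I -> set R),
    J \subset D -> (forall i, i \in J -> measurable (A i)) ->
    P (\bigcap_(i in [set` J]) (X i @^-1` A i)) =
    (\prod_(i in J) P (X i @^-1` A i))%E.

Definition iid_with_law (I : finType) (D : {set I}) (X : I -> T -> R)
    (mu : set R -> \bar R) : Prop :=
  (forall i, i \in D -> has_law (X i) mu) /\ independent_family D X.

Definition standard_gaussian_mx m n (Z : T -> 'M[R]_(m, n)) : Prop :=
  iid_with_law [set: 'I_m * 'I_n]%SET (fun ij w => Z w ij.1 ij.2)
    (normal_prob 0 1).

Definition borel_mx m n : set (set 'M[R]_(m, n)) := <<s open >>.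

Definition independent_mx m n p q (U : T -> 'M[R]_(m, n))
    (V : T -> 'M[R]_(p, q)) : Prop :=
  forall A B, borel_mx A -> borel_mx B ->
    P (U @^-1` A `&` V @^-1` B) = (P (U @^-1` A) * P (V @^-1` B))%E.

(* 'E_P is a total, extended-real-valued integral; this is the expectation of
   X when the real and imaginary parts of X are integrable. *)
Definition complex_expectation (X : T -> R[i]) : R[i] :=
  fine ('E_P[fun w => complex.Re (X w)])%E +i*
  fine ('E_P[fun w => complex.Im (X w)])%E.

(* The value mu(Pi : 1_k) of the Moebius function of the lattice of set
   partitions ordered by refinement. *)
Definition moebius_to_top k (Pi : {set {set 'I_k}}) : R[i] :=
  (-1) ^+ #|Pi|.-1 * (#|Pi|.-1)`!%:R.

Definition joint_cumulant k (X : 'I_k -> T -> R[i]) : R[i] :=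
  \sum_(Pi : {set {set 'I_k}} | finset.partition Pi [set: 'I_k]%SET)
    moebius_to_top Pi *
    \prod_(A in Pi) complex_expectation (fun w => \prod_(i in A) X i w).

End RandomVariables.

(* Main.v *)
(* For a coloring [c] of the vertices let J_c be the matrix of [c i = c j].  If
   [c] is the coloring by the blocks of a partition, a product over the blocks of
   the expectations of products of the f_i(zeta) is the expectation of the tensor
   product of the f_i at a Gaussian matrix whose rows have covariance J_c.
   Interpolating from the identity to J_c by Gaussian integration by parts, and
   growing a forest by one edge of equally colored endpoints at each derivative
   (the forest formula of Brydges, Kennedy, Abdesselam and Rivasseau), writes this
   expectation as a sum over the forests compatible with the partition of terms
   that do not depend on the partition.  The weights met on the way are
   ultrametric, hence positive semidefinite.  Moebius inversion over the partitions
   then keeps exactly the forests with k - 1 edges, the spanning trees. *)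
From HB Require Import structures.
From mathcomp Require Import all_boot all_order all_algebra.
From mathcomp Require Import all_classical all_reals all_analysis.
From mathcomp Require Import complex.
From mathcomp Require Import measurable_realfun ring lra.
Require Import Defs.
Set Implicit Arguments.
Unset Strict Implicit.
Unset Printing Implicit Defensive.
Import Order.TTheory GRing.Theory Num.Theory.
Import numFieldNormedType.Exports.
Local Open Scope ring_scope.
Local Open Scope complex_scope.
Local Open Scope classical_set_scope.

(** * Equality in law and decoupling *)

Section Laws.
Context {R : realType}.

(** The interpolation meets singular covariances, so a Gaussian field is characterised by Stein's
    identity instead of a density. This form is stable under linear maps and independent sums, and
    interpolating between two fields of equal covariance shows that it determines the expectations
    of tame functions. The strength [v] of the interaction between the components of a forest runs
    from 0 up to the least edge value. A derivative at [v = s] creates an edge of value [s], and the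
    forest at strength [s] has the covariance of the enlarged forest at the top of its own range, so
    forests grow by decreasing edge values. The one-step identities are not iterated but summed over
    all forests, with i.i.d. uniform edge values: almost surely exactly one edge is the smallest,
    each nonempty forest is reached once, and the top terms of the nonempty forests cancel. At
    [v = 0] the weights forget the coloring, which is why the remaining terms do not depend on the
    partition. The square root in the statement is specified by a choice; its measurability comes
    from an explicit contraction that computes it. *)

Lemma eq_integral_law d1 d2 d' (T1 : measurableType d1) (T2 : measurableType d2)
    (S : measurableType d') (P1 : probability T1 R) (P2 : probability T2 R)
    (X1 : T1 -> S) (X2 : T2 -> S) :
  measurable_fun setT X1 -> measurable_fun setT X2 ->
  (forall A, measurable A -> P1 (X1 @^-1` A) = P2 (X2 @^-1` A)) ->
  forall f : S -> \bar R, measurable_fun setT f ->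
  (\int[P1]_w f (X1 w) = \int[P2]_w f (X2 w))%E.
Proof.
move=> m1 m2 X12.
pose Y1 : {mfun T1 >-> S} := HB.pack X1 (isMeasurableFun.Build _ _ _ _ _ m1).
pose Y2 : {mfun T2 >-> S} := HB.pack X2 (isMeasurableFun.Build _ _ _ _ _ m2).
have ge0 (f : S -> \bar R) : measurable_fun setT f -> (forall x, 0 <= f x)%E ->
    (\int[P1]_w f (X1 w) = \int[P2]_w f (X2 w))%E.
  move=> mf f0; have e1 := @ge0_integral_distribution _ _ _ _ R P1 Y1 f mf f0.
  have e2 := @ge0_integral_distribution _ _ _ _ R P2 Y2 f mf f0.
  rewrite -[LHS]e1 -[RHS]e2; apply: eq_measure_integral => A mA _.
  exact: X12.
move=> f mf; rewrite integralE [RHS]integralE; congr (_ - _)%E.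
  rewrite (funepos_comp f X1) (funepos_comp f X2).
  by apply: (ge0 (f^\+)%E) => //; exact: measurable_funepos.
rewrite (funeneg_comp f X1) (funeneg_comp f X2).
by apply: (ge0 (f^\-)%E) => //; exact: measurable_funeneg.
Qed.

(** Both joint laws agree with the product of the marginal laws on rectangles, hence everywhere.
    Independence becomes evaluation at two separate sample points, where Fubini applies. *)
Lemma integral_decouple d d1 d2 (T : measurableType d) (S1 : measurableType d1)
    (S2 : measurableType d2) (P : probability T R) (U : T -> S1) (V : T -> S2) :
  measurable_fun setT U -> measurable_fun setT V ->
  (forall A B, measurable A -> measurable B ->
     P (U @^-1` A `&` V @^-1` B) = (P (U @^-1` A) * P (V @^-1` B))%E) ->
  forall f : S1 * S2 -> \bar R, measurable_fun setT f ->
  (\int[P]_w f (U w, V w) = \int[P \x P]_z f (U z.1, V z.2))%E.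
Proof.
move=> mU mV UV f mf.
have mUV : measurable_fun setT (fun w => (U w, V w)) by exact: measurable_fun_pair.
have mUV2 : measurable_fun setT (fun z : T * T => (U z.1, V z.2)).
  by apply: measurable_fun_pair; apply: measurableT_comp.
pose YU : {mfun T >-> S1} := HB.pack U (isMeasurableFun.Build _ _ _ _ _ mU).
pose YV : {mfun T >-> S2} := HB.pack V (isMeasurableFun.Build _ _ _ _ _ mV).
pose W1 : {mfun T >-> (S1 * S2)%type} := HB.pack (fun w => (U w, V w)) (isMeasurableFun.Build _ _ _ _ _ mUV).
pose W2 : {mfun (T * T)%type >-> (S1 * S2)%type} := HB.pack (fun z : T * T => (U z.1, V z.2)) (isMeasurableFun.Build _ _ _ _ _ mUV2).
apply: (@eq_integral_law _ _ _ _ _ _ P (P \x P)%E) => // A mA.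
have e1 := @product_measure_unique _ _ _ _ R (distribution P YU) (distribution P YV) (distribution P W1).
have e2 := @product_measure_unique _ _ _ _ R (distribution P YU) (distribution P YV) (distribution (P \x P)%E W2).
transitivity (((distribution P YU) \x (distribution P YV))%E A).
  by apply/esym/e1 => // B C mB mC; exact: UV.
apply: e2 => // B C mB mC.
transitivity ((P \x P)%E ((U @^-1` B) `*` (V @^-1` C))) => //.
by rewrite product_measure1E// -[X in measurable X]setTI; [exact: (mU)|exact: (mV)].
Qed.

Lemma product_probabilityE d1 d2 (T1 : measurableType d1) (T2 : measurableType d2)
    (P1 : probability T1 R) (P2 : probability T2 R) (A : set T1) (B : set T2) :
  measurable A -> measurable B ->
  ((P1 \x P2)%E : probability (T1 * T2)%type R) (A `*` B) = (P1 A * P2 B)%E.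
Proof. exact: product_measure1E. Qed.

End Laws.

(** * The product sigma-algebra of a finite family of reals *)

Section Boxes.
Context {R : realType} (I : finType).
Notation tupR := (#|I|.-tuple R).

(** Families indexed by a finite type are carried by tuples, whose sigma-algebra is the product
    one. *)
Definition coords (t : tupR) : I -> R := fun i => tnth t (enum_rank i).
Definition of_coords (x : I -> R) : tupR := [tuple x (enum_val j) | j < #|I|].

Lemma of_coordsK x : coords (of_coords x) = x.
Proof. by apply/funext => i; rewrite /coords tnth_mktuple enum_rankK. Qed.

Lemma measurable_of_coords d (T : measurableType d) (X : I -> T -> R) :
  (forall i, measurable_fun setT (X i)) ->
  measurable_fun setT (fun w => of_coords (X ^~ w)).
Proof.
move=> mX; apply/measurable_fun_tnthP => j /=.
rewrite (_ : _ \o _ = X (enum_val j)); first exact: mX.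
by apply/funext => w /=; rewrite tnth_mktuple.
Qed.

(* Measurability with respect to the product sigma-algebra on [I -> R]. *)
Definition multi_measurable d' (S : measurableType d') (h : (I -> R) -> S) :=
  measurable_fun setT (h \o coords).

Lemma multi_measurableP d' (S : measurableType d') (h : (I -> R) -> S) :
  multi_measurable h <->
  forall d (T : measurableType d) (X : I -> T -> R),
    (forall i, measurable_fun setT (X i)) ->
    measurable_fun setT (fun w => h (X ^~ w)).
Proof.
split=> [mh d T X mX|]; last first.
  apply; move=> i; exact: measurable_tnth.
have := measurableT_comp mh (measurable_of_coords mX).
by congr measurable_fun; apply/funext => w /=; rewrite of_coordsK.
Qed.

Definition box (A : I -> set R) : set tupR := [set t | forall i, A i (coords t i)].

(** Boxes are stable under intersection and generate the sigma-algebra, a cylinder being a box with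
    all other sides equal to the whole line. *)
Lemma eq_measure_box (m1 m2 : {measure set tupR -> \bar R}) :
  (m1 setT < +oo)%E ->
  (forall A, (forall i, measurable (A i)) -> m1 (box A) = m2 (box A)) ->
  forall B, measurable B -> m1 B = m2 B.
Proof.
move=> m1oo m12.
pose G : set (set tupR) := [set B | exists2 A, (forall i, measurable (A i)) & B = box A].
apply: (@measure_unique _ _ _ G (fun=> setT)) => //.
- apply/seteqP; split.
    apply: smallest_sub; first exact: smallest_sigma_algebra.
    rewrite -bigcup_seq => B [j _ [A mA <-]]; apply: sub_sigma_algebra.
    exists (fun i => if i == enum_val j then A else setT).
      by move=> i; case: ifP.
    rewrite setTI; apply/seteqP; split => t /=.
      by move=> At i; case: ifP => // /eqP ->; rewrite /coords enum_valK.
    by move=> /(_ (enum_val j)); rewrite eqxx /coords enum_valK.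
  apply: smallest_sub; first exact: sigma_algebra_measurable.
  move=> _ [A mA ->].
  rewrite (_ : box A = \bigcap_(i in [set: I]) ((coords ^~ i) @^-1` (A i))); last first.
    by apply/seteqP; split => t /= At i; [move=> _|]; exact: At.
  apply: fin_bigcap_measurable; first exact: finite_finset.
  by move=> i _; rewrite -[X in measurable X]setTI; exact: measurable_tnth.
- move=> _ _ [A mA ->] [A' mA' ->]; exists (fun i => A i `&` A' i).
    by move=> i; exact: measurableI.
  apply/seteqP; split => t /=; first by move=> [h1 h2] i; split.
  by move=> h; split => i; have [] := h i.
- by move=> _; exists (fun=> setT) => //; apply/seteqP; split.
- by rewrite bigcup_const//; exists 0%N.
- by move=> _ [A mA ->]; exact: m12.
Qed.

Lemma eq_integral_box d1 d2 (T1 : measurableType d1) (T2 : measurableType d2)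
    (P1 : probability T1 R) (P2 : probability T2 R) (X1 : T1 -> tupR)
    (X2 : T2 -> tupR) :
  measurable_fun setT X1 -> measurable_fun setT X2 ->
  (forall A, (forall i, measurable (A i)) ->
    P1 (X1 @^-1` box A) = P2 (X2 @^-1` box A)) ->
  forall f : tupR -> \bar R, measurable_fun setT f ->
  (\int[P1]_w f (X1 w) = \int[P2]_w f (X2 w))%E.
Proof.
move=> m1 m2 X12 f mf.
pose Y1 : {mfun T1 >-> tupR} := HB.pack X1 (isMeasurableFun.Build _ _ _ _ _ m1).
pose Y2 : {mfun T2 >-> tupR} := HB.pack X2 (isMeasurableFun.Build _ _ _ _ _ m2).
apply: (eq_integral_law m1 m2) => // A mA.
apply: (@eq_measure_box (distribution P1 Y1) (distribution P2 Y2)) => //.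
rewrite [X in (X < _)%E](_ : _ = 1%E) ?ltry//.
exact: (probability_setT (distribution P1 Y1)).
Qed.

End Boxes.

(** * Independent families: change of sample space and resampling *)

Section Families.
Context {R : realType} (I : finType).
Implicit Types (D J : {set I}).

(** Nothing is known about the variables outside [D], not even measurability, so they are frozen at
    0 before laws are compared. *)
Let restrict0 D (x : I -> R) : I -> R := fun i => if i \in D then x i else 0.

Lemma independent_box d (T : measurableType d) (P : probability T R) D
    (X : I -> T -> R) (A : I -> set R) :
  independent_family P D X -> (forall i, measurable (A i)) ->
  P [set w | forall i, i \in D -> A i (X i w)] =
  (\prod_(i in D) P (X i @^-1` A i))%E.
Proof. by move=> indX mA; rewrite -indX. Qed.

Let box_restrict d (T : measurableType d) (P : probability T R) D
    (X : I -> T -> R) (A : I -> set R) :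
  independent_family P D X -> (forall i, measurable (A i)) ->
  P ((fun w => of_coords (restrict0 D (X ^~ w))) @^-1` box A) =
  if `[< forall i, i \notin D -> A i 0 >] then
    (\prod_(i in D) P (X i @^-1` A i))%E else 0%E.
Proof.
move=> indX mA; case: asboolP => A0.
  rewrite -(independent_box indX)//; congr (P _); apply/seteqP; split => w /=.
    by move=> h i iD; have := h i; rewrite of_coordsK /restrict0 iD.
  move=> h i; rewrite of_coordsK /restrict0.
  by case: ifPn => iD; [exact: h|exact: A0].
rewrite (_ : _ @^-1` _ = set0) ?measure0//; apply/seteqP; split => w //= h.
apply: A0 => i iD; have := h i.
by rewrite of_coordsK /restrict0 (negbTE iD).
Qed.

Let measurable_restrict0 d (T : measurableType d) D (X : I -> T -> R) :
  (forall i, i \in D -> measurable_fun setT (X i)) ->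
  measurable_fun setT (fun w => of_coords (restrict0 D (X ^~ w))).
Proof.
move=> mX; apply: (measurable_of_coords (X := fun i w => restrict0 D (X ^~ w) i)).
by move=> i; rewrite /restrict0; case: (boolP (i \in D)) => [/mX//|_]; exact: measurable_cst.
Qed.

(** This moves an expectation from the edge values given for one tree to the auxiliary family
    indexed by all possible edges. *)
Lemma eq_integral_iid d1 d2 (T1 : measurableType d1) (T2 : measurableType d2)
    (P1 : probability T1 R) (P2 : probability T2 R) D
    (X1 : I -> T1 -> R) (X2 : I -> T2 -> R) (mu : set R -> \bar R)
    (h : (I -> R) -> \bar R) :
  iid_with_law P1 D X1 mu -> iid_with_law P2 D X2 mu ->
  multi_measurable h -> (forall x y, {in D, x =1 y} -> h x = h y) ->
  (\int[P1]_w h (X1 ^~ w) = \int[P2]_w h (X2 ^~ w))%E.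
Proof.
move=> [l1 i1] [l2 i2] mh hD.
have restrictE x : h x = h (coords (of_coords (restrict0 D x))).
  by apply: hD => i iD; rewrite of_coordsK /restrict0 iD.
rewrite (eq_integral (fun w => h (coords (of_coords (restrict0 D (X1 ^~ w))))))//.
rewrite [RHS](eq_integral (fun w => h (coords (of_coords (restrict0 D (X2 ^~ w))))))//.
have m1 : measurable_fun setT (fun w => of_coords (restrict0 D (X1 ^~ w))).
  by apply: measurable_restrict0 => i /l1[].
have m2 : measurable_fun setT (fun w => of_coords (restrict0 D (X2 ^~ w))).
  by apply: measurable_restrict0 => i /l2[].
apply: (eq_integral_box m1 m2 _ mh).
move=> A mA; rewrite !box_restrict//.
case: ifP => // _; apply: eq_bigr => i iD.
by rewrite (proj2 (l1 i iD)) // (proj2 (l2 i iD)).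
Qed.

(** Redrawing the coordinates in [D2] from an independent copy preserves the joint law. With [D2] a
    singleton, as in every use below, it isolates one variable for Fubini. *)
Lemma integral_family_decouple d (T : measurableType d) (P : probability T R)
    D D2 (X : I -> T -> R) (h : (I -> R) -> \bar R) :
  (forall i, i \in D -> measurable_fun setT (X i)) ->
  independent_family P D X -> D2 \subset D ->
  multi_measurable h -> (forall x y, {in D, x =1 y} -> h x = h y) ->
  (\int[P]_w h (X ^~ w) =
   \int[P \x P]_z h (fun i => if i \in D2 then X i z.2 else X i z.1))%E.
Proof.
move=> mX indX D2D mh hD.
pose X' i (z : T * T) := if i \in D2 then X i z.2 else X i z.1.
have mX' i : i \in D -> measurable_fun setT (X' i).
  by move=> iD; rewrite /X'; case: (i \in D2); apply: measurableT_comp => //; exact: mX.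
have restrictE x : h x = h (coords (of_coords (restrict0 D x))).
  by apply: hD => i iD; rewrite of_coordsK /restrict0 iD.
rewrite (eq_integral (fun w => h (coords (of_coords (restrict0 D (X ^~ w))))))//.
rewrite [RHS](eq_integral (fun w => h (coords (of_coords (restrict0 D (X' ^~ w))))))//.
have m1 := measurable_restrict0 mX.
have m2 := measurable_restrict0 mX'.
apply: (eq_integral_box m1 m2 _ mh) => A mA.
have pre (f : T -> R) (C : set R) : measurable_fun setT f -> measurable C ->
    measurable (f @^-1` C).
  by move=> mf mC; rewrite -[X in measurable X]setTI; exact: mf.
have rect (J : {set I}) : J \subset D ->
    measurable [set w | forall i, i \in J -> A i (X i w)].
  move=> JD; rewrite (_ : [set w | _] = \bigcap_(i in [set` J]) (X i @^-1` A i)).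
    by apply: fin_bigcap_measurable => // i /= iJ; apply: pre => //; apply: mX; exact: (fintype.subsetP JD).
  by apply/seteqP; split.
have indX' : independent_family (P \x P)%E D X'.
  move=> J B' JD mB'.
  have indJ J' : J' \subset J -> independent_family P J' X.
    move=> J'J K C KJ' mC; apply: indX => //.
    by apply: fintype.subset_trans KJ' _; exact: fintype.subset_trans J'J JD.
  pose J1 := J :\: D2; pose J2 := J :&: D2.
  pose C i := if i \in J then B' i else setT.
  have mC i : measurable (C i) by rewrite /C; case: ifP => // /mB'.
  (* A joint event of the mixed family is a rectangle: the indices outside [D2] constrain the first
     sample point, those inside constrain the second. *)
  rewrite (_ : \bigcap_(i in _) _ = [set w | forall i, i \in J1 -> C i (X i w)] `*`
     [set w | forall i, i \in J2 -> C i (X i w)]); last first.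
    apply/seteqP; split => -[w w'] /=.
      move=> h'; split => i; rewrite !inE /C => /andP[i1 i2].
        by rewrite i2; have := h' i i2; rewrite /X' /= (negbTE i1).
      by rewrite i1; have := h' i i1; rewrite /X' /= i2.
    move=> [h1 h2] i /= iJ; rewrite /X' /=; case: ifPn => iD.
      by have := h2 i; rewrite !inE iJ iD /C iJ; exact.
    by have := h1 i; rewrite !inE iJ iD /C iJ; exact.
  have rectC (J' : {set I}) : J' \subset D ->
      measurable [set w | forall i, i \in J' -> C i (X i w)].
    move=> J'D; rewrite (_ : [set w | _] = \bigcap_(i in [set` J']) (X i @^-1` C i)).
      by apply: fin_bigcap_measurable => // i /= iJ; apply: pre => //; apply: mX; exact: (fintype.subsetP J'D).
    by apply/seteqP; split.
  have J1J : J1 \subset J by exact: finset.subsetDl.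
  have J2J : J2 \subset J by exact: finset.subsetIl.
  rewrite product_probabilityE; [|apply: rectC; exact: fintype.subset_trans JD..].
  rewrite !independent_box//; [|exact: indJ..].
  rewrite [RHS](finset.big_setID D2)/= muleC.
  congr (_ * _)%E; apply: eq_bigr => i; rewrite !inE => /andP[i1 i2].
    rewrite /C i1 /X' i2 (_ : _ @^-1` _ = setT `*` (X i @^-1` B' i)).
      rewrite product_probabilityE ?probability_setT ?mul1e//; apply: pre (mB' _ i1).
      exact/mX/(fintype.subsetP JD).
    by apply/seteqP; split => -[w w'] //= [].
  rewrite /C i2 /X' (negbTE i1) (_ : _ @^-1` _ = (X i @^-1` B' i) `*` setT).
    rewrite product_probabilityE ?probability_setT ?mule1//; apply: pre (mB' _ i2).
    exact/mX/(fintype.subsetP JD).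
  by apply/seteqP; split => -[w w'] //= [].
rewrite !box_restrict//; case: ifP => // _; apply: eq_bigr => i iD.
rewrite /X'; case: (i \in D2).
  rewrite (_ : _ @^-1` A i = setT `*` (X i @^-1` A i)).
    by rewrite product_probabilityE ?probability_setT ?mul1e//; apply: pre (mA i); exact: mX.
  by apply/seteqP; split => -[w w'] //= [].
rewrite (_ : _ @^-1` A i = (X i @^-1` A i) `*` setT).
  by rewrite product_probabilityE ?probability_setT ?mule1//; apply: pre (mA i); exact: mX.
by apply/seteqP; split => -[w w'] //= [].
Qed.

End Families.

(** The theorem gives each tree its own edge values, while the expansion compares all forests on one
    space; this supplies the common family. Each step multiplies the sample space by one more copy
    of [mu]. *)
Lemma exists_iid {R : realType} (I : finType) (mu : probability (measurableTypeR R) R) :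
  exists d (T : measurableType d) (P : probability T R) (X : I -> T -> R),
    iid_with_law P [set: I]%SET X mu.
Proof.
suff: forall n (D : {set I}), #|D| = n -> exists d (T : measurableType d)
    (P : probability T R) (X : I -> T -> R), iid_with_law P D X mu.
  by move=> /(_ #|[set: I]%SET| [set: I]%SET erefl).
elim => [D /eqP|n IHn D Dn].
  rewrite cards_eq0 => /eqP ->; exists _, (measurableTypeR R), mu, (fun=> id).
  split=> [i|J A]; first by rewrite inE.
  rewrite finset.subset0 => /eqP -> _; rewrite big_set0.
  rewrite (_ : \bigcap_(i in _) _ = setT) ?probability_setT//.
  by apply/seteqP; split => // x _ i; rewrite /= inE.
have [e eD] : exists e, e \in D by apply/card_gt0P; rewrite Dn.
have /IHn[d [T [P [X [lX iX]]]]] : #|D :\ e| = n by apply/eqP; rewrite -eqSS -Dn (cardsD1 e D) eD.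
pose X' i (z : T * measurableTypeR R) := if i == e then z.2 else X i z.1.
have XD i : i \in D -> i != e -> i \in D :\ e by move=> *; rewrite !inE; apply/andP.
have pre (f : T -> R) (C : set R) : measurable_fun setT f -> measurable C ->
    measurable (f @^-1` C).
  by move=> mf mC; rewrite -[X in measurable X]setTI; exact: mf.
have law i (A : set R) : i \in D -> measurable A ->
    (P \x mu)%E (X' i @^-1` A) = mu A.
  move=> iD mA; rewrite /X'; have [_|ie] := eqVneq i e.
    rewrite (_ : _ @^-1` A = setT `*` A).
      by rewrite product_probabilityE// [X in (X * _)%E](probability_setT P) mul1e.
    by apply/seteqP; split => -[w w'] //= [].
  rewrite (_ : _ @^-1` A = (X i @^-1` A) `*` setT).
    have [mX lXi] := lX _ (XD _ iD ie).
    by rewrite product_probabilityE//; [rewrite [X in (_ * X)%E](probability_setT mu) mule1 lXi|exact: pre].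
  by apply/seteqP; split => -[w w'] //= [].
exists _, (T * measurableTypeR R)%type, (P \x mu)%E, X'; split => [i iD|J A JD mA].
  split=> [|A mA]; last exact: law.
  rewrite /X'; have [_|ie] := eqVneq i e; first exact: measurable_snd.
  by apply: measurableT_comp => //; case: (lX _ (XD _ iD ie)).
pose B : set R := if e \in J then A e else setT.
have mB : measurable B by rewrite /B; case: ifP => // /mA.
have JeD : J :\ e \subset D :\ e by exact: finset.setSD.
rewrite (_ : \bigcap_(i in _) _ = (\bigcap_(i in [set` J :\ e]) X i @^-1` A i) `*` B).
  rewrite product_probabilityE//; last first.
    apply: fin_bigcap_measurable => // i /= ije; apply: pre.
      by case: (lX i (fintype.subsetP JeD _ ije)).
    by apply: mA; move: ije; rewrite !inE => /andP[].
  rewrite iX//; last by move=> i; rewrite !inE => /andP[_ iJ]; exact: mA.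
  have -> : (\prod_(i in J :\ e) P (X i @^-1` A i))%E =
      (\prod_(i in J :\ e) (P \x mu) (X' i @^-1` A i))%E.
    apply: eq_bigr => i iJe; have iD := fintype.subsetP JeD _ iJe.
    move: (iJe) (iD); rewrite !inE => /andP[ie iJ] /andP[_ iD'].
    have mAi := mA _ iJ; rewrite law//; have [_ lXi] := lX i iD.
    exact: lXi.
  rewrite /B; case: ifP => eJ.
    rewrite [RHS](big_setD1 e)//= muleC; congr (_ * _)%E.
    by rewrite law//; exact: mA.
  rewrite [X in (_ * X)%E](probability_setT mu) mule1; apply: eq_bigl => i.
  by rewrite !inE; case: eqVneq => // ->.
apply/seteqP; split => -[w w'] /=.
  move=> h; split.
    by move=> i /=; rewrite !inE => /andP[ie /h]; rewrite /X' /= (negbTE ie).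
  by rewrite /B; case: ifP => // /h; rewrite /X' /= eqxx.
move=> [h1 h2] i /= iJ; rewrite /X' /=; have [ie|ie] := eqVneq i e.
  by move: h2; rewrite /B -ie iJ.
by apply: h1; rewrite /= !inE ie.
Qed.

(** * Calculus of tame functions *)

Section MatrixNorm.
Context {R : realType}.

Lemma le_mx_norm m n (x : 'M[R]_(m, n)) i j : `|x i j| <= `|x|.
Proof.
rewrite [leRHS]/(`|_|) /= mx_normrE.
exact: (le_bigmax_cond _ (fun ij => `|x ij.1 ij.2|) (j := (i, j))).
Qed.

Lemma mx_norm_le m n (x : 'M[R]_(m, n)) (c : R) :
  0 <= c -> (forall i j, `|x i j| <= c) -> `|x| <= c.
Proof.
move=> c0 xc; rewrite [leLHS]/(`|_|) /= mx_normrE.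
by apply: bigmax_le => // -[i j] _ /=.
Qed.

Lemma mx_norm_mulmx m n p (A : 'M[R]_(m, n)) (x : 'M[R]_(n, p)) :
  `|A *m x| <= (n%:R * `|A|) * `|x|.
Proof.
apply: mx_norm_le => [|i j]; first by rewrite !mulr_ge0.
rewrite mxE (le_trans (ler_norm_sum _ _ _))//.
rewrite (le_trans (y := \sum_(l < n) `|A| * `|x|))//; last first.
  by rewrite sumr_const card_ord -[leLHS]mulr_natl mulrA.
by apply: ler_sum => l _; rewrite normrM ler_pM//; exact: le_mx_norm.
Qed.

Lemma mx_norm_le_sum m n (x : 'M[R]_(m, n)) : `|x| <= \sum_i \sum_j `|x i j|.
Proof.
apply: mx_norm_le => [|i j]; first by apply: sumr_ge0 => i _; exact: sumr_ge0.
rewrite (bigD1 i)//= (bigD1 j)//= -addrA lerDl addr_ge0//; first exact: sumr_ge0.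
by apply: sumr_ge0 => i' _; exact: sumr_ge0.
Qed.

End MatrixNorm.

Section RealTame.
Context {R : realType}.

Definition Dp k n (i : 'I_k) (j : 'I_n) (g : 'M[R]_(k, n) -> R) : 'M[R]_(k, n) -> R :=
  'D_(delta_mx i j) g.

Definition iterD k n (s : seq ('I_k * 'I_n)) (g : 'M[R]_(k, n) -> R) :=
  foldr (fun ij h => Dp ij.1 ij.2 h) g s.

(** Growth is measured in the max norm, which dominates the Frobenius norm up to a factor depending
    on the size. Nonnegative constants make the bound monotone in the norm. *)
Definition exp_growth k n (g : 'M[R]_(k, n) -> R) :=
  exists c1 c2 : R, [/\ 0 <= c1, 0 <= c2 & forall x, `|g x| <= c1 * expR (c2 * `|x|)].

Definition rtame k n (g : 'M[R]_(k, n) -> R) :=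
  forall s, (forall x, differentiable (iterD s g) x) /\ exp_growth (iterD s g).

Lemma derive_line (V : normedModType R) (f : V -> R) x v :
  'D_v f x = 'D_1 (fun h : R => f (h *: v + x)) 0.
Proof.
rewrite /derive; set F := fun h => _; set G := (X in _ = lim (fmap X _)).
by rewrite (_ : F = G)//; apply/funext => h; rewrite /F /G /= addr0 scale0r add0r [h *: 1]mulr1.
Qed.

Section Basics.
Variables k n : nat.
Implicit Types (g h : 'M[R]_(k, n) -> R) (x v : 'M[R]_(k, n)).

Lemma deriveE_sum g x v : differentiable g x ->
  'D_v g x = \sum_i \sum_j v i j * Dp i j g x.
Proof.
move=> dg; rewrite deriveE// [in LHS](matrix_sum_delta v) linear_sum.
apply: eq_bigr => i _; rewrite linear_sum; apply: eq_bigr => j _.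
by rewrite linearZ /= /Dp deriveE.
Qed.

Lemma is_derive_path g (c : R -> 'M[R]_(k, n)) (t : R) v :
  differentiable g (c t) -> (forall i j, is_derive t 1 (fun s => c s i j) (v i j)) ->
  is_derive t 1 (g \o c) (\sum_i \sum_j v i j * Dp i j g (c t)).
Proof.
move=> dg dc.
have dct : derivable c t 1 by apply/derivable_mxP => i j; case: (dc i j).
have dcd : differentiable c t by exact/derivable1_diffP.
have vE : 'D_1 c t = v.
  by rewrite derive_mx//; apply/matrixP => i j; rewrite mxE; case: (dc i j).
apply: DeriveDef; first by apply/derivable1_diffP; exact: differentiable_comp.
rewrite deriveE; last exact: differentiable_comp.
by rewrite diff_comp//= -(deriveE _ dcd) -(deriveE _ dg) vE deriveE_sum.
Qed.

Lemma exp_growthD g h : exp_growth g -> exp_growth h -> exp_growth (g \+ h).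
Proof.
move=> [c1 [c2 [c10 c20 gc]]] [d1 [d2 [d10 d20 hd]]].
exists (c1 + d1), (c2 + d2); split; rewrite ?addr_ge0// => x /=.
rewrite (le_trans (ler_normD _ _))// [leRHS]mulrDl lerD//.
  by rewrite (le_trans (gc x))// ler_wpM2l// ler_expR ler_wpM2r// lerDl.
by rewrite (le_trans (hd x))// ler_wpM2l// ler_expR ler_wpM2r// lerDr.
Qed.

Lemma exp_growthM g h : exp_growth g -> exp_growth h -> exp_growth (g \* h).
Proof.
move=> [c1 [c2 [c10 c20 gc]]] [d1 [d2 [d10 d20 hd]]].
exists (c1 * d1), (c2 + d2); split; rewrite ?addr_ge0 ?mulr_ge0// => x /=.
by rewrite normrM mulrDl expRD mulrACA ler_pM.
Qed.

Lemma exp_growth_cst (c : R) : exp_growth (fun _ : 'M[R]_(k, n) => c).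
Proof. by exists `|c|, 0; split=> // x; rewrite mul0r expR0 mulr1. Qed.

(** A coinduction principle: tameness follows from exhibiting a class closed under [Dp], so that no
    iterated derivative has to be computed. *)
Lemma rtame_class (S : ('M[R]_(k, n) -> R) -> Prop) :
  (forall g, S g -> [/\ forall x, differentiable g x, exp_growth g &
     forall i j, S (Dp i j g)]) ->
  forall g, S g -> rtame g.
Proof.
move=> HS g Sg s; suff /HS[] : S (iterD s g) by [].
by elim: s => //= -[i j] s /HS[_ _]; exact.
Qed.

Lemma rtame_diff g x : rtame g -> differentiable g x.
Proof. by move=> /(_ [::])[]. Qed.

Lemma rtame_growth g : rtame g -> exp_growth g.
Proof. by move=> /(_ [::])[]. Qed.

Lemma rtame_continuous g : rtame g -> continuous g.
Proof. by move=> tg x; apply: differentiable_continuous; exact: rtame_diff. Qed.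

(** [foldr] applies the last pair of the list first, so one more inner derivative is absorbed at the
    end of the list. *)
Lemma rtame_Dp i j g : rtame g -> rtame (Dp i j g).
Proof. by move=> tg s; have := tg (rcons s (i, j)); rewrite /iterD foldr_rcons. Qed.

Lemma DpD i j g h : (forall x, differentiable g x) -> (forall x, differentiable h x) ->
  Dp i j (g \+ h) = Dp i j g \+ Dp i j h.
Proof. by move=> dg dh; apply/funext => x; apply: deriveD; exact: diff_derivable. Qed.

Lemma DpM i j g h : (forall x, differentiable g x) -> (forall x, differentiable h x) ->
  Dp i j (g \* h) = (g \* Dp i j h) \+ (h \* Dp i j g).
Proof. by move=> dg dh; apply/funext => x; apply: deriveM; exact: diff_derivable. Qed.

Lemma Dp_cst i j (c : R) : Dp i j (fun _ : 'M[R]_(k, n) => c) = (fun=> 0).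
Proof. by apply/funext => x; exact: derive_cst. Qed.

(** The derivative of a product is a sum of products, so closure under sums and products is proved
    at once on the algebra generated by the tame functions and the constants. *)
Inductive tame_alg : ('M[R]_(k, n) -> R) -> Prop :=
| tame_alg_tame g : rtame g -> tame_alg g
| tame_alg_cst (c : R) : tame_alg (fun=> c)
| tame_algD g h : tame_alg g -> tame_alg h -> tame_alg (g \+ h)
| tame_algM g h : tame_alg g -> tame_alg h -> tame_alg (g \* h).

Lemma tame_alg_rtame g : tame_alg g -> rtame g.
Proof.
apply: (@rtame_class tame_alg) => {g} g; elim => {g}.
- move=> g tg; split => [x||i j]; [exact: rtame_diff|exact: rtame_growth|].
  by apply: tame_alg_tame; exact: rtame_Dp.
- move=> c; split => [x||i j]; [exact: differentiable_cst|exact: exp_growth_cst|].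
  by rewrite Dp_cst; exact: tame_alg_cst.
- move=> g h Tg [dg gg Dg] Th [dh gh Dh]; split => [x||i j].
  + exact: differentiableD.
  + exact: exp_growthD.
  + by rewrite DpD//; exact: tame_algD.
- move=> g h Tg [dg gg Dg] Th [dh gh Dh]; split => [x||i j].
  + exact: differentiableM.
  + exact: exp_growthM.
  + by rewrite DpM//; apply: tame_algD; exact: tame_algM.
Qed.

Lemma rtame_cst (c : R) : rtame (fun _ : 'M[R]_(k, n) => c).
Proof. by apply: tame_alg_rtame; exact: tame_alg_cst. Qed.

Lemma rtameD g h : rtame g -> rtame h -> rtame (g \+ h).
Proof. by move=> *; apply: tame_alg_rtame; apply: tame_algD; exact: tame_alg_tame. Qed.

Lemma rtameM g h : rtame g -> rtame h -> rtame (g \* h).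
Proof. by move=> *; apply: tame_alg_rtame; apply: tame_algM; exact: tame_alg_tame. Qed.

Lemma rtameZ (c : R) g : rtame g -> rtame (fun x => c * g x).
Proof. by move=> tg; apply: (@rtameM (fun=> c)) => //; exact: rtame_cst. Qed.

Lemma rtame_sum (I : Type) (r : seq I) (p : pred I) (G : I -> 'M[R]_(k, n) -> R) :
  (forall i, p i -> rtame (G i)) -> rtame (fun x => \sum_(i <- r | p i) G i x).
Proof.
move=> tG; elim: r => [|i r IH].
  by rewrite (_ : (fun x => _) = fun=> 0); [exact: rtame_cst|apply/funext => x; rewrite big_nil].
case: (boolP (p i)) => pi.
  rewrite (_ : (fun x => _) = G i \+ (fun x => \sum_(i <- r | p i) G i x)).
    by apply: rtameD => //; exact: tG.
  by apply/funext => x; rewrite big_cons pi.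
by under eq_fun do rewrite big_cons (negbTE pi).
Qed.

Lemma Dp_sum (I : Type) (r : seq I) (p : pred I) (G : I -> 'M[R]_(k, n) -> R) i j :
  (forall a, p a -> rtame (G a)) ->
  Dp i j (fun x => \sum_(a <- r | p a) G a x) =
  fun x => \sum_(a <- r | p a) Dp i j (G a) x.
Proof.
move=> tG; elim: r => [|a r IH].
  rewrite (_ : (fun x => _) = fun=> 0); last by apply/funext => x; rewrite big_nil.
  by rewrite Dp_cst; apply/funext => x; rewrite big_nil.
case: (boolP (p a)) => pa; last first.
  under eq_fun do rewrite big_cons (negbTE pa).
  by rewrite IH; apply/funext => x; rewrite big_cons (negbTE pa).
rewrite (_ : (fun x => _) = G a \+ (fun x => \sum_(a <- r | p a) G a x)).
  rewrite DpD; last 2 first.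
  - by move=> x; apply: rtame_diff; exact: tG.
  - by move=> x; apply: rtame_diff; exact: rtame_sum.
  by rewrite IH; apply/funext => x; rewrite big_cons pa.
by apply/funext => x; rewrite big_cons pa.
Qed.

End Basics.

Lemma is_derive_affine (a b s : R) : is_derive s 1 (cst a + b *: (id : R -> R)) b.
Proof.
have h := is_deriveD (is_derive_cst a s 1) (is_deriveZ b (is_derive_id s 1)).
by apply: (is_derive_eq h); exact: etrans (add0r _) (mulr1 b).
Qed.

Section Affine.
Variables k n m : nat.
Variables (b : 'M[R]_(k, n)) (A : 'M[R]_(k, m)).

Let aff (x : 'M[R]_(m, n)) := b + A *m x.

Lemma differentiable_affine x : differentiable aff x.
Proof.
apply: differentiableD; first exact: differentiable_cst.
apply: (@linear_differentiable _ _ _ (mulmx A)).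
apply: bounded_linear_continuous; apply/linear_boundedP; near=> r => y.
rewrite (le_trans (mx_norm_mulmx _ _))// ler_wpM2r//.
Unshelve. all: by end_near. Qed.

Lemma Dp_affine (g : 'M[R]_(k, n) -> R) r j : (forall x, differentiable g x) ->
  Dp r j (g \o aff) = (fun x => \sum_i A i r * Dp i j g x) \o aff.
Proof.
move=> dg; apply/funext => x; rewrite /Dp derive_line /=.
pose c h := h *: (A *m delta_mx r j) + aff x.
rewrite (_ : (fun h => _) = g \o c); last first.
  by apply/funext => h; rewrite /= /aff /c mulmxDr -scalemxAr addrCA addrC.
have c0 : c 0 = aff x by rewrite /c scale0r add0r.
have -> : 'D_1 (g \o c) 0 = \sum_i \sum_j' (A *m delta_mx r j) i j' * Dp i j' g (c 0).
  apply: (@derive_val _ _ _ _ _ _ _ (is_derive_path _ _)) => // i j'.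
  rewrite (_ : (fun s => _) = (A *m delta_mx r j) i j' *: (id : R -> R) + cst (aff x i j')).
    by apply: is_derive_eq; rewrite addr0 [_ *: 1]mulr1.
  by apply/funext => s; rewrite /c !mxE /= mulrC.
rewrite c0; apply: eq_bigr => i _; rewrite (bigD1 j)//= big1 ?addr0.
  rewrite mxE (bigD1 r)//= big1 ?addr0 ?mxE ?eqxx ?mulr1// => l lr.
  by rewrite mxE (negbTE lr) mulr0.
move=> j' jj'; rewrite mxE big1 ?mul0r// => l _.
by rewrite mxE (negbTE jj') andbF mulr0.
Qed.

Lemma exp_growth_affine (g : 'M[R]_(k, n) -> R) :
  exp_growth g -> exp_growth (g \o aff).
Proof.
move=> [c1 [c2 [c10 c20 gc]]].
exists (c1 * expR (c2 * `|b|)), (c2 * (m%:R * `|A|)).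
split; rewrite ?mulr_ge0 ?expR_ge0// => x /=.
rewrite (le_trans (gc _))// -mulrA ler_wpM2l// -expRD ler_expR -mulrA -mulrDr.
by rewrite ler_wpM2l// (le_trans (ler_normD _ _))// lerD2l mx_norm_mulmx.
Qed.

Lemma rtame_affine (g : 'M[R]_(k, n) -> R) : rtame g -> rtame (g \o aff).
Proof.
move=> tg; pose S (h : 'M[R]_(m, n) -> R) := exists2 g, rtame g & h = g \o aff.
apply: (@rtame_class _ _ S); last by exists g.
move=> _ [h th ->]; split=> [x||r j].
- by apply: differentiable_comp; [exact: differentiable_affine|exact: rtame_diff].
- by apply: exp_growth_affine; exact: rtame_growth.
- rewrite Dp_affine; last by move=> x; exact: rtame_diff.
  eexists; last reflexivity.
  by apply: rtame_sum => i _; apply: rtameZ; exact: rtame_Dp.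
Qed.

End Affine.
End RealTame.

(** * Gaussian integration by parts *)

Section Density.
Context {R : realType} d (T : measurableType d).
Variables (mu nu : {measure set T -> \bar R}) (p : T -> R).
Hypotheses (mp : measurable_fun setT p) (p0 : forall x, 0 <= p x).
Hypothesis nuE : forall A, measurable A -> nu A = (\int[mu]_(x in A) (p x)%:E)%E.
Local Open Scope ereal_scope.

Let mpE : measurable_fun setT (EFin \o p).
Proof. exact/measurable_EFinP. Qed.

Import HBNNSimple.

Let integral_density_nnsfun (f : {nnsfun T >-> R}) :
  \int[nu]_x (f x)%:E = \int[mu]_x ((f x)%:E * (p x)%:E).
Proof.
under [LHS]eq_integral do rewrite fimfunE -fsumEFin//.
rewrite [LHS]ge0_integral_fsum//; last 2 first.
  - by move=> r; exact/measurable_EFinP/measurableT_comp.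
  - by move=> n x _; rewrite EFinM nnfun_muleindic_ge0.
under [RHS]eq_integral.
  move=> x xD; rewrite fimfunE -fsumEFin// ge0_mule_fsuml; last first.
    by move=> r; rewrite EFinM nnfun_muleindic_ge0.
  over.
rewrite [RHS]ge0_integral_fsum//; last 2 first.
  - move=> r; apply: emeasurable_funM => //.
    exact/measurable_EFinP/measurableT_comp.
  - move=> n x _; rewrite mule_ge0 ?lee_fin//.
    by have := nnfun_muleindic_ge0 f n x; rewrite -EFinM lee_fin.
apply: eq_fsbigr => r _.
rewrite [LHS]integralZl_indic_nnsfun//=.
under [RHS]eq_integral => x _ do rewrite EFinM -muleA.
have [r0|r0] := ltP r 0%R.
  rewrite (_ : f @^-1` [set r] = set0); last first.
    by apply/seteqP; split => // x /= fx; have : (0 <= f x)%R by []; rewrite fx leNgt r0.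
  rewrite integral_indic// setIT measure0 mule0; apply/esym/integral0_eq => x _.
  by rewrite indicE in_set0 mul0e mule0.
rewrite [RHS]ge0_integralZl//; last 2 first.
  - apply: emeasurable_funM => //; exact/measurable_EFinP/measurable_indic.
  - by move=> x _; rewrite mule_ge0// lee_fin.
congr (_ * _); rewrite integral_indic// setIT nuE// [LHS]integral_mkcond.
apply: eq_integral => x _; rewrite patchE indicE; case: ifP => _ /=.
  by rewrite mul1e.
by rewrite mul0e.
Qed.

Lemma ge0_integral_density (f : T -> \bar R) :
  measurable_fun setT f -> (forall x, 0 <= f x) ->
  \int[nu]_x f x = \int[mu]_x (f x * (p x)%:E).
Proof.
move=> mf f0; pose f_ := nnsfun_approx measurableT mf.
have fp0 n x : 0 <= (f_ n x)%:E * (p x)%:E by rewrite mule_ge0// lee_fin.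
have mfp n : measurable_fun setT (fun x => (f_ n x)%:E * (p x)%:E).
  by apply: emeasurable_funM => //; exact/measurable_EFinP/measurable_funTS.
have ndf x : {homo (f_ ^~ x) : n m / (n <= m)%N >-> (n <= m)%R}.
  by move=> n m nm; exact/lefP/nd_nnsfun_approx.
transitivity (limn (fun n => \int[nu]_x (f_ n x)%:E)).
  rewrite -monotone_convergence//=.
  - by apply: eq_integral => x _; apply/esym/cvg_lim => //; exact: cvg_nnsfun_approx.
  - by move=> n; exact/measurable_EFinP/measurable_funTS.
  - by move=> n x _; rewrite lee_fin.
  - by move=> x _ n m nm; rewrite lee_fin ndf.
transitivity (limn (fun n => \int[mu]_x ((f_ n x)%:E * (p x)%:E))).
  by apply: congr_lim; apply/funext => n /=; exact: integral_density_nnsfun.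
rewrite -monotone_convergence//=.
- apply: eq_integral => x _; apply/cvg_lim => //.
  by apply: cvgeZr => //; exact: cvg_nnsfun_approx.
- by move=> x _ n m nm; rewrite lee_wpmul2r ?lee_fin// ndf.
Qed.

Lemma integrable_density (f : T -> R) : measurable_fun setT f ->
  mu.-integrable setT (fun x => (f x * p x)%:E) ->
  nu.-integrable setT (EFin \o f).
Proof.
move=> mf /integrableP[_ fpoo]; apply/integrableP; split; first exact/measurable_EFinP.
rewrite ge0_integral_density//; last by apply/measurableT_comp => //; exact/measurable_EFinP.
apply: le_lt_trans fpoo; rewrite le_eqVlt; apply/orP; left; apply/eqP.
by apply: eq_integral => x _ /=; rewrite normrM EFinM (ger0_norm (p0 x)).
Qed.

Lemma integral_density (f : T -> R) : measurable_fun setT f ->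
  (\int[nu]_x f x = \int[mu]_x (f x * p x))%R.
Proof.
move=> mf; rewrite /Rintegral integralE [in RHS]integralE; congr (fine (_ - _)).
  rewrite ge0_integral_density//; last by apply: measurable_funepos; exact/measurable_EFinP.
  apply: eq_integral => x _; rewrite !funeposE /= EFinM.
  by rewrite -[in LHS]EFin_max -!EFinM -EFin_max maxr_pMl// mul0r.
rewrite ge0_integral_density//; last by apply: measurable_funeneg; exact/measurable_EFinP.
apply: eq_integral => x _; rewrite !funenegE /= -!EFin_max -EFinM.
by rewrite maxr_pMl// mul0r mulNr.
Qed.

End Density.

(** * The one-dimensional standard Gaussian *)

Section Gauss.
Context {R : realType}.
Notation mu := (@lebesgue_measure R).
Notation phi := (@normal_pdf R 0 1).
Notation gauss := (@normal_prob R 0 1).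

Lemma phiE z : phi z = normal_peak 1 * expR (- z ^+ 2 / 2).
Proof. by rewrite normal_pdfE ?oner_eq0// /normal_fun subr0 expr1n. Qed.

Lemma phi_ge0 z : 0 <= phi z. Proof. exact: normal_pdf_ge0. Qed.

(** The exponents satisfy c|z| - z^2/2 <= 2c^2 - z^2/8, because (c - |z|/2)^2, c^2 and z^2 are
    nonnegative. The Gaussian of deviation 2 is wide enough to absorb the exponential factor. *)
Lemma exp_phi_le (c : R) : exists2 K, 0 <= K &
  forall z, expR (c * `|z|) * phi z <= K * normal_pdf 0 2 z.
Proof.
exists (normal_peak 1 / normal_peak 2 * expR (2 * c ^+ 2)).
  by rewrite mulr_ge0 ?expR_ge0// divr_ge0// normal_peak_ge0.
move=> z; rewrite phiE (@normal_pdfE _ 0 2) ?pnatr_eq0// /normal_fun subr0.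
have p2 : normal_peak (2 : R) != 0 by rewrite gt_eqF// normal_peak_gt0// pnatr_eq0.
rewrite (_ : _ * (normal_peak 2 * _) = normal_peak 1 * (expR (2 * c ^+ 2) * expR (- z ^+ 2 / (2 ^+ 2 *+ 2)))); last by field.
rewrite mulrCA ler_wpM2l ?normal_peak_ge0// -!expRD ler_expR.
have : 0 <= (c - `|z| / 2) ^+ 2 by exact: sqr_ge0.
have : 0 <= c ^+ 2 by exact: sqr_ge0.
have : `|z| ^+ 2 = z ^+ 2 by rewrite real_normK// num_real.
have : 0 <= z ^+ 2 by exact: sqr_ge0.
move: (z ^+ 2) (`|z|) => z2 y h1 h2 h3 h4.
have {}h2 : z2 = y * y by rewrite -h2 expr2.
subst z2. nra.
Qed.

Lemma integrable_exp_phi (c : R) :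
  mu.-integrable setT (fun z => (expR (c * `|z|) * phi z)%:E).
Proof.
have [K K0 cK] := exp_phi_le c.
have iK : mu.-integrable setT (fun z => (K * normal_pdf 0 2 z)%:E).
  under eq_fun do rewrite EFinM.
  by apply: integrableZl => //; exact: integrable_normal_pdf.
apply: (le_integrable measurableT _ _ iK).
  apply/measurable_EFinP/measurable_funM; last exact: measurable_normal_pdf.
  by apply: measurableT_comp => //; apply: measurable_funM => //; exact: measurableT_comp.
move=> z _; rewrite lee_fin ger0_norm ?mulr_ge0 ?expR_ge0 ?phi_ge0//.
by rewrite ger0_norm ?cK// mulr_ge0// normal_pdf_ge0.
Qed.

Lemma integrable_gauss (f : R -> R) (c1 c2 : R) : measurable_fun setT f ->
  (forall z, `|f z| <= c1 * expR (c2 * `|z|)) ->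
  mu.-integrable setT (fun z => (f z * phi z)%:E).
Proof.
move=> mf fc; have iK : mu.-integrable setT (fun z => (c1 * (expR (c2 * `|z|) * phi z))%:E).
  under eq_fun do rewrite EFinM.
  by apply: integrableZl => //; exact: integrable_exp_phi.
apply: (le_integrable measurableT _ _ iK).
  by apply/measurable_EFinP/measurable_funM => //; exact: measurable_normal_pdf.
move=> z _; rewrite lee_fin normrM (ger0_norm (phi_ge0 z)) mulrA.
rewrite [leRHS]ger0_norm ?ler_wpM2r ?phi_ge0//.
by rewrite mulr_ge0 ?phi_ge0// (le_trans _ (fc z)).
Qed.

Lemma Rintegral_gauss (f : R -> R) : measurable_fun setT f ->
  \int[gauss]_z f z = \int[mu]_z (f z * phi z).
Proof.
by move=> mf; apply: integral_density => //; [exact: measurable_normal_pdf|exact: phi_ge0].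
Qed.

Lemma gauss_integrable (f : R -> R) (c1 c2 : R) : measurable_fun setT f ->
  (forall z, `|f z| <= c1 * expR (c2 * `|z|)) ->
  (gauss : measure _ _).-integrable setT (EFin \o f).
Proof.
move=> mf fc; apply: (@integrable_density _ _ _ mu _ phi) => //.
- exact: measurable_normal_pdf.
- exact: phi_ge0.
- exact: integrable_gauss fc.
Qed.

Lemma is_derive_phi (z : R) : is_derive z 1 (phi : R -> R) (- z * phi z).
Proof.
rewrite (_ : (phi : R -> R) = (fun z => normal_peak 1 *: expR (- z ^+ 2 / 2))); last first.
  by apply/funext => x; rewrite phiE.
pose q (z : R) := - z ^+ 2 / 2.
have dq : is_derive z 1 q (- z).
  rewrite (_ : q = (- 2^-1) *: (id ^+ 2 : R -> R)); last first.
    by apply/funext => x; rewrite /q /= [RHS]/(_ *: _) /= mulNr mulNr mulrC.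
  by apply: is_derive_eq; rewrite expr1 /= !scalerA [_ *: 1]mulr1; lra.
have de : is_derive z 1 (expR \o q) (expR (q z) * - z) by exact: is_derive1_comp.
have := is_deriveZ (normal_peak 1) de; rewrite /=.
by move=> h; apply: is_derive_eq h _; rewrite /q /GRing.scale /=; ring.
Qed.

Lemma continuous_phi : continuous phi.
Proof. by apply: continuous_normal_pdf; rewrite oner_eq0. Qed.

Lemma phi_decay (f : R -> R) (c1 c2 : R) :
  (forall z, `|f z| <= c1 * expR (c2 * `|z|)) -> exists K : R,
  forall z, z != 0 -> `|f z * phi z| <= K / z ^+ 2.
Proof.
move=> fc; have [K K0 cK] := exp_phi_le c2.
have c10 : 0 <= c1.
  have := le_trans (normr_ge0 _) (fc 0).
  by rewrite pmulr_lge0// expR_gt0.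
(* The 8 is the denominator in the exponent of the Gaussian of deviation 2: from e^y >= y at y =
   z^2/8 one gets e^(-z^2/8) <= 8/z^2. *)
exists (c1 * K * normal_peak 2 * 8) => z z0.
rewrite normrM (ger0_norm (phi_ge0 z)).
apply: (@le_trans _ _ (c1 * (expR (c2 * `|z|) * phi z))).
  by rewrite mulrA ler_wpM2r// phi_ge0.
apply: (@le_trans _ _ (c1 * (K * normal_pdf 0 2 z))); first by rewrite ler_wpM2l.
rewrite -!mulrA !ler_wpM2l// normal_pdfE ?pnatr_eq0// ler_wpM2l ?normal_peak_ge0//.
rewrite /normal_fun subr0 mulNr expRN.
have z20 : 0 < z ^+ 2 by rewrite exprn_even_gt0.
rewrite -[leRHS]invrK invf_div lef_pV2 ?posrE ?expR_gt0 ?divr_gt0//.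
rewrite (le_trans _ (expR_ge1Dx _))// (_ : 2 ^+ 2 *+ 2 = 8 :> R); last by ring.
by rewrite lerDr.
Qed.

(** Since the derivative of [phi] is -z [phi], the difference of the integrands is the derivative of
    h [phi]. Its integrals over growing intervals converge to the difference of the two sides by
    dominated convergence, and they equal boundary values that vanish at infinity. *)
Lemma gauss_ibp (h dh : R -> R) (c1 c2 : R) :
  (forall z : R, is_derive z 1 h (dh z)) -> continuous dh ->
  (forall z, `|h z| <= c1 * expR (c2 * `|z|)) ->
  (forall z, `|dh z| <= c1 * expR (c2 * `|z|)) ->
  \int[gauss]_z (z * h z) = \int[gauss]_z dh z.
Proof.
move=> hdh cdh hc dhc.
have ch : continuous h.
  by move=> z; apply/differentiable_continuous/derivable1_diffP; case: (hdh z).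
have mh : measurable_fun setT h by exact: continuous_measurable_fun.
have mdh : measurable_fun setT dh by exact: continuous_measurable_fun.
have mid : measurable_fun setT (fun z : R => z * h z) by exact: measurable_funM.
(* The factor z is at most e^|z|, which raises the exponential rate by 1. *)
have zhc z : `|z * h z| <= c1 * expR ((c2 + 1) * `|z|).
  rewrite normrM mulrDl mul1r expRD mulrA mulrC ler_pM//.
  by rewrite (le_trans _ (expR_ge1Dx _))// lerDr.
rewrite !Rintegral_gauss//; apply/eqP; rewrite -subr_eq0 -oppr_eq0 opprB; apply/eqP.
have i1 := integrable_gauss mid zhc.
have i2 := integrable_gauss mdh dhc.
rewrite -RintegralB//.
pose F z := h z * phi z; pose F' z := dh z * phi z - z * h z * phi z.
have dF (z : R) : is_derive z 1 F (F' z).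
  have := is_deriveM (hdh z) (is_derive_phi z).
  by move=> d; apply: is_derive_eq d _; rewrite /F' /GRing.scale /=; ring.
have iF' : mu.-integrable setT (EFin \o F').
  by have := integrableB measurableT i2 i1; apply: eq_integrable => // z _; rewrite /F' /= EFinB.
have cF' : continuous F'.
  move=> z; apply: cvgB; first by apply: cvgM; [exact: cdh|exact: continuous_phi].
  by apply: cvgM; [apply: cvgM; [exact: cvg_id|exact: ch]|exact: continuous_phi].
(* With [N.+1] the interval is nondegenerate and its endpoints are nonzero, as [phi_decay]
   requires. *)
have FN (N : nat) : \int[mu]_z ((F' \_ `[- N.+1%:R, N.+1%:R]) z) = F N.+1%:R - F (- N.+1%:R).
  rewrite -Rintegral_mkcond /Rintegral (@continuous_FTC2 _ F' F)//.
  - by rewrite gtrN.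
  - exact: continuous_subspaceT.
  - split; first by move=> x _; case: (dF x).
      apply: cvg_at_right_filter; apply: differentiable_continuous.
      by apply/derivable1_diffP; case: (dF (- N.+1%:R)).
    apply: cvg_at_left_filter; apply: differentiable_continuous.
    by apply/derivable1_diffP; case: (dF (N.+1%:R)).
  - by move=> x _; rewrite derive1E; case: (dF x).
have lim1 : \int[mu]_z ((F' \_ `[- N.+1%:R, N.+1%:R]) z) @[N --> \oo] --> \int[mu]_z F' z.
  apply: fine_cvg; rewrite fineK ?integrable_fin_num//.
  apply: (@dominated_cvg _ _ _ mu setT measurableT
    (fun N z => ((F' \_ `[- N.+1%:R, N.+1%:R]) z)%:E) (EFin \o F') (fun z => `|F' z|%:E)).
  - move=> N; apply/measurable_EFinP; apply/(measurable_restrictT _ _).1 => //.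
    by apply: measurable_funTS; apply/measurable_EFinP; case/integrableP: iF'.
  - move=> z _; apply: cvg_near_cst; near=> N; congr EFin.
    rewrite patchE mem_set//= in_itv/= -ler_norml.
    have /le_trans : `|z| <= N%:R by near: N; exact: nbhs_infty_ger.
    by apply; rewrite ler_nat.
  - by [].
  - exact: (integrable_abse iF').
  - move=> N z _; rewrite lee_fin patchE; case: ifP => // _.
    by rewrite normr0.
have lim0 : \int[mu]_z ((F' \_ `[- N.+1%:R, N.+1%:R]) z) @[N --> \oo] --> (0 : R).
  have [K hK] := phi_decay hc.
  under eq_fun do rewrite FN.
  apply/cvgrPdist_le => /= e e0; near=> N.
  rewrite sub0r normrN (le_trans (ler_normB _ _))//.
  have N0 : (N.+1%:R : R) != 0 by rewrite pnatr_eq0.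
  have := hK _ N0; have := hK (- N.+1%:R); rewrite oppr_eq0 sqrrN => /(_ N0).
  rewrite -/(F _) -/(F _) => h1 h2.
  rewrite (le_trans (lerD h2 h1))// -mulrDl ler_pdivrMr ?exprn_gt0//.
  have NN : N.+1%:R <= N.+1%:R ^+ 2 :> R by rewrite -natrX ler_nat expnS expn1 leq_pmull.
  apply: (@le_trans _ _ (e * N.+1%:R)); last by rewrite ler_wpM2l// ltW.
  rewrite -ler_pdivrMl// mulrC.
  have /le_trans : (K + K) / e <= N%:R by near: N; exact: nbhs_infty_ger.
  by apply; rewrite ler_nat.
by apply: (cvg_unique _ lim1 lim0).
Unshelve. all: by end_near. Qed.

End Gauss.

(** * Real-valued integrals: sums, Fubini, and measurability through entries *)

Section Expectation.
Context {R : realType}.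

Lemma Rintegral_sum d (T : measurableType d) (mu : {measure set T -> \bar R})
    (I : Type) (s : seq I) (p : pred I) (f : I -> T -> R) :
  (forall i, p i -> mu.-integrable setT (EFin \o f i)) ->
  \int[mu]_x (\sum_(i <- s | p i) f i x) = \sum_(i <- s | p i) \int[mu]_x f i x.
Proof.
move=> fi; elim: s => [|i s IH].
  rewrite big_nil; under eq_Rintegral do rewrite big_nil.
  by rewrite Rintegral_cst// mul0r.
rewrite big_cons -IH; case: (boolP (p i)) => pi; last first.
  by under eq_Rintegral do rewrite big_cons (negbTE pi).
under eq_Rintegral do rewrite big_cons pi.
rewrite RintegralD//; first exact: fi.
have := integrable_sum measurableT s fi.
by apply: eq_integrable => // x _; rewrite /= sumEFin.
Qed.

Lemma integrable_sumR d (T : measurableType d) (mu : {measure set T -> \bar R})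
    (I : Type) (s : seq I) (p : pred I) (f : I -> T -> R) :
  (forall i, p i -> mu.-integrable setT (EFin \o f i)) ->
  mu.-integrable setT (EFin \o (fun x => \sum_(i <- s | p i) f i x)).
Proof.
move=> fi; have := integrable_sum measurableT s fi.
by apply: eq_integrable => // x _; rewrite /= sumEFin.
Qed.

Lemma integrableZlR d (T : measurableType d) (mu : {measure set T -> \bar R})
    (c : R) (f : T -> R) : mu.-integrable setT (EFin \o f) ->
  mu.-integrable setT (EFin \o (fun x => c * f x)).
Proof. by move=> fi; apply: (integrableZl measurableT c fi). Qed.

Lemma integrable_le d (T : measurableType d) (mu : {measure set T -> \bar R})
    (f g : T -> R) : measurable_fun setT f -> (forall x, `|f x| <= g x) ->
  mu.-integrable setT (EFin \o g) -> mu.-integrable setT (EFin \o f).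
Proof.
move=> mf fg gi; apply: (le_integrable measurableT _ _ gi); first exact/measurable_EFinP.
move=> x _; rewrite lee_fin. by rewrite (le_trans (fg x))// ler_norm.
Qed.

Section Product.
Context d1 d2 (T1 : measurableType d1) (T2 : measurableType d2).
Variables (P1 : probability T1 R) (P2 : probability T2 R).

(** Every section is assumed integrable, not almost every one, so that the inner extended-real
    integral is finite and equals its real version at each point. *)
Lemma Rfubini12 (f : T1 * T2 -> R) :
  (P1 \x P2)%E.-integrable setT (EFin \o f) ->
  (forall x, P2.-integrable setT (fun y => (f (x, y))%:E)) ->
  \int[(P1 \x P2)%E]_z f z = \int[P1]_x \int[P2]_y f (x, y).
Proof.
move=> fi f2; rewrite /Rintegral -integral12_prod_meas1//; congr fine.
apply: eq_integral => x _; rewrite /fubini_F /= fineK//.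
exact: (integrable_fin_num measurableT (f2 x)).
Qed.

Lemma Rfubini21 (f : T1 * T2 -> R) :
  (P1 \x P2)%E.-integrable setT (EFin \o f) ->
  (forall y, P1.-integrable setT (fun x => (f (x, y))%:E)) ->
  \int[(P1 \x P2)%E]_z f z = \int[P2]_y \int[P1]_x f (x, y).
Proof.
move=> fi f2; rewrite /Rintegral -integral21_prod_meas1//; congr fine.
apply: eq_integral => x _; rewrite /fubini_G /= fineK//.
exact: (integrable_fin_num measurableT (f2 x)).
Qed.

Lemma integrable_prodM (u : T1 -> R) (v : T2 -> R) :
  P1.-integrable setT (EFin \o u) -> P2.-integrable setT (EFin \o v) ->
  (P1 \x P2)%E.-integrable setT (EFin \o (fun z => u z.1 * v z.2)).
Proof.
move=> ui vi.
have mu : measurable_fun setT u by apply/measurable_EFinP; case/integrableP: ui.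
have mv : measurable_fun setT v by apply/measurable_EFinP; case/integrableP: vi.
apply/integrable12ltyP.
  apply/measurable_EFinP/measurable_funM; first exact: measurableT_comp.
  exact: measurableT_comp.
under eq_integral => x _.
  under eq_integral => y _ do rewrite /= normrM EFinM.
  rewrite ge0_integralZl//; last first.
    by apply/measurable_EFinP/measurableT_comp.
  rewrite -(@fineK _ (\int[P2]_y `|v y|%:E)%E); last first.
    exact: (integrable_fin_num measurableT (integrable_abse vi)).
  over.
rewrite ge0_integralZr//=; last 2 first.
- by apply/measurable_EFinP/measurableT_comp.
- by rewrite lee_fin fine_ge0// integral_ge0.
rewrite lte_mul_pinfty ?integral_ge0//.
- exact: (integrable_fin_num measurableT (integrable_abse ui)).
- by rewrite ltry.
Qed.

(* No integrability is needed: both parts are integrals of nonnegative functions. *)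
Lemma measurable_fun_Rintegral (f : T1 * T2 -> R) : measurable_fun setT f ->
  measurable_fun setT (fun x => \int[P2]_y f (x, y)).
Proof.
move=> mf; have mfE : measurable_fun setT (EFin \o f) by exact/measurable_EFinP.
rewrite (_ : (fun x => _) = fine \o ((fubini_F P2 (EFin \o f)^\+) \- (fubini_F P2 (EFin \o f)^\-))%E); last first.
  apply/funext => x; rewrite /Rintegral integralE /= /fubini_F; congr (fine (_ - _)).
    by apply: eq_integral => y _; rewrite !funeposE.
  by apply: eq_integral => y _; rewrite !funenegE.
apply: measurableT_comp => //; apply: emeasurable_funB.
  by apply: measurable_fun_fubini_tonelli_F => //; exact: measurable_funepos.
by apply: measurable_fun_fubini_tonelli_F => //; exact: measurable_funeneg.
Qed.

End Product.

Definition grid m n (N : nat) (x : 'M[R]_(m, n)) : 'M[int]_(m, n) :=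
  \matrix_(i, j) Num.floor (N.+1%:R * x i j).

Definition ungrid m n (N : nat) (z : 'M[int]_(m, n)) : 'M[R]_(m, n) :=
  \matrix_(i, j) ((z i j)%:~R / N.+1%:R).

Lemma grid_cvg m n (x : 'M[R]_(m, n)) : ungrid N (grid N x) @[N --> \oo] --> x.
Proof.
apply/cvgrPdist_le => /= e e0; near=> N.
apply: mx_norm_le => [|i j]; first exact: ltW.
rewrite !mxE; set y := _ * x i j.
have N0 : 0 < N.+1%:R :> R by rewrite ltr0n.
have -> : x i j - (Num.floor y)%:~R / N.+1%:R = (y - (Num.floor y)%:~R) / N.+1%:R.
  by rewrite mulrBl /y mulrAC divff ?mul1r// gt_eqF.
have /andP[f1 f2] := Num.Theory.floor_itv y.
rewrite ger0_norm; last by rewrite divr_ge0 ?subr_ge0// ltW.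
rewrite ler_pdivrMr// (le_trans (y := 1))//.
  by rewrite lerBlDr addrC -intrD1 ltW.
rewrite -ler_pdivrMl// mulr1.
have /le_trans : e^-1 <= N%:R by near: N; exact: nbhs_infty_ger.
by apply; rewrite ler_nat.
Unshelve. all: by end_near. Qed.

(** Matrices are measured only through their entries. Rounding the entries down to the mesh 1/(N+1)
    leaves countably many values, so [g] of the rounded matrix is measurable piece by piece, and
    continuity of [g] gives the limit. *)
Lemma measurable_comp_continuous d (T : measurableType d) m n
    (g : 'M[R]_(m, n) -> R) (X : T -> 'M[R]_(m, n)) :
  continuous g -> (forall i j, measurable_fun setT (fun w => X w i j)) ->
  measurable_fun setT (g \o X).
Proof.
move=> cg mX.
apply: (@measurable_fun_cvg _ _ _ _ (fun N w => g (ungrid N (grid N (X w))))); last first.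
  move=> w _; apply: (@cvg_comp _ _ _ (fun N => ungrid N (grid N (X w))) g _ (nbhs (X w))).
    exact: grid_cvg.
  exact: cg.
move=> N _ B mB; rewrite setTI.
pose fib (z : 'M[int]_(m, n)) := [set w | grid N (X w) = z].
have mfib z : measurable (fib z).
  rewrite (_ : fib z = \bigcap_(ij in [set: 'I_m * 'I_n])
     ((fun w => N.+1%:R * X w ij.1 ij.2) @^-1` `[(z ij.1 ij.2)%:~R, (z ij.1 ij.2 + 1)%:~R[)).
    apply: fin_bigcap_measurable; first exact: finite_finset.
    move=> [i j] _; rewrite -[X in measurable X]setTI.
    have : measurable_fun setT (fun w => N.+1%:R * X w i j) by exact: measurable_funM.
    exact.
  apply/seteqP; split => w /=.
    move=> <- [i j] _ /=; rewrite in_itv /= mxE.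
    exact: Num.Theory.floor_itv.
  move=> h; apply/matrixP => i j; rewrite mxE.
  apply: floor_def; have := h (i, j) I.
  by rewrite /= in_itv.
pose piece p := if unpickle p is Some z then
    if `[< B (g (ungrid N z)) >] then fib z else set0 else set0.
rewrite (_ : _ @^-1` B = \bigcup_p piece p).
  apply: bigcupT_measurable => p; rewrite /piece.
  by case: unpickle => // z; case: asboolP.
apply/seteqP; split => w /=.
  move=> Bw; exists (pickle (grid N (X w))) => //; rewrite /piece pickleK.
  by case: asboolP.
by move=> [p _]; rewrite /piece; case: unpickle => // z; case: asboolP => // Bz; rewrite /fib /= => ->.
Qed.

End Expectation.

Section Coord.
Context {R : realType} (k n : nat).

Lemma derive_coord (i : 'I_k) (j : 'I_n) (x v : 'M[R]_(k, n)) :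
  'D_v (fun y : 'M[R]_(k, n) => y i j) x = v i j.
Proof.
have := @derive_mx R _ k n id x v (@derivable_id _ _ x v).
by rewrite derive_id => /matrixP /(_ i j); rewrite mxE.
Qed.

Lemma rtame_coord (i : 'I_k) (j : 'I_n) : rtame (fun x : 'M[R]_(k, n) => x i j).
Proof.
pose S (g : 'M[R]_(k, n) -> R) := rtame g \/ g = (fun x => x i j).
apply: (@rtame_class _ _ _ S); last by right.
move=> g [tg|->].
  split=> [x||i' j']; [exact: rtame_diff|exact: rtame_growth|].
  by left; exact: rtame_Dp.
split=> [x||i' j']; first exact: differentiable_coord.
- exists 1, 1; split => // x; rewrite !mul1r (le_trans (le_mx_norm x i j))//.
  by rewrite (le_trans _ (expR_ge1Dx _))// lerDr.
- left; rewrite (_ : Dp i' j' _ = fun=> (delta_mx i' j' : 'M[R]_(k, n)) i j); first exact: rtame_cst.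
  by apply/funext => x; rewrite /Dp derive_coord.
Qed.

End Coord.

Section GaussianField.
Context {R : realType} {k n : nat}.

(* Gaussianity of [X] with covariance [C] across rows (and independent columns)
   in the form of Stein's identity. *)
Record gaussian_field d (T : measurableType d) (P : probability T R)
    (X : T -> 'M[R]_(k, n)) (C : 'M[R]_k) : Prop := GaussianField {
  gf_meas : forall i j, measurable_fun setT (fun w => X w i j) ;
  gf_exp : forall c : R, P.-integrable setT (EFin \o (fun w => expR (c * `|X w|))) ;
  gf_stein : forall g i j, rtame g ->
    \int[P]_w (X w i j * g (X w)) =
    \sum_i' C i i' * \int[P]_w (Dp i' j g (X w)) }.

Lemma measurable_mx_norm d (T : measurableType d) m p (X : T -> 'M[R]_(m, p)) :
  (forall i j, measurable_fun setT (fun w => X w i j)) ->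
  measurable_fun setT (fun w => `|X w|).
Proof. by move=> mX; apply: (measurable_comp_continuous _ mX); exact: norm_continuous. Qed.

Lemma gf_integrable d (T : measurableType d) (P : probability T R) X C g :
  gaussian_field P X C -> rtame g ->
  P.-integrable setT (EFin \o (fun w => g (X w))).
Proof.
move=> gX tg; have [c1 [c2 [c10 c20 gc]]] := rtame_growth tg.
apply: (@integrable_le _ _ _ _ _ (fun w => c1 * expR (c2 * `|X w|))).
- by apply: measurable_comp_continuous; [exact: rtame_continuous|exact: gf_meas gX].
- by move=> w; exact: gc.
- by apply: integrableZlR; exact: gf_exp gX _.
Qed.

End GaussianField.

(** * Stein's identity for standard Gaussian matrices *)

Section StandardGaussian.
Context {R : realType} d (T : measurableType d) (P : probability T R).
Notation gauss := (@normal_prob R 0 1).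

Lemma Rintegral_has_law (X : T -> R) (nu : probability (measurableTypeR R) R) (f : R -> R) :
  has_law P X nu -> measurable_fun setT f ->
  \int[P]_w f (X w) = \int[nu]_s f s.
Proof.
move=> [mX lX] mf; congr fine.
by apply: (@eq_integral_law _ _ _ _ _ _ _ P nu X (id : measurableTypeR R -> measurableTypeR R) mX _ lX (EFin \o f)) => //; exact/measurable_EFinP.
Qed.

Lemma integrable_has_law (X : T -> R) (nu : probability (measurableTypeR R) R) (f : R -> R) :
  has_law P X nu -> measurable_fun setT f ->
  nu.-integrable setT (EFin \o f) -> P.-integrable setT (EFin \o (f \o X)).
Proof.
move=> [mX lX] mf /integrableP[_ fi]; apply/integrableP; split.
  by apply/measurable_EFinP; exact: measurableT_comp.
rewrite (@eq_integral_law _ _ _ _ _ _ _ P nu X (id : measurableTypeR R -> measurableTypeR R) mX _ lX (fun s => `|f s|%:E))//.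
by apply/measurable_EFinP/measurableT_comp.
Qed.

(** Once one coordinate is redrawn from a second copy, the exponential of the sum is a product of
    functions of the two sample points; induction on the number of coordinates does the rest. *)
Lemma iid_gauss_exp (I : finType) (X : I -> T -> R) :
  iid_with_law P [set: I]%SET X gauss -> forall (J : {set I}) (c : R),
  P.-integrable setT (EFin \o (fun w => expR (c * \sum_(i in J) `|X i w|))).
Proof.
move=> [lX iX] J c; have [m] := ubnP #|J|; elim: m J => // m IH J.
have mX i : measurable_fun setT (X i) by case: (lX i (finset.in_setT i)).
have msum (J' : {set I}) d' (T' : measurableType d') (Y : I -> T' -> R) :
    (forall i, measurable_fun setT (Y i)) ->
    measurable_fun setT (fun w => expR (c * \sum_(i in J') `|Y i w|)).
  move=> mY; apply: measurableT_comp => //; apply: measurable_funM => //.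
  under eq_fun do rewrite -big_enum.
  by apply: measurable_sum => i; apply: measurableT_comp.
have [->|[e eJ]] := finset.set_0Vmem J.
  move=> _; rewrite (_ : _ \o _ = cst 1%:E); first exact: finite_measure_integrable_cst.
  by apply/funext => w /=; rewrite big_set0 mulr0 expR0.
rewrite (cardsD1 e) eJ add1n ltnS => /IH {}IH.
have base : P.-integrable setT (EFin \o (fun w => expR (c * `|X e w|))).
  have mf : measurable_fun setT (fun s : R => expR (c * `|s|)).
    by apply: measurableT_comp => //; apply: measurable_funM => //; exact: measurableT_comp.
  apply: (integrable_has_law (lX e (finset.in_setT e)) mf).
  by apply: (@gauss_integrable _ _ 1 c) => // z; rewrite mul1r ger0_norm ?expR_ge0.
have /integrableP[_ fin] := integrable_prodM IH base.
apply/integrableP; split; first exact/measurable_EFinP/msum.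
pose h (x : I -> R) : \bar R := `|(expR (c * \sum_(i in J) `|x i|))%:E|%E.
rewrite (@integral_family_decouple _ _ _ _ _ [set: I]%SET [set e]%SET _ h _ _ _ _ _)//.
- apply: le_lt_trans fin; rewrite le_eqVlt; apply/orP; left; apply/eqP.
  apply: eq_integral => z _; rewrite /h /=; congr (`|_|%:E).
  rewrite -expRD -mulrDr (big_setD1 e)//= finset.in_set1 eqxx addrC.
  have E : \sum_(i in J :\ e) `|if i \in [set e]%SET then X i z.2 else X i z.1| =
      \sum_(i in J :\ e) `|X i z.1|.
    by apply: eq_bigr => i; rewrite !inE => /andP[/negbTE ->].
  by rewrite E.
- apply/multi_measurableP => d' T' Y mY; apply: measurableT_comp => //.
  exact/measurable_EFinP/msum.
- by move=> x y xy; rewrite /h; under eq_bigr do rewrite xy ?inE//.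
Qed.

Lemma mx_norm_delta m p (i : 'I_m) (j : 'I_p) : `|delta_mx i j : 'M[R]_(m, p)| <= 1.
Proof.
apply: mx_norm_le => // i' j'; rewrite mxE.
by case: (_ && _); rewrite ?normr1 ?normr0.
Qed.

(** The entry (i, j) is independent of all the others. With the others fixed, the claim is
    integration by parts along the line through [M0 w] in the direction [del], and Fubini integrates
    the result. *)
Lemma standard_gaussian_field m p (Z : T -> 'M[R]_(m, p)) :
  standard_gaussian_mx P Z -> gaussian_field P Z 1%:M.
Proof.
move=> iZ; have [lZ indZ] := iZ.
have mZ i j : measurable_fun setT (fun w => Z w i j).
  by case: (lZ (i, j) (finset.in_setT _)).
have expZ c : P.-integrable setT (EFin \o (fun w => expR (c * `|Z w|))).
  have := iid_gauss_exp iZ [set: _]%SET `|c|; apply: integrable_le.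
    by apply: measurableT_comp => //; apply: measurable_funM => //; exact: measurable_mx_norm.
  move=> w; rewrite ger0_norm ?expR_ge0// ler_expR.
  rewrite (le_trans (y := `|c| * `|Z w|)) ?ler_wpM2r ?ler_norm//.
  rewrite ler_wpM2l// (le_trans (mx_norm_le_sum _))// pair_big /=.
  by under [leRHS]eq_bigl do rewrite finset.in_setT.
split=> // g i j tg.
transitivity (\int[P]_w Dp i j g (Z w)); last first.
  rewrite (bigD1 i)//= mxE eqxx mul1r big1 ?addr0// => i' ii'.
  by rewrite mxE eq_sym (negbTE ii') mul0r.
pose e := (i, j); pose del : 'M[R]_(m, p) := delta_mx i j.
pose M0 w := Z w - Z w i j *: del.
(* The matrix with entry (i, j) taken from the second sample point and all other entries from the
   first. *)
pose mix (z : T * T) := M0 z.1 + Z z.2 i j *: del.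
have mM0 i' j' : measurable_fun setT (fun w => M0 w i' j').
  rewrite (_ : (fun w => _) = (fun w => Z w i' j' - Z w i j * del i' j')).
    by apply: measurable_funB => //; exact: measurable_funM.
  by apply/funext => w; rewrite /M0 !mxE.
have mmix i' j' : measurable_fun setT (fun z => mix z i' j').
  rewrite (_ : (fun z => _) = (fun z => M0 z.1 i' j' + Z z.2 i j * del i' j')).
    apply: measurable_funD; first exact: (measurableT_comp (mM0 i' j')).
    by apply: measurable_funM => //; exact: (measurableT_comp (mZ i j)).
  by apply/funext => w; rewrite /mix !mxE.
have decouple (f : R -> 'M[R]_(m, p) -> R) :
    (forall d' (T' : measurableType d') (Y : T' -> 'M[R]_(m, p)),
      (forall i j, measurable_fun setT (fun w => Y w i j)) ->
      measurable_fun setT (fun w => f (Y w i j) (Y w))) ->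
    \int[P]_w f (Z w i j) (Z w) = \int[(P \x P)%E]_z f (Z z.2 i j) (mix z).
  move=> mf; congr fine.
  pose mx (x : 'I_m * 'I_p -> R) : 'M[R]_(m, p) := \matrix_(i', j') x (i', j').
  pose h (x : 'I_m * 'I_p -> R) : \bar R := (f (x e) (mx x))%:E.
  have mxZ w : mx (fun ij => Z w ij.1 ij.2) = Z w by apply/matrixP => i' j'; rewrite mxE.
  transitivity (\int[P]_w h (fun ij => Z w ij.1 ij.2))%E.
    by apply: eq_integral => w _; rewrite /h mxZ.
  rewrite (@integral_family_decouple _ _ _ _ _ [set: _]%SET [set e]%SET _ h _ _ _ _ _)//.
  - apply: eq_integral => z _; rewrite /h !inE eqxx /=; congr (f _ _)%:E.
    apply/matrixP => i' j'; rewrite /mix /M0 !mxE finset.in_set1 xpair_eqE.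
    by case: eqVneq => [->|]; case: eqVneq => [->|]; rewrite /= ?mulr1 ?mulr0; lra.
  - apply/multi_measurableP => d' T' Y mY; apply/measurable_EFinP.
    have mxY i' j' : measurable_fun setT (fun w => mx (Y ^~ w) i' j').
      by rewrite (_ : (fun w => _) = Y (i', j'))//; apply/funext => w; rewrite mxE.
    rewrite (_ : (fun w => _) = fun w => f (mx (Y ^~ w) i j) (mx (Y ^~ w))); first exact: (mf _ _ (fun w => mx (Y ^~ w))).
    by apply/funext => w; rewrite mxE.
  - by move=> x y xy; have -> : x = y by apply/funext => ij; apply: xy; rewrite inE.
have bound (g0 : 'M[R]_(m, p) -> R) : rtame g0 -> exists c1 c2 : R,
    [/\ 0 <= c1, 0 <= c2 & forall w s, `|g0 (M0 w + s *: del)| <=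
    c1 * expR (c2 * `|Z w|) * expR (c2 * `|s|)].
  (* The rate doubles because [M0 w] differs from [Z w] only by the entry (i, j), so that its norm
     is at most twice that of [Z w]. *)
  move=> /rtame_growth[c1 [c2 [c10 c20 gc]]]; exists c1, (2 * c2); split=> //.
    by rewrite mulr_ge0.
  move=> w s; rewrite (le_trans (gc _))// -mulrA ler_wpM2l// -expRD ler_expR.
  have del1 := mx_norm_delta i j; rewrite -/del in del1.
  have : `|M0 w + s *: del| <= 2 * `|Z w| + `|s|.
    rewrite (le_trans (ler_normD _ _))// lerD//.
      rewrite (le_trans (ler_normB _ _))// normrZ mulr2n mulrDl mul1r lerD2l.
      by rewrite -[leRHS]mulr1 ler_pM// le_mx_norm.
    by rewrite normrZ -[leRHS]mulr1 ler_pM.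
  move=> /(ler_wpM2l c20) /le_trans; apply.
  have := mulr_ge0 c20 (normr_ge0 s); nra.
(* Needed for [f] the identity, on the side with the factor [Z w i j], and for [f] constantly 1, on
   the side of the derivative. *)
have mixi (f : R -> R) (g0 : 'M[R]_(m, p) -> R) (a : R) : rtame g0 -> measurable_fun setT f ->
    0 <= a -> (forall s, `|f s| <= expR (a * `|s|)) ->
    (P \x P)%E.-integrable setT (EFin \o (fun z => f (Z z.2 i j) * g0 (mix z))) /\
    forall w, P.-integrable setT (fun w2 => (f (Z w2 i j) * g0 (mix (w, w2)))%:E).
  move=> tg0 mf a0 fa; have [c1 [c2 [c10 c20 gc]]] := bound _ tg0.
  have mfg : measurable_fun setT (fun z : T * T => f (Z z.2 i j) * g0 (mix z)).
    apply: measurable_funM.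
      by apply: measurableT_comp => //; exact: (measurableT_comp (mZ i j)).
    by apply: measurable_comp_continuous => //; exact: rtame_continuous.
  have le z : `|f (Z z.2 i j) * g0 (mix z)| <=
      (c1 * expR (c2 * `|Z z.1|)) * expR ((c2 + a) * `|Z z.2|).
    rewrite normrM mulrC (le_trans (ler_pM _ _ (gc _ _) (fa _)))//.
    rewrite -[leLHS]mulrA ler_wpM2l ?mulr_ge0 ?expR_ge0// -expRD ler_expR -mulrDl.
    by rewrite ler_wpM2l ?addr_ge0// le_mx_norm.
  split.
    apply: (integrable_le mfg le).
    by apply: (@integrable_prodM _ _ _ _ _ P P (fun x => c1 * expR (c2 * `|Z x|)) (fun y => expR ((c2 + a) * `|Z y|))); [apply: integrableZlR|].
  move=> w; apply: (@integrable_le _ _ _ _ _ (fun w2 => c1 * expR (c2 * `|Z w|) * expR ((c2 + a) * `|Z w2|))).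
  - by have /(measurableT_comp mfg) : measurable_fun setT (fun w2 : T => (w, w2)) by exact: measurable_fun_pair.
  - by move=> w2; exact: (le (w, w2)).
  - exact: integrableZlR.
rewrite (decouple (fun s x => s * g x)); last first.
  move=> d' T' Y mY; apply: measurable_funM => //.
  by apply: measurable_comp_continuous => //; exact: rtame_continuous.
rewrite (decouple (fun s x => Dp i j g x)); last first.
  move=> d' T' Y mY; apply: measurable_comp_continuous => //.
  by apply: rtame_continuous; exact: rtame_Dp.
have le_id (s : R) : `|id s| <= expR (1 * `|s|).
  by rewrite mul1r (le_trans _ (expR_ge1Dx _))// lerDr.
have le_1 (s : R) : `|(cst 1 : R -> R) s| <= expR (0 * `|s|).
  by rewrite mul0r expR0 normr1.
have [i1 i1'] := mixi id g 1 tg (@measurable_id _ _ _) ler01 le_id.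
have [i2 i2'] := mixi (cst 1) _ 0 (rtame_Dp i j tg) (@measurable_cst _ _ _ _ _ _) (lexx _) le_1.
rewrite Rfubini12//.
under [RHS]eq_Rintegral do rewrite -[Dp i j g _]mul1r.
rewrite Rfubini12//; apply: eq_Rintegral => w _ /=.
have dpath (g0 : 'M[R]_(m, p) -> R) (s : R) : rtame g0 ->
    is_derive s 1 (fun s => g0 (M0 w + s *: del)) (Dp i j g0 (M0 w + s *: del)).
  move=> tg0; set y := M0 w + s *: del.
  have sumE : \sum_i' \sum_j' del i' j' * Dp i' j' g0 y = Dp i j g0 y.
    rewrite (bigD1 i)//= [X in _ + X]big1 ?addr0; last first.
      by move=> i' ii'; rewrite big1// => j' _; rewrite mxE (negbTE ii') mul0r.
    rewrite (bigD1 j)//= big1 ?addr0; last first.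
      by move=> j' jj'; rewrite mxE (negbTE jj') andbF mul0r.
    by rewrite mxE !eqxx mul1r.
  rewrite -sumE; apply: (@is_derive_path R m p g0 (fun s => M0 w + s *: del)); first exact: rtame_diff.
  move=> i' j'; rewrite (_ : (fun s => _) = cst (M0 w i' j') + del i' j' *: (id : R -> R)).
    exact: is_derive_affine.
  by apply/funext => s'; rewrite [LHS]mxE [X in _ + X]mxE mulrC.
have cpath (g0 : 'M[R]_(m, p) -> R) : rtame g0 -> continuous (fun s : R => g0 (M0 w + s *: del)).
  move=> tg0 s; apply/differentiable_continuous/derivable1_diffP.
  by case: (dpath g0 s tg0).
have tDg := rtame_Dp i j tg.
have mpath (g0 : 'M[R]_(m, p) -> R) : rtame g0 -> measurable_fun setT (fun s : R => g0 (M0 w + s *: del)).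
  by move=> tg0; apply: continuous_measurable_fun; exact: cpath.
have lZij : has_law P (fun w => Z w i j) gauss := lZ (i, j) (finset.in_setT _).
rewrite (@Rintegral_has_law _ _ (fun s => s * g (M0 w + s *: del)) lZij); last first.
  by apply: measurable_funM => //; exact: mpath.
rewrite (@Rintegral_has_law _ _ (fun s => 1 * Dp i j g (M0 w + s *: del)) lZij); last first.
  by apply: measurable_funM => //; exact: mpath.
under [RHS]eq_Rintegral do rewrite mul1r.
have [c1 [c2 [c10 c20 gc]]] := bound _ tg.
have [d1 [d2 [d10 d20 hd]]] := bound _ tDg.
apply: (@gauss_ibp _ _ _ (c1 * expR (c2 * `|Z w|) + d1 * expR (d2 * `|Z w|)) (c2 + d2)).
- by move=> s; exact: dpath.
- exact: cpath.
- move=> s; rewrite (le_trans (gc _ _))// ler_pM ?mulr_ge0 ?expR_ge0//.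
    by rewrite lerDl mulr_ge0 ?expR_ge0.
  by rewrite ler_expR ler_wpM2r// lerDl.
- move=> s; rewrite (le_trans (hd _ _))// ler_pM ?mulr_ge0 ?expR_ge0//.
    by rewrite lerDr mulr_ge0 ?expR_ge0.
  by rewrite ler_expR ler_wpM2r// lerDr.
Qed.

End StandardGaussian.

(** * Gaussian interpolation *)

Section Linear.
Context {R : realType} d (T : measurableType d) (P : probability T R).

Lemma measurable_mulmx m k n (B : 'M[R]_(m, k)) (X : T -> 'M[R]_(k, n)) i j :
  (forall i j, measurable_fun setT (fun w => X w i j)) ->
  measurable_fun setT (fun w => (B *m X w) i j).
Proof.
move=> mX; under eq_fun do rewrite mxE.
by apply: measurable_sum => l; apply: measurable_funM.
Qed.

(** Stein's identity is linear and the chain rule transposes [B], so [B] may be rectangular or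
    singular. The degenerate fields of the expansion arise this way. *)
Lemma gf_linear m k n (B : 'M[R]_(m, k)) (X : T -> 'M[R]_(k, n)) C :
  gaussian_field P X C -> gaussian_field P (fun w => B *m X w) (B *m C *m B^T).
Proof.
move=> gX; have mX := gf_meas gX.
split=> [i j|c|g i j tg]; first exact: measurable_mulmx.
  apply: (@integrable_le _ _ _ _ _ (fun w => expR (`|c| * (k%:R * `|B|) * `|X w|))).
  - apply: measurableT_comp => //; apply: measurable_funM => //.
    by apply: measurable_mx_norm => i j; exact: measurable_mulmx.
  - move=> w; rewrite ger0_norm ?expR_ge0// ler_expR.
    rewrite (le_trans (y := `|c| * `|B *m X w|)) ?ler_wpM2r ?ler_norm//.
    by rewrite -mulrA ler_wpM2l// mx_norm_mulmx.
  - exact: gf_exp gX _.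
pose gB := g \o (fun x : 'M[R]_(k, n) => 0 + B *m x).
have tgB : rtame gB by exact: rtame_affine.
have gBE x : gB x = g (B *m x) by rewrite /gB /= add0r.
transitivity (\int[P]_w \sum_r B i r * (X w r j * gB (X w))).
  apply: eq_Rintegral => w _; rewrite gBE mxE mulr_suml.
  by apply: eq_bigr => r _; rewrite mulrA.
have int1 r : P.-integrable setT (EFin \o (fun w => X w r j * gB (X w))).
  exact: (gf_integrable gX (rtameM (rtame_coord r j) tgB)).
rewrite Rintegral_sum; last by move=> r _; exact: integrableZlR.
transitivity (\sum_r \sum_r' \sum_i' B i r * C r r' * B i' r' *
    \int[P]_w Dp i' j g (B *m X w)).
  apply: eq_bigr => r _; rewrite RintegralZl// (gf_stein gX)// mulr_sumr.
  apply: eq_bigr => r' _.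
  have -> : \int[P]_w Dp r' j gB (X w) =
      \sum_i' B i' r' * \int[P]_w Dp i' j g (B *m X w).
    have int2 i' : P.-integrable setT (EFin \o (fun w => Dp i' j g (B *m X w))).
      have := gf_integrable gX (rtame_affine 0 B (rtame_Dp i' j tg)).
      by apply: eq_integrable => // w _ /=; rewrite add0r.
    transitivity (\int[P]_w \sum_i' B i' r' * Dp i' j g (B *m X w)).
      apply: eq_Rintegral => w _; rewrite Dp_affine; last by move=> x; exact: rtame_diff.
      by rewrite /= add0r.
    rewrite Rintegral_sum; last by move=> i' _; exact: integrableZlR.
    by apply: eq_bigr => i' _; rewrite RintegralZl.
  by rewrite !mulr_sumr; apply: eq_bigr => i' _; rewrite !mulrA.
under eq_bigr do rewrite exchange_big; rewrite exchange_big /=.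
apply: eq_bigr => i' _; rewrite mxE mulr_suml.
rewrite exchange_big /=; apply: eq_bigr => r' _.
by rewrite !mxE !mulr_suml; apply: eq_bigr => r _.
Qed.

End Linear.

(** * Linear combinations of independent Gaussian fields *)

Section Combination.
Context {R : realType} {k n : nat} d1 d2 (T1 : measurableType d1)
  (T2 : measurableType d2) (P1 : probability T1 R) (P2 : probability T2 R).
Variables (X1 : T1 -> 'M[R]_(k, n)) (X2 : T2 -> 'M[R]_(k, n)) (C1 C2 : 'M[R]_k).
Hypotheses (g1 : gaussian_field P1 X1 C1) (g2 : gaussian_field P2 X2 C2).

Definition combo (a b : R) (z : T1 * T2) := a *: X1 z.1 + b *: X2 z.2.

Lemma combo_norm a b z : `|combo a b z| <= `|a| * `|X1 z.1| + `|b| * `|X2 z.2|.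
Proof. by rewrite (le_trans (ler_normD _ _))// !normrZ. Qed.

Lemma measurable_combo a b i j : measurable_fun setT (fun z => combo a b z i j).
Proof.
have m1 : measurable_fun setT (fun z : T1 * T2 => X1 z.1 i j).
  exact: (measurableT_comp (gf_meas g1 i j)).
have m2 : measurable_fun setT (fun z : T1 * T2 => X2 z.2 i j).
  exact: (measurableT_comp (gf_meas g2 i j)).
rewrite (_ : (fun z => _) = fun z => a * X1 z.1 i j + b * X2 z.2 i j).
  by apply: measurable_funD; exact: measurable_funM.
by apply/funext => z; rewrite !mxE.
Qed.

Lemma integrable_exp_prod (c1 c2 c3 : R) : (P1 \x P2)%E.-integrable setT
  (EFin \o (fun z => c1 * expR (c2 * `|X1 z.1|) * expR (c3 * `|X2 z.2|))).
Proof.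
apply: (@integrable_prodM _ _ _ _ _ P1 P2 (fun x => c1 * expR (c2 * `|X1 x|))
  (fun y => expR (c3 * `|X2 y|))); last exact: gf_exp g2 _.
by apply: integrableZlR; exact: gf_exp g1 _.
Qed.

Lemma combo_growth (g : 'M[R]_(k, n) -> R) a b : exp_growth g -> exists c1 c2 : R,
  [/\ 0 <= c1, 0 <= c2 & forall z, `|g (combo a b z)| <=
     c1 * expR (c2 * `|X1 z.1|) * expR (c2 * `|X2 z.2|)].
Proof.
move=> [c1 [c2 [c10 c20 gc]]]; exists c1, (c2 * (`|a| + `|b|)).
split=> //; first by rewrite mulr_ge0 ?addr_ge0.
move=> z; rewrite (le_trans (gc _))// -mulrA ler_wpM2l// -expRD ler_expR -mulrDr.
rewrite -mulrA ler_wpM2l// (le_trans (combo_norm _ _ _))// mulrDr.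
by rewrite lerD// ler_wpM2r// ?lerDl ?lerDr.
Qed.

Lemma combo_integrable g a b : rtame g -> [/\
  (P1 \x P2)%E.-integrable setT (EFin \o (fun z => g (combo a b z))),
  forall x, P2.-integrable setT (EFin \o (fun y => g (combo a b (x, y)))) &
  forall y, P1.-integrable setT (EFin \o (fun x => g (combo a b (x, y))))].
Proof.
move=> tg; have [c1 [c2 [c10 c20 gc]]] := combo_growth a b (rtame_growth tg).
have mg : measurable_fun setT (fun z => g (combo a b z)).
  by apply: measurable_comp_continuous (@measurable_combo a b); exact: rtame_continuous.
split.
- by apply: (integrable_le mg gc); exact: integrable_exp_prod.
- move=> x; apply: (@integrable_le _ _ _ _ _ (fun y => c1 * expR (c2 * `|X1 x|) * expR (c2 * `|X2 y|))).
  + exact: (measurableT_comp mg (pair1_measurable x)).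
  + by move=> y; exact: (gc (x, y)).
  + by apply: integrableZlR; exact: gf_exp g2 _.
- move=> y; apply: (@integrable_le _ _ _ _ _ (fun x => c1 * expR (c2 * `|X2 y|) * expR (c2 * `|X1 x|))).
  + exact: (measurableT_comp mg (pair2_measurable y)).
  + by move=> x; rewrite (le_trans (gc (x, y)))// mulrAC.
  + by apply: integrableZlR; exact: gf_exp g1 _.
Qed.

Lemma combo_integrable_coord (Y : T1 * T2 -> 'M[R]_(k, n)) g a b i j : rtame g ->
  (Y = fun z => X1 z.1) \/ (Y = fun z => X2 z.2) -> [/\
  (P1 \x P2)%E.-integrable setT (EFin \o (fun z => Y z i j * g (combo a b z))),
  forall x, P2.-integrable setT (EFin \o (fun y => Y (x, y) i j * g (combo a b (x, y)))) &
  forall y, P1.-integrable setT (EFin \o (fun x => Y (x, y) i j * g (combo a b (x, y))))].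
Proof.
move=> tg YE; have [c1 [c2 [c10 c20 gc]]] := combo_growth a b (rtame_growth tg).
have m1 : measurable_fun setT (fun z : T1 * T2 => X1 z.1 i j).
  exact: (measurableT_comp (gf_meas g1 i j)).
have m2 : measurable_fun setT (fun z : T1 * T2 => X2 z.2 i j).
  exact: (measurableT_comp (gf_meas g2 i j)).
have mY : measurable_fun setT (fun z => Y z i j) by case: YE => ->.
have mg : measurable_fun setT (fun z => Y z i j * g (combo a b z)).
  apply: measurable_funM => //.
  by apply: measurable_comp_continuous (@measurable_combo a b); exact: rtame_continuous.
have Yle z : `|Y z i j| <= expR (`|X1 z.1|) * expR (`|X2 z.2|).
  rewrite -expRD (le_trans _ (expR_ge1Dx _))//.
  have h1 := le_mx_norm (X1 z.1) i j; have h2 := le_mx_norm (X2 z.2) i j.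
  have := normr_ge0 (X1 z.1); have := normr_ge0 (X2 z.2).
  by case: YE => ->; lra.
have le z : `|Y z i j * g (combo a b z)| <=
    c1 * expR ((c2 + 1) * `|X1 z.1|) * expR ((c2 + 1) * `|X2 z.2|).
  rewrite normrM mulrC (le_trans (ler_pM _ _ (gc z) (Yle z)))//.
  by rewrite !mulrDl !mul1r !expRD le_eqVlt; apply/orP; left; apply/eqP; ring.
split.
- by apply: (integrable_le mg le); exact: integrable_exp_prod.
- move=> x; apply: (@integrable_le _ _ _ _ _ (fun y => c1 * expR ((c2 + 1) * `|X1 x|) * expR ((c2 + 1) * `|X2 y|))).
  + exact: (measurableT_comp mg (pair1_measurable x)).
  + by move=> y; exact: (le (x, y)).
  + by apply: integrableZlR; exact: gf_exp g2 _.
- move=> y; apply: (@integrable_le _ _ _ _ _ (fun x => c1 * expR ((c2 + 1) * `|X2 y|) * expR ((c2 + 1) * `|X1 x|))).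
  + exact: (measurableT_comp mg (pair2_measurable y)).
  + by move=> x; rewrite (le_trans (le (x, y)))// mulrAC.
  + by apply: integrableZlR; exact: gf_exp g1 _.
Qed.

Let sumD a i j (g : 'M[R]_(k, n) -> R) y :
  \sum_i' (a%:M : 'M[R]_k) i' i * Dp i' j g y = a * Dp i j g y.
Proof.
rewrite (bigD1 i)//= big1 ?addr0 ?mxE ?eqxx ?mulr1n// => i' ii'.
by rewrite mxE (negbTE ii') mulr0n mul0r.
Qed.

(** With the first sample point fixed, Stein's identity for [X2] is applied to y |-> g(a X1 + b y),
    which is again tame; the chain rule brings out the factor [b]. *)
Lemma combo_stein2 g a b i j : rtame g ->
  \int[(P1 \x P2)%E]_z (X2 z.2 i j * g (combo a b z)) =
  b * \sum_i' C2 i i' * \int[(P1 \x P2)%E]_z Dp i' j g (combo a b z).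
Proof.
move=> tg.
have [i1 i2 _] := combo_integrable_coord a b i j tg (or_intror erefl).
rewrite Rfubini12//=.
have i3 i' := combo_integrable a b (rtame_Dp i' j tg).
under [in RHS]eq_bigr => i' _.
  have [h1 h2 _] := i3 i'; rewrite Rfubini12//.
  over.
have intF i' : P1.-integrable setT (EFin \o (fun x => \int[P2]_y Dp i' j g (combo a b (x, y)))).
  have [h1 h2 _] := i3 i'.
  have := integrable_fubini_F h1; apply: eq_integrable => // x _.
  rewrite /fubini_F /= fineK//; exact: (integrable_fin_num measurableT (h2 x)).
transitivity (\int[P1]_x \sum_i' (b * C2 i i') * \int[P2]_y Dp i' j g (combo a b (x, y))).
  apply: eq_Rintegral => x _.
  pose gx := g \o (fun y : 'M[R]_(k, n) => a *: X1 x + b%:M *m y).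
  have tgx : rtame gx by exact: rtame_affine.
  have := gf_stein g2 i j tgx.
  rewrite (_ : (fun w => _) = fun y => X2 y i j * g (combo a b (x, y))); last first.
    by apply/funext => y; rewrite /gx /combo /= mul_scalar_mx.
  move=> ->; apply: eq_bigr => i' _; rewrite -mulrA mulrCA; congr (_ * _).
  have [_ h2 _] := i3 i'; rewrite -RintegralZl//; apply: eq_Rintegral => y _.
  rewrite Dp_affine; last by move=> ?; exact: rtame_diff.
  by rewrite /= sumD mul_scalar_mx.
rewrite Rintegral_sum; last by move=> i' _; exact: integrableZlR.
by rewrite mulr_sumr; apply: eq_bigr => i' _; rewrite RintegralZl// mulrA.
Qed.

End Combination.

Section Combination1.
Context {R : realType} {k n : nat} d1 d2 (T1 : measurableType d1)
  (T2 : measurableType d2) (P1 : probability T1 R) (P2 : probability T2 R).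
Variables (X1 : T1 -> 'M[R]_(k, n)) (X2 : T2 -> 'M[R]_(k, n)) (C1 C2 : 'M[R]_k).
Hypotheses (g1 : gaussian_field P1 X1 C1) (g2 : gaussian_field P2 X2 C2).

Let combo_swap a b x y : combo X1 X2 a b (x, y) = combo X2 X1 b a (y, x).
Proof. by rewrite /combo /= addrC. Qed.

Lemma combo_stein1 g a b i j : rtame g ->
  \int[(P1 \x P2)%E]_z (X1 z.1 i j * g (combo X1 X2 a b z)) =
  a * \sum_i' C1 i i' * \int[(P1 \x P2)%E]_z Dp i' j g (combo X1 X2 a b z).
Proof.
move=> tg; have := combo_stein2 g2 g1 b a i j tg.
have [i1 _ i2] := combo_integrable_coord g1 g2 a b i j tg (or_introl erefl).
have [j1 j2 _] := combo_integrable_coord g2 g1 b a i j tg (or_intror erefl).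
rewrite (Rfubini21 i1 i2) (Rfubini12 j1 j2) /= => E.
transitivity (\int[P2]_y \int[P1]_x (X1 x i j * g (combo X2 X1 b a (y, x)))).
  by apply: eq_Rintegral => y _; apply: eq_Rintegral => x _; rewrite combo_swap.
rewrite E; congr (_ * _); apply: eq_bigr => i' _; congr (_ * _).
have [h1 _ h2] := combo_integrable g1 g2 a b (rtame_Dp i' j tg).
have [l1 l2 _] := combo_integrable g2 g1 b a (rtame_Dp i' j tg).
rewrite (Rfubini12 l1 l2) (Rfubini21 h1 h2); apply: eq_Rintegral => y _.
by apply: eq_Rintegral => x _; rewrite -combo_swap.
Qed.

Lemma gf_combo a b :
  gaussian_field (P1 \x P2)%E (combo X1 X2 a b) (a ^+ 2 *: C1 + b ^+ 2 *: C2).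
Proof.
split=> [i j|c|g i j tg]; first exact: (measurable_combo g1 g2).
  apply: (@integrable_le _ _ _ _ _ (fun z => 1 * expR (`|c| * `|a| * `|X1 z.1|) *
     expR (`|c| * `|b| * `|X2 z.2|))); last exact: (integrable_exp_prod g1 g2).
    apply: measurableT_comp => //; apply: measurable_funM => //.
    by apply: measurable_mx_norm => i j; exact: (measurable_combo g1 g2).
  move=> z; rewrite ger0_norm ?expR_ge0// mul1r -expRD ler_expR -!mulrA -mulrDr.
  rewrite (le_trans (y := `|c| * `|combo X1 X2 a b z|)) ?ler_wpM2r ?ler_norm//.
  by rewrite ler_wpM2l// combo_norm.
have [i1 _ _] := combo_integrable_coord g1 g2 a b i j tg (or_introl erefl).
have [i2 _ _] := combo_integrable_coord g1 g2 a b i j tg (or_intror erefl).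
transitivity (\int[(P1 \x P2)%E]_z (a * (X1 z.1 i j * g (combo X1 X2 a b z)) +
    b * (X2 z.2 i j * g (combo X1 X2 a b z)))).
  by apply: eq_Rintegral => z _; rewrite !mulrA -mulrDl !mxE.
rewrite RintegralD//; [|exact: integrableZlR..].
rewrite !RintegralZl// combo_stein1// (combo_stein2 g1 g2)// !mulrA -!expr2 !mulr_sumr.
rewrite -big_split /=; apply: eq_bigr => i' _.
by rewrite !mxE mulrDl !mulrA.
Qed.

End Combination1.

Section Growth.
Context {R : realType} {k n : nat}.

Lemma exp_growth_sum (I : Type) (r : seq I) (G : I -> 'M[R]_(k, n) -> R) :
  (forall i, exp_growth (G i)) -> exp_growth (fun x => \sum_(i <- r) G i x).
Proof.
move=> gG; elim: r => [|i r IH].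
  by under eq_fun do rewrite big_nil; exact: exp_growth_cst.
by under eq_fun do rewrite big_cons; exact: exp_growthD.
Qed.

Lemma exp_growth_normr (g : 'M[R]_(k, n) -> R) :
  exp_growth g -> exp_growth (fun x => `|g x|).
Proof.
by move=> [c1 [c2 [c10 c20 gc]]]; exists c1, c2; split=> // x; rewrite normr_id.
Qed.

(** The operator of the edge {i, i'}, and also what a variation of the covariance between rows i and
    i' produces. *)
Definition row_laplacian (i i' : 'I_k) (g : 'M[R]_(k, n) -> R) :=
  fun x => \sum_j Dp i j (Dp i' j g) x.

Lemma rtame_row_laplacian i i' g : rtame g -> rtame (row_laplacian i i' g).
Proof. by move=> tg; apply: rtame_sum => j _; do 2 apply: rtame_Dp. Qed.

End Growth.

(** * The derivative along a Gaussian interpolation *)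

Section Interpolation.
Context {R : realType} {k n : nat} d1 d2 (T1 : measurableType d1)
  (T2 : measurableType d2) (P1 : probability T1 R) (P2 : probability T2 R).
Variables (X1 : T1 -> 'M[R]_(k, n)) (X2 : T2 -> 'M[R]_(k, n)) (C1 C2 : 'M[R]_k).
Hypotheses (g1 : gaussian_field P1 X1 C1) (g2 : gaussian_field P2 X2 C2).

(** The square roots make the covariance affine in [t]. They are not differentiable where they
    vanish, so derivatives are taken inside the interval and the endpoints are reached by
    continuity. *)
Definition interp (t : R) := combo X1 X2 (Num.sqrt (1 - t)) (Num.sqrt t).

Lemma gf_interp t : 0 <= t <= 1 ->
  gaussian_field (P1 \x P2)%E (interp t) ((1 - t) *: C1 + t *: C2).
Proof.
move=> /andP[t0 t1]; have := gf_combo g1 g2 (Num.sqrt (1 - t)) (Num.sqrt t).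
by rewrite !sqr_sqrtr// subr_ge0.
Qed.

Let phi (g : 'M[R]_(k, n) -> R) (t : R) := \int[(P1 \x P2)%E]_z g (interp t z).

(** The interval has 0 and 1 in its interior, so that continuity holds at both ends of the
    interpolation. Beyond them one of the two square roots is 0, by the value of [Num.sqrt] at
    negative numbers. *)
Lemma interp_continuous g : rtame g -> {in `]-1, 2[, continuous (phi g)}.
Proof.
move=> tg; have [c1 [c2 [c10 c20 gc]]] := rtame_growth tg.
have le t z : t \in `]-1, 2[%R -> `|g (interp t z)| <=
    c1 * expR (c2 * 2 * `|X1 z.1|) * expR (c2 * 2 * `|X2 z.2|).
  rewrite in_itv /= => /andP[t1 t2].
  have sq (s : R) : s <= 2 -> `|Num.sqrt s| <= 2.
    move=> s2; rewrite ger0_norm ?sqrtr_ge0// -[leRHS](ger0_norm (ler0n R 2)) -sqrtr_sqr.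
    by rewrite ler_wsqrtr// (le_trans s2)// expr2; lra.
  rewrite (le_trans (gc _))// -!mulrA ler_wpM2l// -expRD ler_expR -mulrDr ler_wpM2l//.
  rewrite (le_trans (combo_norm _ _ _ _ _))// lerD// ler_wpM2r// sq//; last exact: ltW.
  by lra.
apply: (@continuity_under_integral _ _ _ (P1 \x P2)%E (fun t z => g (interp t z)) setT measurableT (-1) 2 _ _
  (fun z => c1 * expR (c2 * 2 * `|X1 z.1|) * expR (c2 * 2 * `|X2 z.2|))).
- by move=> t _; case: (combo_integrable g1 g2 (Num.sqrt (1 - t)) (Num.sqrt t) tg).
- apply: aeW => z _ t _.
  apply: (@cvg_comp _ _ _ (fun t => interp t z) g _ (nbhs (interp t z))); last exact: rtame_continuous.
  apply: cvgD; apply: cvgZr_tmp.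
    apply: (@cvg_comp _ _ _ (fun t => 1 - t) Num.sqrt _ (nbhs (1 - t))); last exact: sqrt_continuous.
    by apply: cvgB; [exact: cvg_cst|exact: cvg_id].
  exact: sqrt_continuous.
- exact: (integrable_exp_prod g1 g2).
- by move=> t It; apply: aeW => z _; apply: le; move: It; rewrite inE.
Qed.

Let dinterp g t z := \sum_i \sum_j ((- (2 * Num.sqrt (1 - t))^-1) * X1 z.1 i j
  + (2 * Num.sqrt t)^-1 * X2 z.2 i j) * Dp i j g (interp t z).

Let is_derive_interp (g : 'M[R]_(k, n) -> R) (t : R) z : rtame g -> t \in `]0, 1[%R ->
  is_derive t 1 (fun t => g (interp t z)) (dinterp g t z).
Proof.
rewrite in_itv /= => tg /andP[t0 t1].
have := @is_derive_path R k n g (interp ^~ z) t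
  (\matrix_(i, j) ((- (2 * Num.sqrt (1 - t))^-1) * X1 z.1 i j
  + (2 * Num.sqrt t)^-1 * X2 z.2 i j)) (rtame_diff _ tg).
rewrite (_ : \sum_i _ = dinterp g t z); last first.
  by apply: eq_bigr => i _; apply: eq_bigr => j _; rewrite mxE.
apply=> i j; rewrite mxE.
have t1' : 0 < 1 - t by rewrite subr_gt0.
have ds1 : is_derive t 1 (Num.sqrt \o (fun t : R => 1 - t)) ((2 * Num.sqrt (1 - t))^-1 * -1).
  have din : is_derive t 1 (fun t : R => 1 - t) (-1).
    rewrite (_ : (fun t => 1 - t) = cst 1 - (id : R -> R))//.
    by apply: is_derive_eq; rewrite sub0r.
  exact: (@is_derive1_comp R Num.sqrt (fun t : R => 1 - t) t _ _ (is_derive1_sqrt t1') din).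

rewrite (_ : (fun s => _) = X1 z.1 i j *: (Num.sqrt \o (fun t : R => 1 - t)) + X2 z.2 i j *: (Num.sqrt : R -> R)).
  have h := is_deriveD (is_deriveZ (X1 z.1 i j) ds1) (is_deriveZ (X2 z.2 i j) (is_derive1_sqrt t0)).
  by apply: (is_derive_eq h); rewrite /GRing.scale /=; ring.
by apply/funext => s; rewrite /interp /combo !mxE mulrC [X in _ + X]mulrC.
Qed.

(** Differentiating the two square roots gives the coefficients -1/(2 sqrt(1 - t)) and 1/(2 sqrt t).
    Stein's identity for each field returns a factor sqrt(1 - t) or sqrt t, and what remains is half
    the difference of the covariances. *)
Lemma is_derive_interp_int (g : 'M[R]_(k, n) -> R) (t : R) : rtame g -> t \in `]0, 1[%R ->
  is_derive t 1 (phi g)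
   (2^-1 * \sum_i \sum_i' (C2 - C1) i i' * phi (row_laplacian i' i g) t).
Proof.
move=> tg t01; have := t01; rewrite in_itv /= => /andP[t0 t1].
(* A neighbourhood of [t] away from 0 and 1, where the derivatives of the square roots are bounded,
   by [K] in total. *)
pose u := t / 2; pose v := (1 + t) / 2.
have uv s : s \in `]u, v[%R -> s \in `]0, 1[%R /\ (u < s < v).
  by rewrite !in_itv /= /u /v => /andP[? ?]; split; apply/andP; split; lra.
have tuv : t \in `]u, v[%R by rewrite in_itv /=; apply/andP; rewrite /u /v; split; lra.
pose f s z := g (interp s z).
pose K := (2 * Num.sqrt (1 - v))^-1 + (2 * Num.sqrt u)^-1.
have K0 : 0 <= K by rewrite addr_ge0// invr_ge0 mulr_ge0// sqrtr_ge0.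
have [c1 [c2 [c10 c20 gc]]] : exp_growth (fun x => \sum_i \sum_j `|Dp i j g x|).
  do 2 (apply: exp_growth_sum => ?); apply: exp_growth_normr.
  by apply: rtame_growth; exact: rtame_Dp.
have der (s : R) z : s \in `]u, v[%R -> is_derive s 1 (f ^~ z) (dinterp g s z).
  by move=> /uv[s01 _]; exact: is_derive_interp.
have sq1 (s : R) : 0 <= s -> s <= 1 -> `|Num.sqrt s| <= 1.
  by move=> s0 s1; rewrite ger0_norm ?sqrtr_ge0// -[leRHS]sqrtr1 ler_wsqrtr.
(* The extra 1 in the rate pays for the entries of [X1] and [X2] that multiply the partial
   derivatives. *)
pose G (z : T1 * T2) := K * (c1 * expR ((c2 + 1) * `|X1 z.1|) * expR ((c2 + 1) * `|X2 z.2|)).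
have iG : (P1 \x P2)%E.-integrable setT (EFin \o G).
  by apply: integrableZlR; exact: (integrable_exp_prod g1 g2).
have Gle s z : s \in `]u, v[%R -> `|dinterp g s z| <= G z.
  move=> suv; have [] := uv _ suv; rewrite in_itv /= => /andP[s0 s1] /andP[us sv].
  have coef i j : `|(- (2 * Num.sqrt (1 - s))^-1) * X1 z.1 i j
      + (2 * Num.sqrt s)^-1 * X2 z.2 i j| <= K * (expR (`|X1 z.1|) * expR (`|X2 z.2|)).
    have a1 : (2 * Num.sqrt (1 - s))^-1 <= (2 * Num.sqrt (1 - v))^-1.
      rewrite lef_pV2 ?posrE ?mulr_gt0 ?sqrtr_gt0 ?subr_gt0//; last by rewrite /v; lra.
      by rewrite ler_pM2l// ler_wsqrtr// lerB// ltW.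
    have a2 : (2 * Num.sqrt s)^-1 <= (2 * Num.sqrt u)^-1.
      rewrite lef_pV2 ?posrE ?mulr_gt0 ?sqrtr_gt0//; last by rewrite /u; lra.
      by rewrite ler_pM2l// ler_wsqrtr// ltW.
    have b1 : `|X1 z.1 i j| <= expR (`|X1 z.1|) * expR (`|X2 z.2|).
      rewrite -expRD (le_trans _ (expR_ge1Dx _))//.
      by have := le_mx_norm (X1 z.1) i j; have := normr_ge0 (X2 z.2); lra.
    have b2 : `|X2 z.2 i j| <= expR (`|X1 z.1|) * expR (`|X2 z.2|).
      rewrite -expRD (le_trans _ (expR_ge1Dx _))//.
      by have := le_mx_norm (X2 z.2) i j; have := normr_ge0 (X1 z.1); lra.
    rewrite (le_trans (ler_normD _ _))// /K [leRHS]mulrDl.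
    have n1 : 0 <= (2 * Num.sqrt (1 - s))^-1 by rewrite invr_ge0 mulr_ge0// sqrtr_ge0.
    have n2 : 0 <= (2 * Num.sqrt s)^-1 by rewrite invr_ge0 mulr_ge0// sqrtr_ge0.
    rewrite lerD//; first by rewrite normrM normrN (ger0_norm n1) ler_pM.
    by rewrite normrM (ger0_norm n2) ler_pM.
  rewrite (le_trans (y := \sum_i \sum_j K * (expR (`|X1 z.1|) * expR (`|X2 z.2|)) * `|Dp i j g (interp s z)|))//.
    rewrite (le_trans (ler_norm_sum _ _ _))//; apply: ler_sum => i _.
    rewrite (le_trans (ler_norm_sum _ _ _))//; apply: ler_sum => j _.
    by rewrite normrM ler_wpM2r.
  under eq_bigr do rewrite -mulr_sumr.
  rewrite -mulr_sumr /G -mulrA ler_wpM2l//.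
  have := gc (interp s z); rewrite ger0_norm; last by do 2 apply: sumr_ge0 => ? _.
  move=> /(ler_wpM2l (mulr_ge0 (expR_ge0 `|X1 z.1|) (expR_ge0 `|X2 z.2|))) /le_trans; apply.
  rewrite mulrCA -mulrA ler_wpM2l// -!expRD ler_expR.
  have : `|interp s z| <= `|X1 z.1| + `|X2 z.2|.
    rewrite (le_trans (combo_norm _ _ _ _ _))// lerD//.
      by rewrite -[leRHS]mul1r ler_wpM2r// sq1//; lra.
    by rewrite -[leRHS]mul1r ler_wpM2r// sq1//; lra.
  by move=> /(ler_wpM2l c20); lra.
have d1f s z : s \in `]u, v[%R -> partial1of2 f s z = dinterp g s z.
  by move=> suv; rewrite partial1of2E; case: (der s z suv).
have intf s : `]u, v[%classic s -> (P1 \x P2)%E.-integrable setT (EFin \o f s).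
  by move=> _; case: (combo_integrable g1 g2 (Num.sqrt (1 - s)) (Num.sqrt s) tg).
have derf s z : `]u, v[%classic s -> [set: T1 * T2] z -> derivable (f ^~ z) s 1.
  by move=> suv _; case: (der s z suv).
have G0 z : 0 <= G z by rewrite !mulr_ge0 ?expR_ge0.
have Gub s z : `]u, v[%classic s -> [set: T1 * T2] z -> `|partial1of2 f s z| <= G z.
  by move=> suv _; rewrite d1f//; exact: Gle.
apply: DeriveDef.
  exact: (derivable_under_integral measurableT tuv intf derf G0 iG Gub).
rewrite -derive1E.
have -> : (phi g)^`() t = \int[(P1 \x P2)%E]_z partial1of2 f t z.
  exact: (differentiation_under_integral measurableT tuv intf derf G0 iG Gub).
under eq_Rintegral do rewrite d1f//.
pose a := Num.sqrt (1 - t); pose b := Num.sqrt t.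
have a0 : a != 0 by rewrite gt_eqF// sqrtr_gt0 subr_gt0.
have b0 : b != 0 by rewrite gt_eqF// sqrtr_gt0.
have ic1 i j : (P1 \x P2)%E.-integrable setT (EFin \o (fun z => X1 z.1 i j * Dp i j g (interp t z))).
  by case: (combo_integrable_coord g1 g2 a b i j (rtame_Dp i j tg) (or_introl erefl)).
have ic2 i j : (P1 \x P2)%E.-integrable setT (EFin \o (fun z => X2 z.2 i j * Dp i j g (interp t z))).
  by case: (combo_integrable_coord g1 g2 a b i j (rtame_Dp i j tg) (or_intror erefl)).
have iD i j i' : (P1 \x P2)%E.-integrable setT (EFin \o (fun z => Dp i' j (Dp i j g) (interp t z))).
  by case: (combo_integrable g1 g2 a b (rtame_Dp i' j (rtame_Dp i j tg))).
transitivity (\sum_i \sum_j (- (2 * a)^-1 * \int[(P1 \x P2)%E]_z (X1 z.1 i j * Dp i j g (interp t z))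
   + (2 * b)^-1 * \int[(P1 \x P2)%E]_z (X2 z.2 i j * Dp i j g (interp t z)))).
  rewrite /dinterp Rintegral_sum; last first.
    move=> i _; apply: integrable_sumR => j _.
    under eq_fun do rewrite mulrDl -!mulrA.
    have := integrableD measurableT (integrableZlR (- (2 * a)^-1) (ic1 i j)) (integrableZlR (2 * b)^-1 (ic2 i j)).
    by apply: eq_integrable => // z _.
  apply: eq_bigr => i _; rewrite Rintegral_sum; last first.
    move=> j _; under eq_fun do rewrite mulrDl -!mulrA.
    have := integrableD measurableT (integrableZlR (- (2 * a)^-1) (ic1 i j)) (integrableZlR (2 * b)^-1 (ic2 i j)).
    by apply: eq_integrable => // z _.
  apply: eq_bigr => j _; rewrite -!RintegralZl// -RintegralD//; last 2 first.
  - exact: integrableZlR.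
  - exact: integrableZlR.
  by apply: eq_Rintegral => z _; rewrite mulrDl !mulrA.
rewrite mulr_sumr; apply: eq_bigr => i _.
transitivity (\sum_j 2^-1 * \sum_i' (C2 - C1) i i' * \int[(P1 \x P2)%E]_z Dp i' j (Dp i j g) (interp t z)).
  apply: eq_bigr => j _.
  rewrite (combo_stein1 g1 g2)//; last exact: rtame_Dp.
  rewrite (combo_stein2 g1 g2)//; last exact: rtame_Dp.
  rewrite -/a -/b !mulrA mulNr.
  rewrite (_ : (2 * a)^-1 * a = 2^-1); last by rewrite invfM mulrAC -mulrA divff ?mulr1.
  rewrite (_ : (2 * b)^-1 * b = 2^-1); last by rewrite invfM mulrAC -mulrA divff ?mulr1.
  rewrite mulNr addrC -mulrBr; congr (_ * _); rewrite -sumrB; apply: eq_bigr => i' _.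
  by rewrite !mxE mulrBl.
rewrite -mulr_sumr exchange_big /=; congr (_ * _); apply: eq_bigr => i' _.
by rewrite -mulr_sumr; congr (_ * _); rewrite /phi /row_laplacian Rintegral_sum.
Qed.

End Interpolation.

Lemma continuous_at_sum (R : realType) (I : Type) (r : seq I) (F : I -> R -> R) (s : R) :
  (forall i, {for s, continuous (F i)}) ->
  {for s, continuous (fun x : R => \sum_(i <- r) F i x)}.
Proof.
move=> cF; elim: r => [|i r IH].
  rewrite (_ : (fun x : R => _) = cst 0); last by apply/funext => x; rewrite big_nil.
  exact: cvg_cst.
rewrite (_ : (fun x : R => _) = F i \+ (fun x => \sum_(i <- r) F i x)); last first.
  by apply/funext => x; rewrite big_cons.
by apply: cvgD; [exact: cF|exact: IH].
Qed.

Section Unique.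
Context {R : realType} {k n : nat} d1 d2 (T1 : measurableType d1)
  (T2 : measurableType d2) (P1 : probability T1 R) (P2 : probability T2 R).
Variables (X1 : T1 -> 'M[R]_(k, n)) (X2 : T2 -> 'M[R]_(k, n)) (C1 C2 : 'M[R]_k).
Hypotheses (g1 : gaussian_field P1 X1 C1) (g2 : gaussian_field P2 X2 C2).
Let phi (g : 'M[R]_(k, n) -> R) (t : R) := \int[(P1 \x P2)%E]_z g (interp X1 X2 t z).

Let Rintegral_prob_cst d (T : measurableType d) (P : probability T R) (c : R) :
  \int[P]_w c = c.
Proof. by rewrite Rintegral_cst// [X in fine X](probability_setT P) mulr1. Qed.

Lemma interp0 g : rtame g -> phi g 0 = \int[P1]_w g (X1 w).
Proof.
move=> tg; have [i1 i2 _] := combo_integrable g1 g2 (Num.sqrt (1 - 0)) (Num.sqrt 0) tg.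
rewrite /phi (Rfubini12 i1 i2); apply: eq_Rintegral => x _.
rewrite -[RHS](Rintegral_prob_cst P2); apply: eq_Rintegral => y _.
by rewrite /combo subr0 sqrtr1 sqrtr0 scale1r scale0r addr0.
Qed.

Lemma interp1 g : rtame g -> phi g 1 = \int[P2]_w g (X2 w).
Proof.
move=> tg; have [i1 _ i2] := combo_integrable g1 g2 (Num.sqrt (1 - 1)) (Num.sqrt 1) tg.
rewrite /phi (Rfubini21 i1 i2); apply: eq_Rintegral => y _.
rewrite -[RHS](Rintegral_prob_cst P1); apply: eq_Rintegral => x _.
by rewrite /combo subrr sqrtr1 sqrtr0 scale1r scale0r add0r.
Qed.

Lemma interp_continuous_at g t : rtame g -> 0 <= t <= 1 -> {for t, continuous (phi g)}.
Proof.
move=> tg /andP[t0 t1]; apply: (interp_continuous g1 g2 tg).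
by rewrite inE /= in_itv /=; apply/andP; split; lra.
Qed.

(** With equal covariances the interpolation has derivative 0, so its two ends agree. The covariance
    therefore determines the field as far as tame functions can tell. *)
Lemma gf_unique g : C1 = C2 -> rtame g -> \int[P1]_w g (X1 w) = \int[P2]_w g (X2 w).
Proof.
move=> CE tg; rewrite -interp0// -interp1//.
have d (t : R) : t \in `]0, 1[%R -> is_derive t 1 (phi g) 0.
  move=> t01; have := is_derive_interp_int g1 g2 tg t01.
  rewrite CE subrr big1 ?mulr0// => i _; rewrite big1// => i' _.
  by rewrite mxE mul0r.
have c : {within `[0, 1], continuous (phi g)}.
  apply: continuous_in_subspaceT => t; rewrite inE /= in_itv /=.
  exact: interp_continuous_at.
have [x _ /eqP] := MVT ltr01 d c.
by rewrite mul0r subr_eq0 => /eqP ->.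
Qed.

(** The interpolation is rescaled to have length [m]. The integrand [kf] is prescribed only in the
    open interval, where later uses have another expression for it; the continuous [kf'] carries the
    fundamental theorem on the closed one. *)
Lemma gf_ftc (g : 'M[R]_(k, n) -> R) (m : R) (Delta : 'M[R]_k) (kf : R -> R) :
  0 < m -> C2 = C1 + m *: Delta -> rtame g ->
  (forall s, 0 < s < m -> kf s = 2^-1 * \sum_i \sum_i' Delta i i' *
     \int[(P1 \x P2)%E]_z row_laplacian i' i g (interp X1 X2 (s / m) z)) ->
  \int[P2]_w g (X2 w) - \int[P1]_w g (X1 w) =
  \int[lebesgue_measure]_(s in `]0, m[) kf s.
Proof.
move=> m0 CE tg kfE.
pose kf' s := 2^-1 * \sum_i \sum_i' Delta i i' * phi (row_laplacian i' i g) (s / m).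
pose F s := phi g (s / m).
have sm s : (0 <= s <= m) = (0 <= s / m <= 1).
  by rewrite ler_pdivrMr// ler_pdivlMr// mul0r mul1r.
have sm' s : (0 < s < m) = (0 < s / m < 1).
  by rewrite ltr_pdivrMr// ltr_pdivlMr// mul0r mul1r.
have cdiv (s : R) : {for s, continuous (fun s : R => s / m)}.
  by apply: cvgM; [exact: cvg_id|exact: cvg_cst].
have cphi h (s : R) : rtame h -> 0 <= s <= m -> {for s, continuous (fun s : R => phi h (s / m))}.
  move=> th; rewrite sm => sm01; apply: continuous_comp; first exact: cdiv.
  exact: interp_continuous_at.
have ckf (s : R) : 0 <= s <= m -> {for s, continuous kf'}.
  move=> s0m; apply: cvgM; first exact: cvg_cst.
  apply: continuous_at_sum => i; apply: continuous_at_sum => i'.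
  apply: cvgM; first exact: cvg_cst.
  by apply: cphi => //; exact: rtame_row_laplacian.
have ckf' : {within `[0, m], continuous kf'}.
  by apply: continuous_in_subspaceT => t; rewrite inE /= in_itv /=; exact: ckf.
have dF (s : R) : 0 < s < m -> is_derive s 1 F (kf' s).
  rewrite sm' => s01.
  have s01' : s / m \in `]0, 1[%R by rewrite in_itv.
  have D1 := is_derive_interp_int g1 g2 tg s01'.
  have D2 : is_derive s 1 (fun s : R => s / m) m^-1.
    rewrite (_ : (fun s => _) = m^-1 *: (id : R -> R)); last first.
      by apply/funext => x; rewrite mulrC.
    by apply: is_derive_eq; rewrite [_ *: 1]mulr1.
  have := @is_derive1_comp R (phi g) (fun s => s / m) s _ _ D1 D2.
  move=> h; apply: (is_derive_eq h); rewrite /kf' -mulrA; congr (_ * _).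
  rewrite mulr_suml; apply: eq_bigr => i _; rewrite mulr_suml; apply: eq_bigr => i' _.
  rewrite CE !mxE addrC addKr mulrAC; congr (_ * _).
  by rewrite mulrAC divff ?mul1r// gt_eqF.
have ikf' : lebesgue_measure.-integrable `[0, m] (EFin \o kf').
  by apply: continuous_compact_integrable => //; exact: segment_compact.
transitivity (\int[lebesgue_measure]_(s in `[0, m]) kf' s).
  rewrite /Rintegral (@continuous_FTC2 _ kf' F)//.
  - by rewrite /= /F mul0r divff ?gt_eqF// interp0// interp1.
  - split.
    + by move=> s; rewrite in_itv /= => /dF[].
    + by apply: cvg_at_right_filter; apply: cphi => //; rewrite lexx ltW.
    + by apply: cvg_at_left_filter; apply: cphi => //; rewrite lexx ltW.
  - by move=> s; rewrite in_itv /= derive1E => /dF[].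
have ikf2 : lebesgue_measure.-integrable `]0, m] (EFin \o kf').
  by apply: integrableS ikf' => //; apply: subset_itvr; rewrite bnd_simp.
have ikf3 : lebesgue_measure.-integrable `]0, m[ (EFin \o kf').
  by apply: integrableS ikf2 => //; apply: subset_itvl; rewrite bnd_simp.
rewrite -Rintegral_itv_obnd_cbnd// -Rintegral_itv_bndo_bndc//.
apply: eq_Rintegral => s; rewrite inE /= in_itv /= => s0m.
by rewrite kfE.
Qed.

End Unique.

(** * The positive definite square root *)

Lemma cvg_sumR (R : realType) (T I : Type) (F : set_system T) (FF : Filter F)
    (r : seq I) (f : I -> T -> R) (a : I -> R) :
  (forall i, True -> f i x @[x --> F] --> a i) ->
  \sum_(i <- r) f i x @[x --> F] --> \sum_(i <- r) a i.
Proof.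
move=> fa; elim: r => [|i r IH].
  by rewrite big_nil; under eq_cvg do rewrite big_nil; exact: cvg_cst.
rewrite big_cons; under eq_cvg do rewrite big_cons.
by apply: cvgD => //; exact: fa.
Qed.

Section OperatorBound.
Context {R : realType} {k : nat}.
Implicit Types (u v w : 'cV[R]_k) (M N : 'M[R]_k).

Definition form M u v : R := (u^T *m M *m v) 0 0.
Definition dot u v : R := (u^T *m v) 0 0.
Definition enorm u : R := Num.sqrt (dot u u).

Lemma dotE u v : dot u v = \sum_i u i 0 * v i 0.
Proof. by rewrite /dot mxE; apply: eq_bigr => i _; rewrite mxE. Qed.

Lemma form_dot M u v : form M u v = dot u (M *m v).
Proof. by rewrite /form /dot mulmxA. Qed.

Lemma dot_ge0 u : 0 <= dot u u.
Proof. by rewrite dotE; apply: sumr_ge0 => i _; rewrite -expr2 sqr_ge0. Qed.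

Lemma dot_eq0 u : dot u u = 0 -> u = 0.
Proof.
rewrite dotE => /eqP; rewrite psumr_eq0; last by move=> i _; rewrite -expr2 sqr_ge0.
move=> /allP u0; apply/matrixP => i j; rewrite !mxE (ord1 j); apply/eqP.
by have := u0 i (mem_index_enum i); rewrite /= mulf_eq0 orbb.
Qed.

Lemma enorm_ge0 u : 0 <= enorm u. Proof. exact: sqrtr_ge0. Qed.

Lemma enorm_sqr u : enorm u ^+ 2 = dot u u.
Proof. by rewrite sqr_sqrtr// dot_ge0. Qed.

Lemma enorm0 : enorm 0 = 0.
Proof. by rewrite /enorm /dot mulmx0 mxE sqrtr0. Qed.

Lemma enorm_eq0 u : enorm u = 0 -> u = 0.
Proof. by move=> u0; apply: dot_eq0; rewrite -enorm_sqr u0 expr0n. Qed.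

Lemma formDl M u v w : form M (u + v) w = form M u w + form M v w.
Proof. by rewrite /form linearD /= !mulmxDl mxE. Qed.

Lemma formDr M u v w : form M w (u + v) = form M w u + form M w v.
Proof. by rewrite /form mulmxDr mxE. Qed.

Lemma formZl M a u v : form M (a *: u) v = a * form M u v.
Proof. by rewrite /form linearZ /= -!scalemxAl mxE. Qed.

Lemma formZr M a u v : form M u (a *: v) = a * form M u v.
Proof. by rewrite /form -!scalemxAr mxE. Qed.

Lemma formD M N u v : form (M + N) u v = form M u v + form N u v.
Proof. by rewrite /form mulmxDr mulmxDl mxE. Qed.

Lemma formZ M a u v : form (a *: M) u v = a * form M u v.
Proof. by rewrite /form -scalemxAr -scalemxAl mxE. Qed.

Lemma form1 u v : form 1%:M u v = dot u v.
Proof. by rewrite /form mulmx1. Qed.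

Lemma form_sym M u v : M^T = M -> form M u v = form M v u.
Proof.
move=> Ms; rewrite /form (_ : u^T *m M *m v = (v^T *m M *m u)^T) ?mxE//.
by rewrite !trmx_mul trmxK Ms mulmxA.
Qed.

Lemma form_delta M i j : form M (delta_mx i 0) (delta_mx j 0) = M i j.
Proof. by rewrite /form trmx_delta -rowE -colE !mxE. Qed.

Lemma enorm_delta (i : 'I_k) : enorm (delta_mx i 0) = 1.
Proof. by rewrite /enorm -form1 form_delta mxE eqxx sqrtr1. Qed.

(** A bound on the operator norm, stated through the bilinear form so that no supremum is taken. *)
Definition bounded_form r M := forall u v, `|form M u v| <= r * enorm u * enorm v.

Lemma bounded_formD r s M N : bounded_form r M -> bounded_form s N ->
  bounded_form (r + s) (M + N).
Proof.
move=> bM bN u v; rewrite formD (le_trans (ler_normD _ _))//.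
by rewrite !mulrDl lerD.
Qed.

Lemma bounded_formZ r a M : bounded_form r M -> bounded_form (`|a| * r) (a *: M).
Proof. by move=> bM u v; rewrite formZ normrM -!mulrA ler_wpM2l// mulrA. Qed.

Lemma bounded_form_le r s M : r <= s -> bounded_form r M -> bounded_form s M.
Proof.
move=> rs bM u v; rewrite (le_trans (bM u v))// ler_wpM2r ?enorm_ge0//.
by rewrite ler_wpM2r ?enorm_ge0.
Qed.

Lemma bounded_formM r s M N : 0 <= r -> 0 <= s -> bounded_form r M -> bounded_form s N ->
  bounded_form (r * s) (M *m N).
Proof.
move=> r0 s0 bM bN u v; pose w := N *m v.
have -> : form (M *m N) u v = form M u w by rewrite /form /w !mulmxA.
rewrite (le_trans (bM u w))//.
have -> : r * s * enorm u * enorm v = r * enorm u * (s * enorm v) by ring.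
rewrite ler_wpM2l ?mulr_ge0 ?enorm_ge0//.
(* Testing the bound for [N] on the pair w, v with w = N v gives |w|^2 <= s |w| |v|. *)
have := bN w v; rewrite form_dot -/w -enorm_sqr ger0_norm ?sqr_ge0//.
have := enorm_ge0 w; rewrite le_eqVlt => /orP[/eqP <- _|w0].
  by rewrite mulr_ge0 ?enorm_ge0.
by rewrite expr2 mulrAC ler_pM2r// mulrC.
Qed.

Lemma bounded_form_entry r M i j : bounded_form r M -> `|M i j| <= r.
Proof.
by move=> /(_ (delta_mx i 0) (delta_mx j 0)); rewrite form_delta !enorm_delta !mulr1.
Qed.

(** Polarisation and the parallelogram law bound the form by r(|u|^2 + |v|^2)/2, which is [r] on
    unit vectors; homogeneity gives the general case. *)
Lemma bounded_form_quad r M : M^T = M ->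
  (forall u, `|form M u u| <= r * dot u u) -> bounded_form r M.
Proof.
move=> Ms Mr.
have half u v : `|form M u v| <= r * (dot u u + dot v v) / 2.
  have E1 : form M (u + v) (u + v) - form M (u - v) (u - v) = 4 * form M u v.
    by rewrite -[- v]scaleN1r !formDl !formDr !formZl !formZr (form_sym v u Ms); ring.
  have E2 : dot (u + v) (u + v) + dot (u - v) (u - v) = 2 * (dot u u + dot v v).
    by rewrite -[- v]scaleN1r -!form1 !formDl !formDr !formZl !formZr; ring.
  have := Mr (u + v); have := Mr (u - v).
  rewrite !ler_norml => /andP[h1 h2] /andP[h3 h4]; apply/andP; split; nra.
move=> u v.
have [->|u0] := eqVneq u 0.
  by rewrite enorm0 mulr0 mul0r /form linear0 !mul0mx mxE normr0.
have [->|v0] := eqVneq v 0.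
  by rewrite enorm0 mulr0 /form mulmx0 mxE normr0.
have nu : enorm u != 0 by apply: contra_neq u0; exact: enorm_eq0.
have nv : enorm v != 0 by apply: contra_neq v0; exact: enorm_eq0.
have := half ((enorm u)^-1 *: u) ((enorm v)^-1 *: v).
rewrite -!form1 !formZl !formZr !form1 -!enorm_sqr.
have -> : (enorm u)^-1 * ((enorm u)^-1 * enorm u ^+ 2) = 1 by field.
have -> : (enorm v)^-1 * ((enorm v)^-1 * enorm v ^+ 2) = 1 by field.
rewrite (_ : r * (1 + 1) / 2 = r); last by field.
rewrite mulrA -invfM normrM [X in X * _]ger0_norm ?invr_ge0 ?mulr_ge0 ?enorm_ge0// => h.
by rewrite -mulrA mulrC -ler_pdivrMl// mulr_gt0 ?lt0r ?nu ?nv ?enorm_ge0.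
Qed.

End OperatorBound.

(** * Square roots by a contracting iteration *)

Section SquareRoot.
Context {R : realType} {k : nat}.
Implicit Types (X M A B : 'M[R]_k).

(* The iteration [Y := (X + Y^2) / 2] converges to [1 - sqrt (1 - X)]. *)
Fixpoint sqrt_iter X n : 'M[R]_k :=
  if n is n'.+1 then 2^-1 *: (X + sqrt_iter X n' *m sqrt_iter X n') else 0.

(* The limit of the iteration; the upper limit makes it a measurable function of
   [X] even where the iteration diverges. *)
Definition sqrt_lim X : 'M[R]_k :=
  \matrix_(i, j) fine (limn_esup (fun n => (sqrt_iter X n i j)%:E)).

Lemma fine_limn_esup (u : R^nat) : cvgn u -> fine (limn_esup (EFin \o u)) = limn u.
Proof.
move=> cu; have cE : (EFin \o u) n @[n --> \oo] --> (limn u)%:E by apply/fine_cvgP; split => //; exact: nearW.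
by rewrite is_cvg_limn_esupE ?(cvg_lim _ cE)//; apply/cvg_ex; exists (limn u)%:E.
Qed.

Section Contraction.
Variables (X : 'M[R]_k) (r : R).
Hypotheses (r0 : 0 <= r) (r1 : r < 1) (bX : bounded_form r X).

Lemma sqrt_iter_bound n : bounded_form r (sqrt_iter X n).
Proof.
elim: n => [|n IH] /=.
  by move=> u v; rewrite /form mulmx0 mul0mx mxE normr0 !mulr_ge0 ?enorm_ge0.
apply: bounded_form_le (bounded_formZ _ (bounded_formD bX (bounded_formM r0 r0 IH IH))).
have : r * r <= r by rewrite ler_piMl// ltW.
by rewrite ger0_norm ?invr_ge0//; lra.
Qed.

(** A difference of squares splits as Y2 (Y2 - Y1) + (Y2 - Y1) Y1 without commutativity. The
    iterates are bounded by [r], and the factor 1/2 compensates the two terms, so increments shrink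
    by [r]. *)
Lemma sqrt_iter_step n : bounded_form (r ^+ n.+1) (sqrt_iter X n.+1 - sqrt_iter X n).
Proof.
elim: n => [|n IH].
  rewrite /= mulmx0 addr0 subr0 expr1.
  apply: bounded_form_le (bounded_formZ _ bX).
  by rewrite ger0_norm ?invr_ge0// ler_piMl// invf_le1// ler1n.
set Y2 := sqrt_iter X n.+1; set Y1 := sqrt_iter X n.
have -> : sqrt_iter X n.+2 - sqrt_iter X n.+1 =
    2^-1 *: (Y2 *m (Y2 - Y1) + (Y2 - Y1) *m Y1).
  rewrite [LHS](_ : _ = 2^-1 *: (X + Y2 *m Y2) - 2^-1 *: (X + Y1 *m Y1))//.
  rewrite -scalerBr; congr (_ *: _).
  by rewrite mulmxBr mulmxBl addrA subrK opprD addrACA subrr add0r.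
have rn : 0 <= r ^+ n.+1 by exact: exprn_ge0.
have b1 := bounded_formM r0 rn (sqrt_iter_bound n.+1) IH.
have b2 := bounded_formM rn r0 IH (sqrt_iter_bound n).
apply: bounded_form_le (bounded_formZ 2^-1 (bounded_formD b1 b2)).
rewrite ger0_norm ?invr_ge0// [r ^+ n.+2]exprS.
by move: (r ^+ n.+1) rn => y y0; nra.
Qed.

Lemma sqrt_iter_cvg i j : sqrt_iter X n i j @[n --> \oo] --> sqrt_lim X i j.
Proof.
rewrite mxE; set a := fun n => sqrt_iter X n i j.
pose da n : R := a n.+1 - a n.
have aE : a = series da.
  apply/funext => n; rewrite /series /= telescope_sumr//.
  by rewrite (_ : a 0%N = 0) ?subr0// /a /= mxE.
suff cda : cvgn (series da).
  rewrite -[X in fine (limn_esup X)]/(EFin \o a) fine_limn_esup aE//.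
apply: normed_cvg; apply: (@series_le_cvg _ _ (geometric 1 r)).
- by move=> n /=.
- by move=> n /=; rewrite mul1r exprn_ge0.
- move=> n /=; rewrite mul1r.
  have := bounded_form_entry i j (sqrt_iter_step n); rewrite !mxE => h.
  rewrite (le_trans (y := r ^+ n.+1))//.
    by move: h; rewrite /da /a /= !mxE.
  by rewrite exprS ler_piMl ?exprn_ge0// ltW.
- by apply: is_cvg_geometric_series; rewrite ger0_norm.
Qed.

Lemma sqrt_lim_eq : sqrt_lim X = 2^-1 *: (X + sqrt_lim X *m sqrt_lim X).
Proof.
apply/matrixP => i j.
have c1 : sqrt_iter X n.+1 i j @[n --> \oo] --> sqrt_lim X i j.
  have := @sqrt_iter_cvg i j; rewrite -(cvg_shiftS (fun n => sqrt_iter X n i j)).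
  exact.
have c2 : sqrt_iter X n.+1 i j @[n --> \oo] --> 2^-1 * (X i j + \sum_l sqrt_lim X i l * sqrt_lim X l j).
  rewrite (_ : (fun n => _) = (fun n => 2^-1 * (X i j + \sum_l sqrt_iter X n i l * sqrt_iter X n l j))); last first.
    by apply/funext => n; rewrite /= !mxE.
  apply: cvgM; first exact: cvg_cst.
  apply: cvgD; first exact: cvg_cst.
  apply: cvg_sumR => l _.
  by apply: cvgM; exact: sqrt_iter_cvg.
rewrite [LHS](cvg_unique _ c1 c2)// [RHS]mxE; congr (_ * _).
by rewrite [RHS]mxE; congr (_ + _); rewrite [RHS]mxE.
Qed.

Lemma sqrt_lim_bound : bounded_form r (sqrt_lim X).
Proof.
move=> u v.
have c : `|form (sqrt_iter X n) u v| @[n --> \oo] --> `|form (sqrt_lim X) u v|.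
  apply: cvg_norm.
  have fE M : form M u v = \sum_j (\sum_i u i 0 * M i j) * v j 0.
    by rewrite /form mxE; apply: eq_bigr => j _; rewrite mxE; congr (_ * _); apply: eq_bigr => i _; rewrite mxE.
  rewrite fE; under eq_fun do rewrite fE.
  apply: cvg_sumR => j _; apply: cvgM; last exact: cvg_cst.
  apply: cvg_sumR => i _; apply: cvgM; first exact: cvg_cst.
  exact: sqrt_iter_cvg.
rewrite -(cvg_lim _ c)//; apply: limr_le; first by apply/cvg_ex; eexists; exact: c.
by apply: nearW => n; exact: sqrt_iter_bound.
Qed.

Lemma sqrt_lim_sym : X^T = X -> (sqrt_lim X)^T = sqrt_lim X.
Proof.
move=> Xs; have it n : (sqrt_iter X n)^T = sqrt_iter X n.
  elim: n => [|n IH] /=; first by rewrite linear0.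
  by rewrite linearZ /= linearD /= trmx_mul IH Xs.
by apply/matrixP => i j; rewrite !mxE; congr (fine (limn_esup _)); apply/funext => n; rewrite -{1}(it n) mxE.
Qed.

End Contraction.

(** With D = B - B' and M = B + B', equality of the squares gives DM + MD = 0. Then the trace of DMD
    equals its own opposite, hence vanishes; as M is positive definite, every column of D is 0. *)
Lemma positive_definite_sqrt_unique B B' :
  positive_definite B -> positive_definite B' -> B *m B = B' *m B' -> B = B'.
Proof.
move=> [Bs Bp] [Bs' Bp'] BB; pose D := B - B'; pose M := B + B'.
have Ds : D^T = D by rewrite /D linearB /= Bs Bs'.
have DM : D *m M + M *m D = 0.
  by rewrite /D /M !mulmxDl !mulmxDr !mulNmx !mulmxN BB; apply/matrixP => i j; rewrite !mxE; ring.
have tr0 : \tr (D *m M *m D) = 0.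
  have e1 : \tr (D *m M *m D) = \tr (D *m (D *m M)) by rewrite mxtrace_mulC.
  have e2 : \tr (D *m M *m D) = - \tr (D *m (D *m M)).
    have MD : M *m D = - (D *m M) by apply/eqP; rewrite -addr_eq0 addrC DM.
    by rewrite -mulmxA MD mulmxN linearN.
  by lra.
have quad j : 0 <= form M (col j D) (col j D).
  have [->|d0] := eqVneq (col j D) 0; first by rewrite /form mulmx0 mxE.
  by rewrite /form /M mulmxDr mulmxDl mxE addr_ge0// ltW ?Bp ?Bp'.
have trE : \tr (D *m M *m D) = \sum_j form M (col j D) (col j D).
  apply: eq_bigr => j _; rewrite /form tr_col Ds.
  rewrite -row_mul mxE [RHS]mxE; apply: eq_bigr => l _.
  by rewrite [row _ _ _ _]mxE [col _ _ _ _]mxE.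
apply/eqP; rewrite -subr_eq0 -/D; apply/eqP/matrixP => i j; rewrite [RHS]mxE.
have : form M (col j D) (col j D) == 0.
  move: tr0; rewrite trE => /eqP; rewrite psumr_eq0// => /allP /(_ j).
  by rewrite mem_index_enum; apply.
have [d0 _|d0] := eqVneq (col j D) 0.
  by have := congr1 (fun v : 'cV_k => v i 0) d0; rewrite !mxE.
rewrite /form /M mulmxDr mulmxDl mxE gt_eqF//.
by rewrite addr_gt0// ?Bp ?Bp'.
Qed.

(** Writing A = c(1 - X), the iteration yields 1 - sqrt(1 - X), hence the root of A. Unlike
    [sqrt_mx], this is an explicit limit and so depends measurably on A; [c] is to be an upper bound
    of the quadratic form of A. *)
Definition sqrt_pd (c : R) A : 'M[R]_k := Num.sqrt c *: (1%:M - sqrt_lim (1%:M - c^-1 *: A)).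

Section Root.
Variables (A : 'M[R]_k) (c lam : R).
Hypotheses (As : A^T = A) (lam0 : 0 < lam) (lamc : lam <= c).
Hypothesis (quadA : forall u, lam * dot u u <= form A u u <= c * dot u u).

Let X := 1%:M - c^-1 *: A.
Let r := 1 - lam / c.

Let c0 : 0 < c. Proof. exact: lt_le_trans lamc. Qed.

Lemma root_r : 0 <= r < 1.
Proof.
by rewrite /r subr_ge0 ler_pdivrMr// mul1r lamc ltrBlDr ltrDl divr_gt0.
Qed.

Let Xs : X^T = X. Proof. by rewrite /X linearB /= linearZ /= trmx1 As. Qed.

(** A spectrum of A inside [lam, c] puts the spectrum of X = 1 - A/c inside [0, 1 - lam/c], where
    the iteration contracts. *)
Lemma root_bound : bounded_form r X.
Proof.
apply: bounded_form_quad => // u; have /andP[h1 h2] := quadA u.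
rewrite /X formD -[- (_ *: A)]scaleN1r formZ formZ form1 mulN1r.
have d0 := dot_ge0 u.
have i1 : c^-1 * form A u u <= dot u u by rewrite mulrC ler_pdivrMr// mulrC.
have i2 : lam / c * dot u u <= c^-1 * form A u u.
  by rewrite mulrAC mulrC ler_wpM2l// invr_ge0 ltW.
rewrite ger0_norm ?subr_ge0// /r mulrBl mul1r.
by rewrite lerB.
Qed.

Lemma sqrt_pdK : sqrt_pd c A *m sqrt_pd c A = A.
Proof.
have /andP[r0 r1] := root_r; rewrite /sqrt_pd -/X.
have YE := sqrt_lim_eq r0 r1 root_bound; set Y := sqrt_lim X in YE *.
rewrite -scalemxAl -scalemxAr scalerA -expr2 sqr_sqrtr ?ltW//.
rewrite mulmxBl mul1mx mulmxBr mulmx1.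
have YY : Y *m Y = 2 *: Y - X.
  by rewrite {3}YE scalerA divff// scale1r addrC addKr.
rewrite YY /X (_ : 1%:M - Y - (Y - (2 *: Y - (1%:M - c^-1 *: A))) = c^-1 *: A).
  by rewrite scalerA divff ?scale1r// gt_eqF.
by apply/matrixP => i j; rewrite !mxE; ring.
Qed.

Lemma sqrt_pd_sym : (sqrt_pd c A)^T = sqrt_pd c A.
Proof.
by rewrite /sqrt_pd linearZ /= linearB /= trmx1 sqrt_lim_sym.
Qed.

Lemma sqrt_pd_pd : positive_definite (sqrt_pd c A).
Proof.
split; first exact: sqrt_pd_sym.
have /andP[r0 r1] := root_r.
move=> u u0; rewrite -[X in 0 < X]/(form (sqrt_pd c A) u u) /sqrt_pd formZ.
rewrite mulr_gt0 ?sqrtr_gt0// formD -[- sqrt_lim _]scaleN1r formZ form1 mulN1r subr_gt0.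
have d0 : 0 < dot u u.
  by rewrite lt0r dot_ge0 andbT; apply: contra_neq u0; exact: dot_eq0.
have := sqrt_lim_bound r0 r1 root_bound u u.
rewrite -mulrA -expr2 enorm_sqr => /(le_trans (ler_norm _)) /le_lt_trans; apply.
by rewrite gtr_pMl.
Qed.

Lemma sqrt_mxE : sqrt_mx A = sqrt_pd c A.
Proof.
apply: xget_unique; first by split; [exact: sqrt_pd_pd|exact: sqrt_pdK].
move=> B [Bp BB]; apply: positive_definite_sqrt_unique => //; first exact: sqrt_pd_pd.
by rewrite BB sqrt_pdK.
Qed.

End Root.

Lemma measurable_sqrt_pd d (T : measurableType d) (c : R) (W : T -> 'M[R]_k) :
  (forall i j, measurable_fun setT (fun w => W w i j)) ->
  forall i j, measurable_fun setT (fun w => sqrt_pd c (W w) i j).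
Proof.
move=> mW.
have mX i j : measurable_fun setT (fun w => (1%:M - c^-1 *: W w) i j).
  rewrite (_ : (fun w => _) = (fun w => (1%:M : 'M[R]_k) i j - c^-1 * W w i j)).
    by apply: measurable_funB => //; exact: measurable_funM.
  by apply/funext => w; rewrite !mxE.
have mI n i j : measurable_fun setT (fun w => sqrt_iter (1%:M - c^-1 *: W w) n i j).
  elim: n i j => [|n IH] i j /=; first by under eq_fun do rewrite mxE; exact: measurable_cst.
  set X := fun w => 1%:M - c^-1 *: W w.
  rewrite (_ : (fun w => _) = (fun w => 2^-1 * (X w i j + \sum_l sqrt_iter (X w) n i l * sqrt_iter (X w) n l j))).
    apply: measurable_funM => //; apply: measurable_funD; first exact: mX.
    by apply: measurable_sum => l; exact: measurable_funM.
  by apply/funext => w; rewrite mxE; congr (_ * _); rewrite mxE; congr (_ + _); rewrite mxE.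
move=> i j.
rewrite (_ : (fun w => _) = (fun w => Num.sqrt c * ((1%:M : 'M[R]_k) i j - sqrt_lim (1%:M - c^-1 *: W w) i j))).
  apply: measurable_funM => //; apply: measurable_funB => //.
  under eq_fun do rewrite mxE.
  apply: measurableT_comp => //; apply: measurable_fun_limn_esup => n.
  by apply/measurable_EFinP; exact: mI.
by apply/funext => w; rewrite /sqrt_pd mxE; congr (_ * _); rewrite mxE; congr (_ + _); rewrite mxE.
Qed.

End SquareRoot.

(** * Forests and colorings *)

Section Graphs.
Variable k : nat.
Implicit Types (E F : {set {set 'I_k}}) (i j a b : 'I_k) (e : {set 'I_k}).

Definition conn F := connect (adjacent F).

Lemma adjacent_sym F i j : adjacent F i j = adjacent F j i.
Proof. by rewrite /adjacent /= finset.setUC. Qed.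

Lemma conn_sym F i j : conn F i j = conn F j i.
Proof.
apply: (sym_connect_sym (e := adjacent F)) => {}i {}j; exact: adjacent_sym.
Qed.

Lemma conn_refl F i : conn F i i. Proof. exact: connect0. Qed.

Lemma conn_trans F i j l : conn F i j -> conn F j l -> conn F i l.
Proof. exact: connect_trans. Qed.

Lemma conn_edge F i j : [set i; j]%SET \in F -> conn F i j.
Proof. by move=> ij; apply: connect1. Qed.

Lemma conn_sub E F i j : E \subset F -> conn E i j -> conn F i j.
Proof.
move=> EF; apply: connect_sub => {}i {}j ij; apply: conn_edge.
exact: (fintype.subsetP EF).
Qed.

Lemma set2_eq a b i j : [set a; b]%SET = [set i; j]%SET ->
  (i = a /\ j = b) \/ (i = b /\ j = a).
Proof.
move=> E; have : i \in [set a; b]%SET by rewrite E !inE eqxx.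
have : j \in [set a; b]%SET by rewrite E !inE eqxx orbT.
have : a \in [set i; j]%SET by rewrite -E !inE eqxx.
have : b \in [set i; j]%SET by rewrite -E !inE eqxx orbT.
rewrite !inE => /orP[]/eqP -> /orP[]/eqP -> // /orP[]/eqP ? /orP[]/eqP ?; subst; auto.
Qed.

Lemma conn_setU1 F a b i j : conn ([set a; b]%SET |: F) i j =
  [|| conn F i j, conn F i a && conn F b j | conn F i b && conn F a j].
Proof.
have FaF : F \subset [set a; b]%SET |: F by exact: finset.subsetUr.
have ab : conn ([set a; b]%SET |: F) a b by apply: conn_edge; rewrite !inE eqxx.
apply/idP/idP; last first.
  case/or3P; first exact: conn_sub.
    move=> /andP[ia bj]; apply: conn_trans (conn_sub FaF ia) _.
    exact: conn_trans ab (conn_sub FaF bj).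
  move=> /andP[ia bj]; apply: conn_trans (conn_sub FaF ia) _.
  by apply: conn_trans (conn_sub FaF bj); rewrite conn_sym.
case/connectP => p; elim/last_ind: p j => [|p y IH] j.
  by move=> _ ->; rewrite conn_refl.
rewrite rcons_path last_rcons => /andP[ip]; set z := last i p => zy ->.
have {}IH := IH z ip erefl; move: zy; rewrite /adjacent /= !inE.
case/orP => [/eqP/esym/set2_eq[[zE yE]|[zE yE]]|/conn_edge zy].
- rewrite zE in IH; rewrite yE !conn_refl !andbT; case/or3P: IH => [->|/andP[-> _]|/andP[-> _]];
    by rewrite ?orbT.
- rewrite zE in IH; rewrite yE !conn_refl !andbT; case/or3P: IH => [->|/andP[-> _]|/andP[-> _]];
    by rewrite ?orbT.
- case/or3P: IH => [iz|/andP[-> bz]|/andP[-> bz]]; first by rewrite (conn_trans iz zy).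
    by rewrite (conn_trans bz zy) orbT.
  by rewrite (conn_trans bz zy) !orbT.
Qed.

(** Acyclicity in the form that every edge is a bridge, which passes to subgraphs and leaves only
    connectivity to reason about. *)
Definition forest F := [forall e in F, [exists a, [exists b,
  [&& a != b, e == [set a; b]%SET & ~~ conn (F :\ e) a b]]]].

Lemma forestP F : reflect (forall e, e \in F -> exists a b,
  [/\ a != b, e = [set a; b]%SET & ~~ conn (F :\ e) a b]) (forest F).
Proof.
apply: (iffP forallP) => h e; last first.
  apply/implyP => /h[a [b [h1 h2 h3]]].
  by apply/existsP; exists a; apply/existsP; exists b; apply/and3P; split => //; apply/eqP.
move=> eF; have /implyP/(_ eF)/existsP[a /existsP[b /and3P[h1 /eqP h2 h3]]] := h e.
by exists a, b.
Qed.

Lemma forest_edge F e : forest F -> e \in F -> exists a b, a != b /\ e = [set a; b]%SET.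
Proof. by move=> /forestP fF /fF[a [b []]]; exists a, b. Qed.

Lemma forest0 : forest finset.set0.
Proof. by apply/forestP => e; rewrite inE. Qed.

Lemma forest_bridge F a b : forest F -> [set a; b]%SET \in F ->
  ~~ conn (F :\ [set a; b]%SET) a b.
Proof.
move=> /forestP fF /fF[a' [b' [_ E nc]]].
by case: (set2_eq E) => -[? ?]; subst; rewrite // conn_sym.
Qed.

Lemma forest_sub E F : E \subset F -> forest F -> forest E.
Proof.
move=> EF /forestP fF; apply/forestP => e eE.
have [a [b [ab eab nc]]] := fF e (fintype.subsetP EF _ eE).
exists a, b; split=> //; apply: contra nc; apply: conn_sub.
exact: finset.setSD.
Qed.

(** If an old edge xy ceased to be a bridge, the detour from x to y would pass through ab, and then
    a and b would be connected in [F] by way of xy. *)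
Lemma forest_add F a b : forest F -> a != b -> ~~ conn F a b ->
  forest ([set a; b]%SET |: F).
Proof.
move=> /[dup] fF /forestP FP ab nab; have abF : [set a; b]%SET \notin F.
  by apply: contra nab; exact: conn_edge.
apply/forestP => e; rewrite !inE => /orP[/eqP ->|eF].
  by exists a, b; split=> //; rewrite finset.setU1K.
have [x [y [xy eE nc]]] := FP e eF; exists x, y; split=> //.
have -> : ([set a; b]%SET |: F) :\ e = [set a; b]%SET |: (F :\ e).
  have abe : [set a; b]%SET != e by apply: contra abF => /eqP ->.
  apply/setP => e'; rewrite !inE; have [->|//] := eqVneq e' e.
  by rewrite eq_sym (negbTE abe).
have cxy : conn F x y by apply: conn_edge; rewrite -eE.
have sub : F :\ e \subset F by exact: subD1set.
rewrite conn_setU1 (negbTE nc) /=; apply: contra nab => /orP[]/andP[/(conn_sub sub) h1 /(conn_sub sub) h2].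
  by apply: (conn_trans (j := x)); [rewrite conn_sym|apply: (conn_trans cxy); rewrite conn_sym].
by apply: (conn_trans h2); apply: (conn_trans _ h1); rewrite conn_sym.
Qed.

(** * Counting colorings constant on components *)

Section Colorings.
Variable q : nat.
Notation col := {ffun 'I_k -> 'I_q.+1}.

(** The number of these colorings is q+1 to the number of components, so it measures connectivity
    without naming components. Colors in ['I_q.+1] form a cyclic group, in which they can be
    shifted. *)
Definition colorings F : {set col} :=
  [set c : col | [forall i, forall j, adjacent F i j ==> (c i == c j)]].

Lemma coloringsP F (c : col) : reflect (forall i j, conn F i j -> c i = c j) (c \in colorings F).
Proof.
rewrite inE; apply: (iffP forallP) => [h i j /connectP[p]|h i].
  elim: p i => [|z p IH] i /=; first by move=> _ ->.
  move=> /andP[iz zp] jE; rewrite -(IH z zp jE).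
  by have /forallP/(_ z)/implyP/(_ iz)/eqP := h i.
by apply/forallP => j; apply/implyP => ij; apply/eqP/h/connect1.
Qed.

Lemma colorings_conn F a b : conn F a b -> colorings ([set a; b]%SET |: F) = colorings F.
Proof.
move=> ab; apply/setP => c; apply/coloringsP/coloringsP => h i j ij; apply: h.
  by rewrite conn_setU1 ij.
move: ij; rewrite conn_setU1 => /or3P[//|/andP[ia bj]|/andP[ib aj]].
  exact: conn_trans ia (conn_trans ab bj).
by apply: (conn_trans ib); apply: conn_trans aj; rewrite conn_sym.
Qed.

(** Every coloring of [F] arises exactly once from one in which a and b agree, by shifting the
    component of b by the color difference t = c b - c a. *)
Lemma card_colorings_add F a b : ~~ conn F a b ->
  #|colorings F| = (q.+1 * #|colorings ([set a; b]%SET |: F)|)%N.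
Proof.
move=> nab.
pose f (tc : 'I_q.+1 * col) : col := [ffun i => if conn F b i then tc.2 i + tc.1 else tc.2 i].
pose D := finset.setX [set: 'I_q.+1]%SET (colorings ([set a; b]%SET |: F)).
have nba : conn F b a = false by rewrite conn_sym; apply/negbTE.
have cab c : c \in colorings ([set a; b]%SET |: F) -> c a = c b.
  by move=> /coloringsP; apply; apply: conn_edge; rewrite !inE eqxx.
have -> : colorings F = f @: D.
  apply/setP => c; apply/idP/imsetP => [/coloringsP cF|[[t c'] /finset.setXP[_ /= c'F] ->]].
    exists (c b - c a, [ffun i => if conn F b i then c i - (c b - c a) else c i]).
      apply/finset.setXP; split; first by rewrite inE.
      apply/coloringsP => i j; rewrite !ffunE conn_setU1 => /or3P[ij|/andP[ia bj]|/andP[ib aj]].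
      - by rewrite (cF _ _ ij) /conn (same_connect_r (e := adjacent F) _ ij)//; exact: conn_sym.
      - have -> : conn F b i = false.
          by apply/negbTE; apply: contra nab => bi; rewrite conn_sym; exact: conn_trans bi ia.
        by rewrite bj -(cF _ _ bj) (cF _ _ ia) opprB addrC subrK.
      - have -> : conn F b j = false.
          apply/negbTE; apply: contra nab => bj; rewrite conn_sym; apply: conn_trans bj _.
          by rewrite conn_sym.
        by rewrite conn_sym ib (cF _ _ ib) -(cF _ _ aj) opprB addrC subrK.
    apply/ffunP => i; rewrite /f ffunE; case: ifP => ib; rewrite [X in X i]/= ffunE ib//.
    by rewrite [_.1]/= subrK.
  have {}c'F := c'F; apply/coloringsP => i j ij; rewrite !ffunE /=.
  have -> : conn F b j = conn F b i.
    by apply/idP/idP => h; [apply: (conn_trans h); rewrite conn_sym|exact: conn_trans h ij].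
  by have /coloringsP/(_ i j) -> // := c'F; rewrite conn_setU1 ij.
rewrite card_in_imset ?cardsX ?cardsT ?card_ord//.
move=> [t c] [t' c'] /finset.setXP[_ /= cF] /finset.setXP[_ /= cF'] /ffunP E.
have E1 := E a; have E2 := E b; rewrite !ffunE nba conn_refl /= in E1 E2.
have tt : t = t'.
  by move: E2; rewrite -(cab _ cF) -(cab _ cF') E1 => /addrI.
subst t'; congr pair; apply/ffunP => i; have := E i; rewrite !ffunE /=.
by case: ifP => // _ /addIr.
Qed.

Lemma card_colorings0 : #|colorings finset.set0| = (q.+1 ^ k)%N.
Proof.
suff -> : colorings finset.set0 = [set: col]%SET by rewrite cardsT card_ffun !card_ord.
apply/setP => c; rewrite !inE; apply/forallP => i; apply/forallP => j.
by rewrite /adjacent /= inE.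
Qed.

Lemma card_colorings_forest F : forest F ->
  (#|colorings F| * q.+1 ^ #|F|)%N = (q.+1 ^ k)%N.
Proof.
have [m] := ubnP #|F|; elim: m F => // m IH F Fm fF.
have [->|[e eF]] := finset.set_0Vmem F.
  by rewrite cards0 expn0 muln1 card_colorings0.
have [a [b [ab eE]]] := forest_edge fF eF.
rewrite eE in eF; have nc := forest_bridge fF eF.
set F' := F :\ [set a; b]%SET in nc.
have FE : F = [set a; b]%SET |: F' by rewrite finset.setD1K.
have cF : #|F| = #|F'|.+1 by rewrite (cardsD1 [set a; b]%SET F) eF.
have fF' : forest F' by apply: forest_sub fF; exact: subD1set.
rewrite -(IH F') //; last by rewrite -ltnS -cF.
by rewrite (card_colorings_add nc) -FE cF expnS mulnCA mulnA.
Qed.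

(** In an arbitrary graph an edge divides the number of colorings by q+1 or leaves it alone. *)
Lemma card_colorings_ge F : (forall e, e \in F -> exists a b, e = [set a; b]%SET) ->
  (q.+1 ^ k <= #|colorings F| * q.+1 ^ #|F|)%N.
Proof.
have [m] := ubnP #|F|; elim: m F => // m IH F Fm F2.
have [->|[e eF]] := finset.set_0Vmem F.
  by rewrite cards0 expn0 muln1 card_colorings0.
have [a [b eE]] := F2 _ eF.
rewrite eE in eF; set F' := F :\ [set a; b]%SET.
have FE : F = [set a; b]%SET |: F' by rewrite finset.setD1K.
have cF : #|F| = #|F'|.+1 by rewrite (cardsD1 [set a; b]%SET F) eF.
have /IH : (#|F'| < m)%N by rewrite -ltnS -cF.
have F'2 e' : e' \in F' -> exists a b, e' = [set a; b]%SET.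
  by move=> /(fintype.subsetP (subD1set _ _)); exact: F2.
move=> /(_ F'2) h; apply: (leq_trans h); rewrite cF expnS.
case: (boolP (conn F' a b)) => ab.
  by rewrite FE colorings_conn// leq_mul2l leq_pmull// orbT.
by rewrite (card_colorings_add ab) -FE mulnAC mulnC.
Qed.

End Colorings.

Lemma card_colorings_connected F : (0 < k)%N -> (forall i j, conn F i j) ->
  #|colorings 1 F| = 2%N.
Proof.
move=> k0 cF; pose i0 := Ordinal k0.
have -> : colorings 1 F = [set [ffun=> t] | t : 'I_2].
  apply/setP => c; apply/coloringsP/imsetP => [h|[t _ ->] i j _]; last by rewrite !ffunE.
  by exists (c i0) => //; apply/ffunP => i; rewrite ffunE; exact: h.
rewrite card_imset ?card_ord// => t t' /ffunP/(_ i0).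
by rewrite !ffunE.
Qed.

(** Counting two-colorings replaces arguments on cycles: a connected graph has exactly 2, and a
    forest with m edges has 2^(k-m). *)
Lemma spanning_tree_forest F : (0 < k)%N ->
  spanning_tree F = forest F && (#|F| == k.-1).
Proof.
move=> k0; apply/and3P/andP => [[/forallP F2 Fk /forallP cF]|[fF Fk]].
  have {}cF i j : conn F i j by have /forallP := cF i; exact.
  have F2' e : e \in F -> exists a b, a != b /\ e = [set a; b]%SET.
    by move=> eF; have /implyP/(_ eF)/cards2P := F2 e.
  split=> //; apply/forestP => e eF; have [a [b [ab eE]]] := F2' _ eF.
  exists a, b; split=> //; apply/negP => cab.
  have FE : F = [set a; b]%SET |: (F :\ e) by rewrite -eE finset.setD1K.
  have := card_colorings_connected k0 cF; rewrite FE colorings_conn// => c2.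
  (* Deleting an edge that is not a bridge leaves the 2 colorings unchanged, but the remaining k - 2
     edges would force 2^k <= 2 * 2^(k-2). *)
  have : (2 ^ k <= #|colorings 1 (F :\ e)| * 2 ^ #|F :\ e|)%N.
    apply: card_colorings_ge => e'; rewrite inE => /andP[_ /F2'[a' [b' [_ ->]]]].
    by exists a', b'.
  rewrite c2 -expnS leq_exp2l//; move: Fk; rewrite (cardsD1 e) eF => /eqP Fk.
  by rewrite -add1n Fk -[X in (X <= _)%N -> _](prednK k0) ltnn.
split=> //.
- apply/forallP => e; apply/implyP => eF; have [a [b [ab ->]]] := forest_edge fF eF.
  by rewrite cards2 ab.
- have := card_colorings_forest 1 fF; rewrite (eqP Fk) => c2.
  have {}c2 : #|colorings 1 F| = 2%N.
    apply/eqP; rewrite -(eqn_pmul2r (m := 2 ^ k.-1)) ?expn_gt0//.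
    by rewrite c2 -expnS prednK.
  apply/forallP => i; apply/forallP => j; apply/negPn/negP => nij.
  have := card_colorings_add 1 nij; rewrite c2 => /eqP.
  rewrite -[X in X == _]muln1 eqn_pmul2l// => /eqP c1.
  have : ([set [ffun=> t] | t : 'I_2] \subset colorings 1 ([set i; j]%SET |: F)).
    by apply/fintype.subsetP => c /imsetP[t _ ->]; apply/coloringsP => a b _; rewrite !ffunE.
  move/subset_leq_card; rewrite -c1 card_imset ?card_ord// => t t' /ffunP/(_ i).
  by rewrite !ffunE.
Qed.

End Graphs.

(** * Weights of a forest *)

Section Weights.
Context {R : realType} {k : nat} {cT : eqType}.
Implicit Types (F : {set {set 'I_k}}) (x : {set 'I_k} -> R) (c : 'I_k -> cT).
Implicit Types (v u : R) (i j l : 'I_k).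

Definition level F x u : {set {set 'I_k}} := [set e in F | u <= x e]%SET.

(* Off the diagonal: the bottleneck value of [i] and [j] in [F] if they are
   connected, and otherwise [v] or [0] according to the colors of [i], [j]. *)
Definition wt F x v c i j : R :=
  if i == j then 1 else
  \big[Num.max/(if c i == c j then v else 0)]_(e in F | conn (level F x (x e)) i j) x e.

Lemma level_sub F x u : level F x u \subset F.
Proof. by apply/fintype.subsetP => e; rewrite inE => /andP[]. Qed.

Lemma level_le F x u u' : u <= u' -> level F x u' \subset level F x u.
Proof.
move=> uu'; apply/fintype.subsetP => e; rewrite !inE => /andP[-> h] /=.
exact: le_trans uu' h.
Qed.

Lemma conn_neq F i j : conn F i j -> i != j -> exists e, e \in F.
Proof.
move=> /connectP[[|z p] /=]; first by move=> _ ->; rewrite eqxx.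
by move=> /andP[iz _] _ _; exists [set i; z]%SET.
Qed.

(** All comparisons of weights go through thresholds, which turn maxima of values into connectivity
    of level graphs. The range ]0, 1] of [u] separates the default 0 and the diagonal value 1. *)
Lemma wt_threshold F x v c i j u : 0 < u <= 1 ->
  (u <= wt F x v c i j) = [|| i == j, (u <= v) && (c i == c j) | conn (level F x u) i j].
Proof.
move=> /andP[u0 u1]; rewrite /wt; have [->|ij] /= := eqVneq i j; first by rewrite u1.
apply/idP/idP.
  apply: contraTT; rewrite negb_or => /andP[nb nc]; rewrite -ltNge.
  apply/bigmax_ltP; split=> [|e /andP[eF ce]].
    by move: nb; case: (c i == c j); rewrite ?andbT ?andbF// -ltNge.
  by rewrite ltNge; apply: contra nc => ue; apply: conn_sub ce; exact: level_le.
case/orP => [/andP[uv /eqP ->]|cu].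
  by apply: le_trans uv _; rewrite eqxx; exact: bigmax_ge_id.
have [e0 e0u] := conn_neq cu ij.
(* For the edge of least value in the level graph of [u], that whole graph lies in the level graph
   of [x e], so the edge takes part in the maximum. *)
pose e := [arg min_(e < e0 in level F x u) x e]%O.
have [eu emin] : e \in level F x u /\ forall e', e' \in level F x u -> x e <= x e'.
  by rewrite /e; case: arg_minP.
have eF := fintype.subsetP (level_sub F x u) _ eu.
apply: (@le_trans _ _ (x e)); first by move: eu; rewrite inE => /andP[].
apply: (le_bigmax_cond _ x); rewrite eF /=.
apply: conn_sub cu; apply/fintype.subsetP => e' e'u; rewrite inE emin// andbT.
exact: (fintype.subsetP (level_sub F x u)).
Qed.

Lemma wt_bounds F x v c i j : (forall e, 0 <= x e <= 1) -> 0 <= v <= 1 ->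
  0 <= wt F x v c i j <= 1.
Proof.
move=> x01 /andP[v0 v1]; rewrite /wt; case: ifP => _; first by rewrite ler01 lexx.
apply/andP; split.
  by apply: le_trans (bigmax_ge_id _ _ _ _); case: ifP.
apply: bigmax_le => [|e _]; first by case: ifP.
by case/andP: (x01 e).
Qed.

Lemma eq_threshold (a b : R) : 0 <= a <= 1 -> 0 <= b <= 1 ->
  (forall u, 0 < u <= 1 -> (u <= a) = (u <= b)) -> a = b.
Proof.
move=> /andP[a0 a1] /andP[b0 b1] ab; apply/eqP; rewrite eq_le; apply/andP; split.
  by move: a0; rewrite [0 <= a]le_eqVlt => /orP[/eqP <- //|a0]; rewrite -ab ?lexx// a0.
by move: b0; rewrite [0 <= b]le_eqVlt => /orP[/eqP <- //|b0]; rewrite ab ?lexx// b0.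
Qed.

Definition colored F c := forall i j, adjacent F i j -> c i = c j.

Lemma colored_conn F c i j : colored F c -> conn F i j -> c i = c j.
Proof.
move=> cF /connectP[p]; elim: p i => [|z p IH] i /=; first by move=> _ ->.
by move=> /andP[/cF -> zp]; exact: IH.
Qed.

Lemma wt_sym F x v c i j : wt F x v c i j = wt F x v c j i.
Proof.
rewrite /wt eq_sym; case: ifP => // _; rewrite [c i == _]eq_sym.
by apply: eq_bigl => e; rewrite conn_sym.
Qed.

(* Adding to a forest an edge of minimal value [x e] does not change the weights
   once disconnected vertices of equal color interact with strength [x e]. *)
Lemma wt_add F x c e i j : (forall e, 0 <= x e <= 1) -> colored (e |: F) c ->
  (forall e', e' \in F -> x e <= x e') ->
  wt (e |: F) x (x e) c i j = wt F x (x e) c i j.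
Proof.
move=> x01 col emin; apply: eq_threshold => [||u u01]; try exact: wt_bounds.
rewrite !wt_threshold//; case: (i == j) => //=.
have colF : colored F c by move=> a b ab; apply: col; rewrite /adjacent /= inE; apply/orP; right.
have [ue|eu] /= := leP u (x e).
  case: eqVneq => //= ij; apply/idP/idP.
    by move=> /(conn_sub (level_sub _ _ _)) /(colored_conn col) /eqP; rewrite (negbTE ij).
  by move=> /(conn_sub (level_sub _ _ _)) /(colored_conn colF) /eqP; rewrite (negbTE ij).
congr conn; apply/setP => e'; rewrite !inE; case: (eqVneq e' e) => //= ->.
by rewrite leNgt eu andbF.
Qed.

(** Below all edge values, [v] is felt only by pairs that [F] does not connect. This makes the
    covariance affine in the strength, with slope the indicator of the pairs that can become
    edges. *)
Lemma wt_affine F x v c i j : (forall e, 0 <= x e <= 1) -> 0 <= v <= 1 ->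
  (forall e, e \in F -> v <= x e) ->
  wt F x v c i j = wt F x 0 c i j + v * ((c i == c j) && ~~ conn F i j)%:R.
Proof.
move=> x01 v01 vF; have z01 : 0 <= (0 : R) <= 1 by rewrite lexx ler01.
case: (boolP (conn F i j)) => cij; rewrite ?andbF ?mulr0 ?addr0 ?andbT.
  apply: eq_threshold => [||u u01]; try exact: wt_bounds.
  rewrite !wt_threshold//; case: (i == j) => //=; case/andP: u01 => u0 u1.
  rewrite [u <= 0]leNgt u0 /=; have [uv|//] := leP u v.
  rewrite (_ : level F x u = F) ?cij ?orbT//.
  by apply/setP => e; rewrite inE andb_idr// => /vF; exact: le_trans.
have ij : i == j = false by apply/negbTE; apply: contra cij => /eqP ->; exact: conn_refl.
have lev u : conn (level F x u) i j = false.
  by apply/negbTE; apply: contra cij; apply: conn_sub; exact: level_sub.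
have -> : wt F x 0 c i j = 0.
  apply: eq_threshold => [||u /[dup] u01 /andP[u0 u1]]; rewrite ?z01//; first exact: wt_bounds.
  by rewrite wt_threshold// ij lev /= orbF [u <= 0]leNgt u0.
rewrite add0r; apply: eq_threshold => [||u /[dup] u01 /andP[u0 u1]]; first exact: wt_bounds.
  by case: (c i == c j); rewrite ?mulr1 ?mulr0.
rewrite wt_threshold// ij lev /= orbF; case: (c i == c j); rewrite ?mulr1 ?mulr0 ?andbT//.
by rewrite andbF leNgt u0.
Qed.

(** At each threshold the claim is transitivity of a relation: connections in the level graph
    compose with equalities of colors because connected vertices share a color. *)
Lemma wt_ultrametric F x v c i j l : (forall e, 0 <= x e <= 1) -> 0 <= v <= 1 ->
  colored F c ->
  Num.min (wt F x v c i l) (wt F x v c l j) <= wt F x v c i j.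
Proof.
move=> x01 v01 col; set u := Num.min _ _.
have [u0|u0] := leP u 0.
  by apply: le_trans u0 _; case/andP: (wt_bounds F c i j x01 v01).
have u1 : 0 < u <= 1.
  by rewrite u0 ge_min; case/andP: (wt_bounds F c i l x01 v01) => _ ->.
have h1 : u <= wt F x v c i l by rewrite ge_min lexx.
have h2 : u <= wt F x v c l j by rewrite ge_min lexx orbT.
move: h1 h2; rewrite !wt_threshold//.
have cl a b : conn (level F x u) a b -> c a = c b.
  by move=> /(conn_sub (level_sub F x u)); exact: colored_conn.
case/or3P => [/eqP ->//|/andP[uv /eqP cil]|cil]; case/or3P => [/eqP <-|/andP[uv' /eqP clj]|clj].
- by rewrite uv cil eqxx orbT.
- by rewrite uv cil clj eqxx orbT.
- by rewrite uv cil (cl _ _ clj) eqxx orbT.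
- by rewrite cil !orbT.
- by rewrite uv' (cl _ _ cil) clj eqxx orbT.
- by rewrite (conn_trans cil clj) !orbT.
Qed.

End Weights.

(** * Positivity of ultrametric matrices *)

Section Ultrametric.
Context {R : realType} {k : nat}.
Implicit Types (C : 'I_k -> 'I_k -> R).

(** The form is the sum of the squares of the class sums. Summing over all members [l] of a class
    and dividing by its size [N l] avoids choosing representatives; a vertex related to nothing
    contributes 0. *)
Lemma partial_equivalence_psd (e : rel 'I_k) (u : 'I_k -> R) :
  symmetric e -> transitive e -> 0 <= \sum_i \sum_j u i * u j * (e i j)%:R.
Proof.
move=> es et; pose N l : R := #|[set m | e l m]%SET|%:R.
have -> : \sum_i \sum_j u i * u j * (e i j)%:R =
    \sum_l (N l)^-1 * (\sum_i u i * (e i l)%:R) ^+ 2.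
  transitivity (\sum_i \sum_j \sum_l (N l)^-1 * (u i * (e i l)%:R * (u j * (e j l)%:R))); last first.
    under [RHS]eq_bigr => l _.
      rewrite expr2 mulr_suml mulr_sumr; under eq_bigr => i _ do rewrite mulr_sumr mulr_sumr.
      over.
    rewrite [RHS]exchange_big /=; apply: eq_bigr => i _.
    by rewrite [RHS]exchange_big.
  apply: eq_bigr => i _; apply: eq_bigr => j _.
  have -> : \sum_l (N l)^-1 * (u i * (e i l)%:R * (u j * (e j l)%:R)) =
      u i * u j * \sum_l (N l)^-1 * (e i l && e j l)%:R.
    rewrite mulr_sumr; apply: eq_bigr => l _; rewrite -mulnb natrM; ring.
  congr (_ * _); case: (boolP (e i j)) => ij; last first.
    rewrite [RHS]big1// => l _; case: (boolP (e i l && e j l)) => [/andP[il jl]|_]; last by rewrite mulr0.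
    by move: ij; rewrite (et l)// es.
  apply/esym; transitivity (\sum_(l in [set m | e i m]%SET) (N i)^-1).
    rewrite [RHS]big_mkcond /=; apply: eq_bigr => l _; rewrite inE.
    have -> : e j l = e i l.
      by apply/idP/idP => h; [apply: et ij h|apply: (et i); rewrite // es].
    rewrite andbb; case: (boolP (e i l)) => il; rewrite ?mulr0 ?mulr1//.
    congr (_ ^-1); rewrite /N; congr (_%:R); congr #|pred_of_set _|.
    by apply/setP => m; rewrite !inE; apply/idP/idP => h; [apply: et il h|apply: (et i); rewrite // es].
  rewrite sumr_const -[LHS]mulr_natl; apply: (@divff _ (N i)); rewrite pnatr_eq0 -lt0n card_gt0.
  by apply/finset.set0Pn; exists j; rewrite inE.
apply: sumr_ge0 => l _; rewrite mulr_ge0 ?sqr_ge0// invr_ge0 ler0n//.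
Qed.

(** Induction on the number of distinct values. Capping the largest value [M] at the next one [m']
    removes M - m' times the indicator of C >= M, a transitive relation by the ultrametric
    inequality, and the capped matrix is still ultrametric. *)
Lemma ultrametric_psd C (u : 'I_k -> R) :
  (forall i j, 0 <= C i j) -> (forall i j, C i j = C j i) ->
  (forall i j l, Num.min (C i l) (C l j) <= C i j) ->
  0 <= \sum_i \sum_j u i * u j * C i j.
Proof.
pose vals C := undup [seq C ij.1 ij.2 | ij <- enum [set: 'I_k * 'I_k]%SET].
have valsP D i j : D i j \in vals D.
  by rewrite mem_undup; apply/mapP; exists (i, j); rewrite ?mem_enum ?inE.
have [m] := ubnP (size (vals C)); elim: m C => // m IH C Cm C0 Cs Cu.
have [i0 _|none] := pickP 'I_k; last first.
  by rewrite big1// => i; have := none i.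
pose p := [arg max_(ij > (i0, i0)) C ij.1 ij.2]%O; pose M := C p.1 p.2.
have leM i j : C i j <= M.
  by rewrite /M /p; case: arg_maxP => //= q _ /(_ (i, j)); exact.
have [/existsP[q qM]|] := boolP [exists q, C q.1 q.2 < M]; last first.
  rewrite negb_exists => /forallP allM.
  have CM i j : C i j = M.
    by apply/eqP; rewrite eq_le leM /= leNgt; exact: (allM (i, j)).
  have := @partial_equivalence_psd (fun _ _ => true) u (fun _ _ => erefl) (fun _ _ _ _ _ => erefl).
  move=> /(mulr_ge0 (C0 p.1 p.2)); rewrite mulr_sumr => h; apply: le_trans h _.
  rewrite le_eqVlt; apply/orP; left; apply/eqP; apply: eq_bigr => i _.
  by rewrite mulr_sumr; apply: eq_bigr => j _; rewrite mulr1 mulrC; congr (_ * _); rewrite CM.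
pose r := [arg max_(ij > q | C ij.1 ij.2 < M) C ij.1 ij.2]%O; pose m' := C r.1 r.2.
have [m'M lem'] : m' < M /\ forall i j, C i j < M -> C i j <= m'.
  rewrite /m' /r; case: arg_maxP => //= q' q'M h; split=> // i j ijM.
  exact: (h (i, j)).
pose C' i j := Num.min (C i j) m'.
have CE i j : C i j = C' i j + (M - m') * (M <= C i j)%R%:R.
  rewrite /C'; have [MC|CM] := leP M (C i j).
    have -> : C i j = M by apply/eqP; rewrite eq_le leM MC.
    by rewrite mulr1 (min_idPr _) ?ltW// addrC subrK.
  by rewrite mulr0 addr0 (min_idPl _)// lem'.
have -> : \sum_i \sum_j u i * u j * C i j = (\sum_i \sum_j u i * u j * C' i j) +
    (M - m') * \sum_i \sum_j u i * u j * (M <= C i j)%R%:R.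
  rewrite mulr_sumr -big_split; apply: eq_bigr => i _ /=.
  rewrite mulr_sumr -big_split; apply: eq_bigr => j _ /=.
  by rewrite {1}CE; ring.
apply: addr_ge0; last first.
  apply: mulr_ge0; [by rewrite subr_ge0 ltW|]; apply: (partial_equivalence_psd (e := fun i j => M <= C i j)).
    by move=> i j; rewrite Cs.
  by move=> j i l ij jl; apply: le_trans (Cu i l j); rewrite le_min ij jl.
apply: IH.
- rewrite -ltnS; apply: leq_trans Cm; rewrite ltnS.
  have MC : M \in vals C by exact: valsP.
  rewrite (perm_size (perm_to_rem MC)) /= ltnS.
  apply: uniq_leq_size; first exact: undup_uniq.
  move=> v; rewrite mem_undup => /mapP[[i j] _ ->] /=.
  rewrite mem_rem_uniq ?undup_uniq// inE /= /C' minElt; case: ifP => h.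
    by rewrite valsP andbT lt_eqF// (lt_trans h).
  by rewrite valsP andbT lt_eqF.
- by move=> i j; rewrite /C' le_min C0; exact: C0.
- by move=> i j; rewrite /C' Cs.
- move=> i j l; rewrite /C' !le_min !ge_min !lexx !orbT andbT.
  have := Cu i j l; rewrite !ge_min => /orP[->//|->]; rewrite ?orbT//.
Qed.

End Ultrametric.

Section WeightMatrix.
Context {R : realType} {k : nat} {cT : eqType}.
Variables (F : {set {set 'I_k}}) (x : {set 'I_k} -> R) (v : R) (c : 'I_k -> cT) (M : R).
Hypotheses (x01 : forall e, 0 <= x e <= 1) (v01 : 0 <= v <= 1) (col : colored F c).
Hypotheses (M01 : 0 <= M < 1) (xM : forall e, e \in F -> x e <= M) (vM : v <= M).

Definition wt_mx : 'M[R]_k := \matrix_(i, j) wt F x v c i j.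

Lemma wt_mx_sym : wt_mx^T = wt_mx.
Proof. by apply/matrixP => i j; rewrite !mxE wt_sym. Qed.

Let wt_off i j : i != j -> wt F x v c i j <= M.
Proof.
rewrite /wt => /negbTE ->; apply: bigmax_le => [|e /andP[eF _]]; last exact: xM.
by case: ifP => // _; case/andP: M01.
Qed.

(** Below, the matrix is (1 - M) times the identity plus an ultrametric one. Above, entries in
    [0, 1] give u_i u_j w <= (u_i^2 + u_j^2)/2, which sums to k |u|^2. *)
Lemma wt_mx_quad u : (1 - M) * dot u u <= form wt_mx u u <= k%:R * dot u u.
Proof.
have fE : form wt_mx u u = \sum_i \sum_j u i 0 * u j 0 * wt F x v c i j.
  rewrite form_dot dotE; apply: eq_bigr => i _; rewrite mxE mulr_sumr.
  by apply: eq_bigr => j _; rewrite mxE mulrA mulrAC.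
apply/andP; split.
  (* Lowering the diagonal from 1 to [M] keeps the matrix ultrametric, since no entry off the
     diagonal exceeds [M]. *)
  pose C i j := wt F x v c i j - (1 - M) * (i == j)%:R.
  have C1 i : C i i = M by rewrite /C /wt eqxx mulr1 opprB addrCA subrr addr0.
  have C2 i j : i != j -> C i j = wt F x v c i j.
    by move=> /negbTE ij; rewrite /C ij mulr0 subr0.
  have CM i j : C i j <= M.
    by have [->|ij] := eqVneq i j; [rewrite C1|rewrite C2// wt_off].
  have := @ultrametric_psd R k C (fun i => u i 0).
  move=> h; rewrite fE -subr_ge0 dotE mulr_sumr -sumrB.
  have -> : \sum_i (\sum_j u i 0 * u j 0 * wt F x v c i j - (1 - M) * (u i 0 * u i 0)) =
      \sum_i \sum_j u i 0 * u j 0 * C i j.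
    apply: eq_bigr => i _; rewrite (bigD1 i)//= [RHS](bigD1 i)//= addrAC; congr (_ + _).
      by rewrite /C eqxx mulr1; ring.
    by apply: eq_bigr => j ji; rewrite C2// eq_sym.
  apply: h => [i j|i j|i j l].
  - have [->|ij] := eqVneq i j; first by rewrite C1; case/andP: M01.
    by rewrite C2//; case/andP: (wt_bounds F c i j x01 v01).
  - by rewrite /C wt_sym eq_sym.
  - have [->|ij] := eqVneq i j; first by rewrite C1 ge_min CM.
    have [<-|il] := eqVneq i l; first by rewrite ge_min lexx orbT.
    have [->|lj] := eqVneq l j; first by rewrite ge_min lexx.
    by rewrite !C2//; exact: wt_ultrametric.
rewrite fE dotE mulr_sumr.
apply: (@le_trans _ _ (\sum_i \sum_j (u i 0 ^+ 2 + u j 0 ^+ 2) / 2)).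
  apply: ler_sum => i _; apply: ler_sum => j _.
  have /andP[w0 w1] := wt_bounds F c i j x01 v01.
  have s1 : 0 <= (u i 0 - u j 0) ^+ 2 by exact: sqr_ge0.
  have s2 : 0 <= (u i 0 + u j 0) ^+ 2 by exact: sqr_ge0.
  move: (wt F x v c i j) w0 w1 s1 s2 => w w0 w1; rewrite !expr2; nra.
under eq_bigr => i _ do (under eq_bigr do rewrite mulrDl; rewrite big_split /= sumr_const card_ord).
rewrite big_split /= sumr_const card_ord -[X in _ + X]mulr_natl mulr_sumr -big_split /=.
rewrite le_eqVlt; apply/orP; left; apply/eqP; apply: eq_bigr => i _.
by rewrite -mulr_natl expr2; field.
Qed.

End WeightMatrix.

(** * Tree weights as bottleneck values *)

Section TreeWeightE.
Context {R : realType} {k : nat}.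
Implicit Types (E : {set {set 'I_k}}).

Lemma le_bigmin_seq (I : Type) (s : seq I) (x : I -> R) (y u : R) :
  (u <= \big[Num.min/y]_(e <- s) x e) = (u <= y) && all (fun e => u <= x e) s.
Proof.
elim: s => [|e s IH]; first by rewrite big_nil andbT.
by rewrite big_cons le_min IH /= andbCA.
Qed.

Lemma conn_avoid E (e : {set 'I_k}) z i p :
  path (adjacent E) i p -> z \notin i :: p -> z \in e -> conn (E :\ e)%SET i (last i p).
Proof.
move=> + + ze; elim: p i => [|a p IH] i /=; first by move=> _ _; exact: conn_refl.
move=> /andP[ia ap]; rewrite inE negb_or => /andP[zi zp].
apply: conn_trans (IH _ ap zp); apply: conn_edge; rewrite !inE.
apply/andP; split; last exact: ia.
apply: contra zi => /eqP iae; move: ze; rewrite -iae !inE => /orP[//|/eqP za].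
by move: zp; rewrite za mem_head.
Qed.

Lemma path_level E (x : {set 'I_k} -> R) u i p : path (adjacent E) i p ->
  all (fun e => u <= x e) (pairmap (fun a b => [set a; b]%SET) i p) ->
  conn (level E x u) i (last i p).
Proof.
elim: p i => [|a p IH] i /=; first by move=> _ _; exact: conn_refl.
move=> /andP[ia ap] /andP[xia xa].
apply: conn_trans (IH _ ap xa); apply: conn_edge; rewrite inE xia andbT; exact: ia.
Qed.

Lemma pairmap_mem (i : 'I_k) p e : e \in pairmap (fun a b => [set a; b]%SET) i p ->
  exists p1 b p2, p = p1 ++ b :: p2 /\ e = [set last i p1; b]%SET.
Proof.
elim: p i => [//|a p IH] i /=; rewrite inE => /orP[/eqP ->|/IH [p1 [b [p2 [-> ->]]]]].
  by exists [::], a, p.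
by exists (a :: p1), b, p2.
Qed.

(** If the tree path had an edge of value below [u] while i and j were connected at level [u], they
    would stay connected without that edge. The two remaining pieces of the path would then join its
    endpoints, although it is a bridge. *)
Lemma tree_weightE E (x : {set 'I_k} -> R) (cT : eqType) (c : 'I_k -> cT) i j : (0 < k)%N ->
  spanning_tree E -> (forall e, 0 <= x e <= 1) ->
  tree_weight E x i j = wt E x 0 c i j.
Proof.
move=> k0 tE x01; rewrite mxE; have [<-|ij] := eqVneq i j; first by rewrite /wt eqxx.
have /andP[fE _] : forest E && (#|E| == k.-1) by rewrite -spanning_tree_forest.
have [pE pj up] : [/\ path (adjacent E) i (tree_path E i j), last i (tree_path E i j) = j &
    uniq (i :: tree_path E i j)].
  rewrite /tree_path; case: xgetP => [p -> //|].
  have /and3P[_ _ /forallP /(_ i) /forallP /(_ j) /connectP[p pE ->]] := tE.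
  by case/shortenP: pE => p' p'E up' _ /(_ p') [].
have bound : 0 <= \big[Num.min/x (head finset.set0 (tree_path_edges E i j))]_(e <- tree_path_edges E i j) x e <= 1.
  apply/andP; split.
    rewrite le_bigmin_seq; case/andP: (x01 (head finset.set0 (tree_path_edges E i j))) => -> _ /=.
    by apply/allP => e _; case/andP: (x01 e).
  elim: (tree_path_edges E i j) (head _ _) => [|e s IH] y; first by rewrite big_nil; case/andP: (x01 y).
  by rewrite big_cons ge_min IH orbT.
have z01 : 0 <= (0 : R) <= 1 by rewrite lexx ler01.
apply: eq_threshold => [//||u u01]; first exact: wt_bounds.
rewrite wt_threshold// (negbTE ij) /= [u <= 0]leNgt; case/andP: (u01) => -> _ /=.
rewrite le_bigmin_seq /tree_path_edges; set p := tree_path E i j in pE pj up *.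
apply/idP/idP => [/andP[_]|cij]; first by rewrite -[X in conn _ _ X]pj; exact: path_level.
have h : all (fun e => u <= x e) (pairmap (fun a b => [set a; b]%SET) i p).
  apply/allP => e /pairmap_mem[p1 [b [p2 [pE' eE]]]].
  rewrite leNgt; apply/negP => xeu.
  have ab : last i p1 != b /\ all (fun z => z \notin i :: p1) (b :: p2).
    move: up; rewrite pE' -cat_cons cat_uniq => /and3P[_ /hasPn h _]; split; last exact/allP.
    by apply: contraNneq (h b (mem_head _ _)) => <-; exact: mem_last.
  case: ab => ab /= /andP[bp1 /allP p2p1].
  have eE' : e \in E.
    by rewrite eE; move: pE; rewrite pE' cat_path /= => /and3P[].
  move: pE pj; rewrite pE' cat_path last_cat /= => /and3P[p1E _ p2E] pj.
  have be : b \in e by rewrite eE !inE eqxx orbT.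
  have ae : last i p1 \in e by rewrite eE !inE eqxx.
  have abn : last i p1 \notin b :: p2.
    rewrite inE negb_or ab /=; apply/negP => /p2p1; rewrite mem_last//.
  (* Each piece of the path avoids one endpoint of [e], and therefore does not use [e]. *)
  have c1 := conn_avoid p1E bp1 be.
  have c2 := conn_avoid p2E abn ae.
  have c3 : conn (E :\ e) i j.
    apply: conn_sub cij; apply/fintype.subsetP => e'; rewrite !inE => /andP[e'E ue'].
    by rewrite e'E andbT; apply: contraTneq ue' => ->; rewrite -ltNge.
  rewrite eE in eE'; have /negP := forest_bridge fE eE'; apply; rewrite -eE.
  apply: conn_trans (_ : conn _ _ i) _; first by rewrite conn_sym.
  by apply: conn_trans c3 _; rewrite conn_sym -pj.
rewrite h andbT; case: (p) h pj => [|a p' /= /andP[]//].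
by move=> _ /= /eqP; rewrite (negbTE ij).
Qed.

End TreeWeightE.

(** * Moebius inversion *)

Section Moebius.
Variable k : nat.
Hypothesis k0 : (0 < k)%N.
Implicit Types (F Pi : {set {set 'I_k}}).

Definition compat F Pi :=
  [forall i, forall j, adjacent F i j ==> (finset.pblock Pi i == finset.pblock Pi j)].

Section Kernel.
Variables (q : nat) (Pi : {set {set 'I_k}}).
Hypothesis pPi : finset.partition Pi [set: 'I_k]%SET.
Notation col := {ffun 'I_k -> 'I_q}.

Let pblock_in i : finset.pblock Pi i \in Pi.
Proof. by apply: pblock_mem; case/and3P: pPi => /eqP -> _ _; rewrite inE. Qed.

Let pblock_eq i j : (finset.pblock Pi i == finset.pblock Pi j) = (j \in finset.pblock Pi i).
Proof. by case/and3P: pPi => /eqP cov tr _; rewrite eq_pblock// cov inE. Qed.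

Let B0 := pblock_in (Ordinal k0).
Let idx i : 'I_#|Pi| := enum_rank_in B0 (finset.pblock Pi i).

Let idxE i j : (idx i == idx j) = (j \in finset.pblock Pi i).
Proof.
rewrite -pblock_eq; apply/eqP/eqP => [E|E]; last by rewrite /idx E.
by rewrite -[LHS](enum_rankK_in B0)// -/(idx i) E enum_rankK_in.
Qed.

Let pick_block (r : 'I_#|Pi|) : {i | idx i = r}.
Proof.
have rP := enum_valP r.
have /finset.set0Pn/sigW[i ir] : enum_val r != finset.set0.
  by case/and3P: pPi => _ _ n0; apply: contraNneq n0 => <-.
exists i; rewrite /idx; case/and3P: pPi => _ tr _.
by rewrite (def_pblock tr rP ir) enum_valK_in.
Qed.

Lemma kernelP (c : col) : reflect (forall i j, (c i == c j) = (j \in finset.pblock Pi i))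
  (preim_partition c [set: 'I_k]%SET == Pi).
Proof.
apply: (iffP eqP) => [<- i j|h].
  rewrite pblock_equivalence_partition ?inE// => x y z _ _ _.
  by split=> // /eqP ->.
rewrite -(equivalence_partition_pblock pPi) /preim_partition /equivalence_partition.
apply: eq_imset => i; apply/setP => j; rewrite !inE; exact: h.
Qed.

(** A coloring with kernel [Pi] is an injective assignment of colors to blocks, precomposed with the
    index of the block. *)
Lemma card_kernel :
  #|[set c : col | preim_partition c [set: 'I_k]%SET == Pi]%SET| = q ^_ #|Pi|.
Proof.
pose f (g : {ffun 'I_#|Pi| -> 'I_q}) : col := [ffun i => g (idx i)].
have -> : [set c : col | preim_partition c [set: 'I_k]%SET == Pi]%SET =
    f @: [set g : {ffun _} | injectiveb g]%SET.
  apply/setP => c; rewrite inE; apply/kernelP/imsetP => [h|[g + ->] i j].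
    exists [ffun r => c (sval (pick_block r))].
      rewrite inE; apply/injectiveP => r r'; rewrite !ffunE => /eqP.
      by rewrite h -idxE (svalP (pick_block r)) (svalP (pick_block r')) => /eqP.
    apply/ffunP => i; rewrite !ffunE; apply/eqP; rewrite h -idxE.
    by rewrite (svalP (pick_block _)).
  by rewrite inE => /injectiveP gi; rewrite !ffunE -idxE; apply: inj_eq.
rewrite card_in_imset ?card_inj_ffuns ?card_ord// => g g' _ _ /ffunP E.
apply/ffunP => r; have := E (sval (pick_block r)).
by rewrite !ffunE (svalP (pick_block r)).
Qed.

End Kernel.

Lemma card_colorings_partitions F q : #|colorings q F| =
  (\sum_(Pi | finset.partition Pi [set: 'I_k]%SET && compat F Pi) q.+1 ^_ #|Pi|)%N.
Proof.
rewrite -sum1_card (partition_big (fun c : {ffun 'I_k -> 'I_q.+1} => preim_partition c [set: 'I_k]%SET)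
   (fun Pi => finset.partition Pi [set: 'I_k]%SET && compat F Pi)) => [|c cF].
  apply: eq_bigr => Pi /andP[pPi cPi]; rewrite -(card_kernel _ pPi) -sum1_card.
  apply: eq_bigl => c; rewrite [RHS]inE andb_idl// => /kernelP-/(_ pPi) h.
  apply/coloringsP => i j ij; apply/eqP; rewrite h.
  case/connectP: ij => p; elim: p i => [|z p IH] i /=.
    by move=> _ ->; rewrite mem_pblock; case/and3P: pPi => /eqP -> _ _; rewrite inE.
  move=> /andP[iz zp] jE; have := IH _ zp jE.
  have /forallP/(_ i)/forallP/(_ z)/implyP/(_ iz)/eqP -> := cPi.
  by [].
rewrite preim_partitionP; apply/forallP => i; apply/forallP => j; apply/implyP => ij.
have pp := preim_partitionP c [set: 'I_k]%SET; case/and3P: (pp) => /eqP cov tr _.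
rewrite eq_pblock ?cov ?inE//.
have /kernelP <- // := eqxx (preim_partition c [set: 'I_k]%SET).
by apply/eqP; apply: (elimT (coloringsP _ _) cF); exact: connect1.
Qed.

(** * Falling factorials and coefficient extraction *)

Section Polynomial.
Context {R : realType}.

Let fall m : {poly R[i]} := \prod_(i < m) ('X - (i%:R)%:P).

Let fall_eval m n : (fall m).[n%:R] = (n ^_ m)%:R.
Proof.
rewrite horner_prod ffact_prod natr_prod; have [mn|nm] := leqP m n.
  apply: eq_bigr => i _; rewrite !hornerE natrB//.
  exact: leq_trans (ltnW (ltn_ord i)) mn.
rewrite (bigD1 (Ordinal nm))//= !hornerE subrr mul0r.
by rewrite (bigD1 (Ordinal nm))//= subnn mul0r.
Qed.

(** The linear coefficient of X(X - 1)...(X - m) is the Moebius value of a partition with m + 1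
    blocks. *)
Let fall_coef m : (fall m.+1)`_1 = (-1) ^+ m * (m`!)%:R.
Proof.
rewrite /fall big_ord_recl /= subr0 coefXM /= -horner_coef0 horner_prod.
under eq_bigr do rewrite !hornerE.
elim: m => [|m IH]; first by rewrite big_ord0 expr0 mul1r.
rewrite big_ord_recr /= IH /bump /= add1n factS natrM exprS; ring.
Qed.

(** Counting colorings by kernel gives, for every positive number of colors, that the sum over [Pi]
    of falling factorials times X^|F| equals X^k. This is then an identity of polynomials, and its
    coefficient of degree |F| + 1 is the claim. *)
Lemma sum_moebius F : forest F ->
  \sum_(Pi | finset.partition Pi [set: 'I_k]%SET && compat F Pi) moebius_to_top R Pi =
  (#|F| == k.-1)%:R.
Proof.
move=> fF; pose cP Pi := finset.partition Pi [set: 'I_k]%SET && compat F Pi.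
pose p : {poly R[i]} := \sum_(Pi | cP Pi) fall #|Pi| * 'X^#|F| - 'X^k.
have p0 : p = 0.
  apply: (@roots_geq_poly_eq0 _ p [seq q.+1%:R | q <- iota 0 (size p)]).
  - apply/allP => _ /mapP[q _ ->]; rewrite rootE /p !hornerE horner_sum.
    under eq_bigr do rewrite hornerM fall_eval hornerXn.
    rewrite -mulr_suml -natr_sum -card_colorings_partitions -natrX -natrM.
    by rewrite card_colorings_forest// natrX subrr.
  - rewrite map_inj_uniq ?iota_uniq// => q q' /eqP.
    by rewrite eqr_nat => /eqP[].
  - by rewrite size_map size_iota.
have card_pos Pi : cP Pi -> #|Pi| = #|Pi|.-1.+1.
  move=> /andP[/and3P[/eqP cov _ _] _]; rewrite prednK// card_gt0.
  apply/eqP => Pi0; have := finset.in_setT (Ordinal k0).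
  by rewrite -cov Pi0 /finset.cover big_set0 inE.
have Fk : (#|F| <= k.-1)%N.
  have := card_colorings_forest 1 fF; have : (2 <= #|colorings 1 F|)%N.
    have : ([set [ffun=> t] | t : 'I_2] \subset colorings 1 F).
      by apply/fintype.subsetP => c /imsetP[t _ ->]; apply/coloringsP => a b _; rewrite !ffunE.
    move/subset_leq_card; rewrite card_imset ?card_ord// => t t' /ffunP/(_ (Ordinal k0)).
    by rewrite !ffunE.
  move=> c2 cE; have : (2 ^ #|F|.+1 <= 2 ^ k)%N by rewrite -cE expnS leq_mul2r c2 orbT.
  by rewrite leq_exp2l// => h; rewrite -ltnS prednK.
have := congr1 (fun p : {poly R[i]} => p`_(#|F|.+1)) p0.
rewrite /p coef0 coefB coefXn coef_sum.
under eq_bigr => Pi cPi.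
  rewrite coefMXn ltnNge leqnSn /= subSnn (card_pos _ cPi) fall_coef.
  over.
move/eqP; rewrite subr_eq0 => /eqP E.
have -> : (#|F| == k.-1) = (#|F|.+1 == k) by rewrite -[LHS]eqSS (prednK k0).
rewrite -E; apply: eq_bigr => Pi cPi.
by rewrite /moebius_to_top.
Qed.

End Polynomial.
End Moebius.

(** * Edge operators *)

Section Clairaut.
Context {R : realType} {k n : nat}.
Implicit Types (g : 'M[R]_(k, n) -> R) (x v w : 'M[R]_(k, n)).

Lemma is_derive_line g x v (s : R) : (forall y, differentiable g y) ->
  is_derive s 1 (fun s : R => g (x + s *: v)) ('D_v g (x + s *: v)).
Proof.
move=> dg; rewrite deriveE_sum//.
apply: (@is_derive_path _ _ _ g (fun s => x + s *: v)) => // i j.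
rewrite (_ : (fun s => _) = cst (x i j) + v i j *: (id : R -> R)).
  exact: is_derive_affine.
by apply/funext => r; rewrite !mxE /= mulrC.
Qed.

Lemma MVT_line g (h : R) (f df : R -> R) : 0 < h ->
  (forall s : R, is_derive s 1 f (df s)) ->
  exists2 s, 0 < s < h & f h - f 0 = h * df s.
Proof.
move=> h0 fdf; have [|s sh ->] := @MVT R f df 0 h h0 (fun s _ => fdf s).
- apply: continuous_subspaceT => s; apply: differentiable_continuous.
  by apply/derivable1_diffP; case: (fdf s).
- by exists s; [move: sh; rewrite in_itv|rewrite subr0 mulrC].
Qed.

(** The mean value theorem is used twice, first along [v] on the difference in the direction [w],
    then along [w] on the derivative in the direction [v]. *)
Lemma mixed_difference g x v w (h : R) : 0 < h -> (forall y, differentiable g y) ->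
  (forall y, differentiable ('D_v g) y) ->
  exists s t, [/\ 0 < s < h, 0 < t < h &
    g (x + h *: v + h *: w) - g (x + h *: v) - (g (x + h *: w) - g x) =
    h * (h * 'D_w ('D_v g) (x + s *: v + t *: w))].
Proof.
move=> h0 dg ddg.
pose f s := g (x + h *: w + s *: v) - g (x + s *: v).
have df (s : R) : is_derive s 1 f ('D_v g (x + h *: w + s *: v) - 'D_v g (x + s *: v)).
  by apply: is_deriveB; exact: is_derive_line.
have [s sh] := MVT_line g h0 df.
rewrite /f scale0r !addr0 [x + h *: w + _]addrAC => ->.
have [t th] := MVT_line g h0 (fun t => is_derive_line (x + s *: v) w t ddg).
rewrite scale0r addr0 => e.
by exists s, t; split=> //; rewrite [x + h *: w + _]addrAC e.
Qed.

(** Both orders of differentiation, taken at points near [x], represent the same second difference;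
    if they differed at [x] by e > 0, continuity to within e/2 would be contradicted. *)
Lemma derive_comm g x v w : (forall y, differentiable g y) ->
  (forall y, differentiable ('D_v g) y) -> (forall y, differentiable ('D_w g) y) ->
  {for x, continuous ('D_w ('D_v g))} -> {for x, continuous ('D_v ('D_w g))} ->
  'D_w ('D_v g) x = 'D_v ('D_w g) x.
Proof.
move=> dg dv dw c1 c2; apply/eqP; rewrite -subr_eq0 -normr_le0 leNgt; apply/negP => e0.
set e := `|_| in e0; have e20 : 0 < e / 2 by rewrite divr_gt0.
have /cvgrPdist_lt /(_ _ e20) n1 := c1; have /cvgrPdist_lt /(_ _ e20) n2 := c2.
have [r /= r0 br] := (nbhs_ballP x _).1 (filterI n1 n2).
(* With h = r/N the points x + s v + t w stay in the ball of radius r for s, t < h; the summand 1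
   keeps N positive. *)
pose N := `|v| + `|w| + 1; have N0 : 0 < N by rewrite ltr_wpDl ?addr_ge0.
pose h := r / N; have h0 : 0 < h by rewrite divr_gt0.
have inb s t : 0 < s < h -> 0 < t < h -> ball x r (x + s *: v + t *: w).
  move=> /andP[s0 sh] /andP[t0 th]; rewrite -ball_normE /= -addrA opprD addrA subrr add0r normrN.
  rewrite (le_lt_trans (ler_normD _ _))// !normrZ (gtr0_norm s0) (gtr0_norm t0).
  apply: (@le_lt_trans _ _ (h * (`|v| + `|w|))).
    by rewrite mulrDr lerD// ler_wpM2r// ltW.
  by rewrite /h mulrAC ltr_pdivrMr// ltr_pM2l// ltrDl.
have [s1 [t1 [s1h t1h E1]]] := mixed_difference x w h0 dg dv.
have [s2 [t2 [s2h t2h E2]]] := mixed_difference x v h0 dg dw.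
have E : 'D_w ('D_v g) (x + s1 *: v + t1 *: w) = 'D_v ('D_w g) (x + t2 *: v + s2 *: w).
  rewrite [x + t2 *: v + _]addrAC.
  have EE : g (x + h *: v + h *: w) - g (x + h *: v) - (g (x + h *: w) - g x) =
      g (x + h *: w + h *: v) - g (x + h *: w) - (g (x + h *: v) - g x).
    rewrite [x + h *: w + _]addrAC; move: (g _) (g _) (g _) (g _) => r1 r2 r3 r4.
    by rewrite !opprB addrACA [X in _ + X = _]addrC addrACA.
  have := etrans (esym E1) (etrans EE E2).
  by move=> /(mulfI (lt0r_neq0 h0)) /(mulfI (lt0r_neq0 h0)).
have [m1 _] := br _ (inb _ _ s1h t1h); have [_ m2] := br _ (inb _ _ t2h s2h).
suff : e < e by rewrite ltxx.
have eE : e = `|('D_w ('D_v g) x - 'D_w ('D_v g) (x + s1 *: v + t1 *: w)) -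
    ('D_v ('D_w g) x - 'D_v ('D_w g) (x + t2 *: v + s2 *: w))|.
  by rewrite E /e opprB addrA subrK.
rewrite {1}eE [ltRHS](splitr e).
exact: le_lt_trans (ler_normB _ _) (ltrD m1 m2).
Qed.

Lemma DpC g i j i' j' : rtame g -> Dp i j (Dp i' j' g) = Dp i' j' (Dp i j g).
Proof.
move=> tg; apply/funext => x.
apply: derive_comm => [y|y|y||]; try (by apply: rtame_diff => //; exact: rtame_Dp);
  by apply: rtame_continuous; do 2 apply: rtame_Dp.
Qed.

End Clairaut.

Section EdgeOperators.
Context {R : realType} {k n : nat}.
Implicit Types (g : 'M[R]_(k, n) -> R) (e : {set 'I_k}) (F : {set {set 'I_k}}).

Definition edge_op e g := if enum e is [:: i; i'] then row_laplacian i i' g else g.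

Definition forest_op F g := foldr edge_op g (enum F).

Lemma rtame_edge_op e g : rtame g -> rtame (edge_op e g).
Proof.
rewrite /edge_op; case: (enum e) => [//|i [//|i' [|//]]] tg; exact: rtame_row_laplacian.
Qed.

Lemma row_laplacianC i i' l l' g : rtame g ->
  row_laplacian i i' (row_laplacian l l' g) = row_laplacian l l' (row_laplacian i i' g).
Proof.
move=> tg; have E a a' b b' : row_laplacian a a' (row_laplacian b b' g) =
    fun x => \sum_j \sum_j' Dp a j (Dp a' j (Dp b j' (Dp b' j' g))) x.
  rewrite /row_laplacian; apply/funext => x; apply: eq_bigr => j _.
  rewrite Dp_sum; last by move=> j' _; do 2 apply: rtame_Dp.
  by rewrite Dp_sum// => j' _; do 3 apply: rtame_Dp.
apply: etrans (E i i' l l') (etrans _ (esym (E l l' i i'))).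
apply/funext => x; apply: etrans (exchange_big _ _ _ _ _ _) _.
apply: eq_bigr => j _; apply: eq_bigr => j' _.
have tD a b f : rtame f -> rtame (Dp a b f) := fun H => rtame_Dp a b H.
suff H : Dp i j' (Dp i' j' (Dp l j (Dp l' j g))) = Dp l j (Dp l' j (Dp i j' (Dp i' j' g))).
  exact: (congr1 (fun f => f x) H).
have H1 : Dp i' j' (Dp l j (Dp l' j g)) = Dp l j (Dp i' j' (Dp l' j g)) by exact/DpC/tD.
have H2 : Dp i j' (Dp l j (Dp i' j' (Dp l' j g))) = Dp l j (Dp i j' (Dp i' j' (Dp l' j g))).
  exact/DpC/tD/tD.
have H3 : Dp i' j' (Dp l' j g) = Dp l' j (Dp i' j' g) by exact/DpC.
have H4 : Dp i j' (Dp l' j (Dp i' j' g)) = Dp l' j (Dp i j' (Dp i' j' g)) by exact/DpC/tD.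
rewrite H1.
rewrite H2.
rewrite H3.
rewrite H4.
reflexivity.
Qed.

Lemma edge_opC e e' g : rtame g -> edge_op e (edge_op e' g) = edge_op e' (edge_op e g).
Proof.
rewrite /edge_op; case: (enum e) => [//|i [//|i' [|//]]].
by case: (enum e') => [//|l [//|l' [|//]]] tg; exact: row_laplacianC.
Qed.

Lemma rtame_foldr_edge_op s g : rtame g -> rtame (foldr edge_op g s).
Proof. by move=> tg; elim: s => //= e s; exact: rtame_edge_op. Qed.

Lemma rtame_forest_op F g : rtame g -> rtame (forest_op F g).
Proof. exact: rtame_foldr_edge_op. Qed.

Lemma foldr_edge_op_perm s t g : rtame g -> perm_eq s t ->
  foldr edge_op g s = foldr edge_op g t.
Proof.
move=> tg; elim: s t => [|e s IH] t; first by rewrite perm_sym => /perm_nilP ->.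
move=> st; have et : e \in t by rewrite -(perm_mem st) mem_head.
case/path.splitPr: et st => p1 p2.
rewrite perm_sym -[e :: p2]cat1s perm_catCA /= perm_cons perm_sym => /IH /= ->.
elim: p1 => //= e' p1 <-; exact/edge_opC/rtame_foldr_edge_op.
Qed.

(** The expansion adds edges in the order of their values, whereas the operator applies them in the
    order of the enumeration; commutation reconciles the two. *)
Lemma forest_op_add e F g : rtame g -> e \notin F ->
  forest_op (e |: F) g = edge_op e (forest_op F g).
Proof.
move=> tg eF; rewrite -[RHS]/(foldr edge_op g (e :: enum F)).
apply: foldr_edge_op_perm => //; apply: uniq_perm; rewrite ?enum_uniq//=.
  by rewrite mem_enum eF enum_uniq.
by move=> e'; rewrite mem_enum !inE mem_enum.
Qed.

Lemma forest_op0 g : forest_op finset.set0 g = g.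
Proof. by rewrite /forest_op enum_set0. Qed.

Lemma edge_op_set2 a b g : rtame g -> a != b ->
  edge_op [set a; b]%SET g = row_laplacian a b g.
Proof.
move=> tg ab; have sz : size (enum [set a; b]%SET) = 2 by rewrite -cardE cards2 ab.
have := enum_uniq [set a; b]%SET; have := mem_enum [set a; b]%SET.
rewrite /edge_op; case: (enum _) sz => [//|i [//|i' [|//]]] _ H /=; rewrite inE andbT => ii'.
have : i \in [set a; b]%SET by rewrite -H mem_head.
have : i' \in [set a; b]%SET by rewrite -H !inE eqxx orbT.
have S : row_laplacian a b g = row_laplacian b a g.
  by apply/funext => x; apply: eq_bigr => j _; rewrite DpC.
rewrite !inE => /orP[]/eqP i'E /orP[]/eqP iE.
- by exfalso; move: ii'; rewrite i'E iE eqxx.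
- by rewrite i'E iE; exact: esym.
- by rewrite i'E iE; reflexivity.
- by exfalso; move: ii'; rewrite i'E iE eqxx.
Qed.

End EdgeOperators.

(** * The forest expansion *)

Section FiniteChoice.
Context d (T : measurableType d) {R : realType}.

Lemma measurable_finite_choice (I : finType) (phi : T -> I) (H : I -> T -> R) :
  (forall i, measurable (phi @^-1` [set i])) ->
  (forall i, measurable_fun setT (H i)) -> measurable_fun setT (fun w => H (phi w) w).
Proof.
move=> mphi mH.
rewrite (_ : (fun w => _) = fun w => \sum_i (\1_(phi @^-1` [set i]) w * H i w)).
  by apply: measurable_sum => i; apply: measurable_funM => //; exact: measurable_indic.
apply/funext => w; rewrite (bigD1 (phi w))//= big1 ?addr0.
  by rewrite indicE mem_set// mul1r.
by move=> i /eqP ne; rewrite indicE memNset ?mul0r// => /= h; apply: ne.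
Qed.

Lemma measurable_finset (I : finType) (p : I -> T -> bool) (s : {set I}) :
  (forall i, measurable_fun setT (p i)) ->
  measurable ((fun w => [set i | p i w]%SET) @^-1` [set s]).
Proof.
move=> mp; rewrite (_ : _ @^-1` _ = \bigcap_(i in [set: I]) (p i @^-1` [set i \in s])).
  apply: fin_bigcap_measurable => [|i _]; first exact: finite_finset.
  by rewrite -[_ @^-1` _]setTI; exact: mp.
apply/seteqP; split=> [w /= <- i _|w h] /=; first by rewrite inE.
by apply/setP => i; rewrite inE; exact: (h i).
Qed.

Lemma measurable_bigmax (I : Type) (r : seq I) (q : pred I) (f0 : T -> R) (f : I -> T -> R) :
  measurable_fun setT f0 -> (forall i, measurable_fun setT (f i)) ->
  measurable_fun setT (fun w => \big[Num.max/f0 w]_(i <- r | q i) f i w).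
Proof.
move=> m0 mf; elim: r => [|i r IH]; first by under eq_fun do rewrite big_nil.
under eq_fun do rewrite big_cons; case: (q i) => //.
exact: measurable_maxr.
Qed.

Lemma measurable_bigmin (I : Type) (r : seq I) (q : pred I) (f0 : T -> R) (f : I -> T -> R) :
  measurable_fun setT f0 -> (forall i, measurable_fun setT (f i)) ->
  measurable_fun setT (fun w => \big[Num.min/f0 w]_(i <- r | q i) f i w).
Proof.
move=> m0 mf; elim: r => [|i r IH]; first by under eq_fun do rewrite big_nil.
under eq_fun do rewrite big_cons; case: (q i) => //.
exact: measurable_minr.
Qed.

(** The range of the maximum varies with the sample point, but only through the set of comparisons X
    e w <= X e' w. This set takes finitely many values, and for each of them the range is fixed. *)
Lemma measurable_wt k (cT : eqType) (F : {set {set 'I_k}}) (X : {set 'I_k} -> T -> R)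
    (V : T -> R) (c : 'I_k -> cT) i j :
  (forall e, measurable_fun setT (X e)) -> measurable_fun setT V ->
  measurable_fun setT (fun w => wt F (X^~ w) (V w) c i j).
Proof.
move=> mX mV.
pose phi w := [set p : {set 'I_k} * {set 'I_k} | X p.1 w <= X p.2 w]%SET.
pose H (rho : {set {set 'I_k} * {set 'I_k}}) w : R := if i == j then 1 else \big[Num.max/(if c i == c j then V w else 0)]_(e in F |
  conn [set e' in F | (e, e') \in rho]%SET i j) X e w.
rewrite (_ : (fun w => _) = fun w => H (phi w) w).
  apply: measurable_finite_choice => rho.
    by apply: measurable_finset => p; apply: measurable_fun_ler.
  rewrite /H; case: (i == j) => //; apply: measurable_bigmax => //.
  by case: (c i == c j).
apply/funext => w; rewrite /H /wt; case: ifP => // _; apply: eq_bigl => e.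
by congr (_ && conn _ _ _); apply/setP => e'; rewrite !inE.
Qed.

End FiniteChoice.

Section SquareRootWeight.
Context {R : realType} {k : nat} {cT : eqType}.
Variables (F : {set {set 'I_k}}) (x : {set 'I_k} -> R) (v : R) (c : 'I_k -> cT).
Hypotheses (k0 : (0 < k)%N) (x01 : forall e, 0 < x e < 1) (v01 : 0 <= v < 1).
Hypothesis col : colored F c.

Let x01' e : 0 <= x e <= 1. Proof. by case/andP: (x01 e) => a b; rewrite !ltW. Qed.

Let wt_quad : exists lam, [/\ 0 < lam, lam <= k%:R &
  forall u : 'cV_k, lam * dot u u <= form (wt_mx F x v c) u u <= k%:R * dot u u].
Proof.
case/andP: v01 => v0 v1.
(* The form is at least 1 - M, which is positive because [v] and all edge values are strictly below
   1. *)
pose M := \big[Num.max/v]_(e in F) x e.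
have M0 : 0 <= M by apply: le_trans v0 _; exact: bigmax_ge_id.
have M1 : M < 1 by apply/bigmax_ltP; split=> // e _; case/andP: (x01 e).
exists (1 - M); split; first by rewrite subr_gt0.
- by rewrite (@le_trans _ _ 1)// ?gerBl// (ler_nat R 1).
- move=> u; apply: wt_mx_quad => //.
  + by rewrite v0 ltW.
  + by rewrite M0.
  + by move=> e eF; exact: (le_bigmax_cond _ x).
  + exact: bigmax_ge_id.
Qed.

Definition sqrt_wt := sqrt_pd k%:R (wt_mx F x v c).

Lemma sqrt_wtK : sqrt_wt *m sqrt_wt = wt_mx F x v c.
Proof. by have [lam [l0 lk q]] := wt_quad; exact: sqrt_pdK (wt_mx_sym _ _ _ _) l0 lk q. Qed.

Lemma sqrt_wt_sym : sqrt_wt^T = sqrt_wt.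
Proof. by apply: sqrt_pd_sym; exact: wt_mx_sym. Qed.

Lemma sqrt_mx_wt : sqrt_mx (wt_mx F x v c) = sqrt_wt.
Proof. by have [lam [l0 lk q]] := wt_quad; exact: (sqrt_mxE (wt_mx_sym _ _ _ _) l0 lk q). Qed.

(* The diagonal entries of [sqrt_wt ^ 2] are 1. *)
Lemma norm_sqrt_wt : `|sqrt_wt| <= 1.
Proof.
apply: mx_norm_le => // i j.
have : (sqrt_wt *m sqrt_wt) i i = 1 by rewrite sqrt_wtK mxE /wt eqxx.
have S l : sqrt_wt l i = sqrt_wt i l by rewrite -{1}sqrt_wt_sym mxE.
rewrite mxE (bigD1 j)//= S => E.
rewrite -(ler_pXn2r (n := 2))// ?nnegrE// expr1n real_normK ?num_real// -E expr2 lerDl.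
by apply: sumr_ge0 => l _; rewrite S -expr2 sqr_ge0.
Qed.

Lemma gf_sqrt_wt n d (T : measurableType d) (P : probability T R) (Z : T -> 'M[R]_(k, n)) :
  gaussian_field P Z 1%:M ->
  gaussian_field P (fun z => sqrt_wt *m Z z) (wt_mx F x v c).
Proof.
by move=> gZ; have := gf_linear sqrt_wt gZ; rewrite mulmx1 sqrt_wt_sym sqrt_wtK.
Qed.

End SquareRootWeight.

(** * One step of the expansion *)

Section Duhamel.
Context {R : realType} {k n : nat} {cT : eqType}.
Variables (c : 'I_k -> cT) (k0 : (0 < k)%N).
Context d (T : measurableType d) (P : probability T R) (Z : T -> 'M[R]_(k, n)).
Hypothesis gZ : gaussian_field P Z 1%:M.
Implicit Types (F : {set {set 'I_k}}) (x : {set 'I_k} -> R) (e : {set 'I_k}).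

Definition colored_forest F := forest F && [forall i, forall j, adjacent F i j ==> (c i == c j)].

Lemma colored_forestP F : reflect (forest F /\ colored F c) (colored_forest F).
Proof.
apply: (iffP andP) => -[fF h]; split=> //.
  by move=> i j ij; apply/eqP; move/forallP/(_ i)/forallP/(_ j)/implyP: h; exact.
by apply/forallP => i; apply/forallP => j; apply/implyP => /h ->.
Qed.

Definition addable F := [set e | (e \notin F) && colored_forest (e |: F)]%SET.

Lemma addable_set2 F i j : colored_forest F ->
  ([set i; j]%SET \in addable F) = (c i == c j) && ~~ conn F i j.
Proof.
move=> /colored_forestP[fF cF]; rewrite inE; apply/andP/andP.
  move=> [ijF /colored_forestP[f' c']]; split; first by apply/eqP/c'; rewrite /adjacent /= setU11.
  have := forest_bridge f' (setU11 _ F : [set i; j]%SET \in _).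
  by rewrite finset.setU1K.
move=> [/eqP cij nij]; have ij : i != j by apply: contra nij => /eqP ->; exact: conn_refl.
split; first by apply: contra nij; exact: conn_edge.
apply/colored_forestP; split; first exact: forest_add.
move=> a b; rewrite /adjacent /= in_setU1 => /orP[/eqP|]; last exact: cF.
by move=> /esym/set2_eq[[-> ->]|[-> ->]].
Qed.

(** Each edge comes from two ordered pairs. The factor 2 cancels the 1/2 in the derivative of the
    Gaussian interpolation. *)
Lemma sum_addable F (G : {set 'I_k} -> R) : colored_forest F ->
  \sum_i \sum_j ((c i == c j) && ~~ conn F i j)%:R * G [set i; j]%SET =
  2 * \sum_(e in addable F) G e.
Proof.
move=> FF; rewrite pair_big /=.
transitivity (\sum_(p : 'I_k * 'I_k | [set p.1; p.2]%SET \in addable F) G [set p.1; p.2]%SET).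
  rewrite [RHS]big_mkcond; apply: eq_bigr => -[i j] _ /=; rewrite addable_set2//.
  by case: (_ && _); rewrite ?mul1r ?mul0r.
rewrite (partition_big (fun p => [set p.1; p.2]%SET) (mem (addable F)))//= mulr_sumr.
apply: eq_bigr => e eA.
have [a [b [ab E]]] : exists a b, a != b /\ e = [set a; b]%SET.
  move: eA; rewrite inE => /andP[_ /colored_forestP[f' _]].
  by apply: (forest_edge f'); exact: setU11.
rewrite (bigD1 (a, b)) /=; last by rewrite E -{1}E eA eqxx.
rewrite (bigD1 (b, a)) /=; last first.
  by rewrite E [[set b; a]%SET]finset.setUC -{1}E eA eqxx /= xpair_eqE [b == a]eq_sym (negbTE ab).
rewrite [[set b; a]%SET]finset.setUC -E big1 ?addr0; first by rewrite mulrDl mul1r.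
move=> [i j] /= /andP[/andP[/andP[_ /eqP ijE] nab] nba]; exfalso.
move: ijE; rewrite E => /esym/set2_eq[[ia jb]|[ia jb]].
  by rewrite ia jb eqxx in nab.
by rewrite ia jb eqxx in nba.
Qed.

Definition gam F x v (f : 'M[R]_(k, n) -> R) := \int[P]_z f (sqrt_wt F x v c *m Z z).

Definition upd x e (s : R) e' := if e' == e then s else x e'.

(** The strength for [F] runs up to this value. The default 1 is the end of the range for the empty
    forest. *)
Definition mn F x := \big[Num.min/1]_(e in F) x e.

Lemma mn_gt0 F x : (forall e, 0 < x e) -> 0 < mn F x.
Proof. by move=> x0; apply/bigmin_gtP; split=> // e _; exact: x0. Qed.

Lemma mn_le F x e : e \in F -> mn F x <= x e.
Proof. by move=> eF; exact: (bigmin_le_cond _ x). Qed.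

Lemma mn_le1 F x : mn F x <= 1.
Proof. exact: bigmin_le_id. Qed.

Lemma mn_lt1 F x e : e \in F -> x e < 1 -> mn F x < 1.
Proof. by move=> eF; apply: le_lt_trans; exact: mn_le. Qed.

(** A new edge carries the current strength [s], below all older values, and so is the minimum of
    the enlarged forest. That forest at the top of its range continues [F] at strength [s], which
    closes the recursion. *)
Lemma wt_mx_upd F x e s : forest (e |: F) -> e \notin F -> colored (e |: F) c ->
  (forall e, 0 < x e < 1) -> 0 < s < mn F x ->
  wt_mx (e |: F) (upd x e s) (mn (e |: F) (upd x e s)) c = wt_mx F x s c.
Proof.
move=> fF eF cF x01 /andP[s0 sm].
have s1 : s < 1 by apply: lt_le_trans sm _; exact: mn_le1.
have xe : upd x e s e = s by rewrite /upd eqxx.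
have xF e' : e' \in F -> upd x e s e' = x e'.
  by rewrite /upd; case: eqVneq => // ->; rewrite (negbTE eF).
have sx e' : e' \in F -> s <= x e' by move=> e'F; apply: le_trans (ltW sm) _; exact: mn_le.
have -> : mn (e |: F) (upd x e s) = upd x e s e.
  apply/eqP; rewrite eq_le mn_le ?setU11//= xe; apply/bigmin_geP; split; first exact: ltW.
  by move=> e'; rewrite in_setU1 => /orP[/eqP ->|e'F]; rewrite ?xe// xF// sx.
apply/matrixP => i j; rewrite !mxE wt_add//.
- rewrite xe /wt; case: (i == j) => //.
  have lE u : level F (upd x e s) u = level F x u.
    by apply/setP => e'; rewrite !inE; case: (boolP (e' \in F)) => // /xF ->.
  apply: eq_big => [e'|e' /andP[e'F _]]; last exact: xF.
  by case: (boolP (e' \in F)) => //= e'F; rewrite lE xF.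
- by move=> e'; rewrite /upd; case: ifP => _; [rewrite !ltW|case/andP: (x01 e') => *; rewrite !ltW].
- by move=> e' e'F; rewrite xe xF// sx.
Qed.

(** The upper end is an arbitrary field with the right covariance: for the empty forest and m = 1
    the covariance may be singular, out of reach of [gf_sqrt_wt]. *)
Lemma gam_ftc F x m f d2 (T2 : measurableType d2) (P2 : probability T2 R)
    (X2 : T2 -> 'M[R]_(k, n)) :
  colored_forest F -> (forall e, 0 < x e < 1) -> 0 < m <= 1 ->
  (forall e, e \in F -> m <= x e) -> gaussian_field P2 X2 (wt_mx F x m c) -> rtame f ->
  \int[P2]_z f (X2 z) = gam F x 0 f +
    \int[lebesgue_measure]_(s in `]0, m[) \sum_(e in addable F) gam F x s (edge_op e f).
Proof.
move=> FF x01 /andP[m0 m1] mF g2 tf; have /colored_forestP[fF cF] := FF.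
have x01' e : 0 <= x e <= 1 by case/andP: (x01 e) => *; rewrite !ltW.
have v01 : 0 <= (0 : R) < 1 by rewrite lexx ltr01.
have g1 := gf_sqrt_wt k0 x01 v01 cF gZ.
pose Delta : 'M[R]_k := \matrix_(i, j) ((c i == c j) && ~~ conn F i j)%:R.
have wtE v : 0 <= v <= 1 -> (forall e, e \in F -> v <= x e) ->
    wt_mx F x v c = wt_mx F x 0 c + v *: Delta.
  by move=> v01' vF; apply/matrixP => i j; rewrite !mxE wt_affine.
apply/eqP; rewrite addrC -subr_eq; apply/eqP.
apply: (gf_ftc g1 g2 m0 (Delta := Delta)) => //.
  by apply: wtE => //; rewrite m1 ltW.
move=> s /andP[s0 sm].
have s01 : 0 <= s < 1 by rewrite ltW//= (lt_le_trans sm).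
have sm01 : 0 <= s / m <= 1.
  apply/andP; split; first by rewrite divr_ge0// ltW.
  by rewrite ler_pdivrMr// mul1r ltW.
have gi := gf_interp g1 g2 sm01.
have gs := gf_sqrt_wt k0 x01 s01 cF gZ.
have CE : (1 - s / m) *: wt_mx F x 0 c + (s / m) *: wt_mx F x m c = wt_mx F x s c.
  rewrite (wtE m) ?m1 ?ltW// (wtE s); last 2 first.
  - by case/andP: s01 => -> /ltW ->.
  - by move=> e eF; apply: le_trans (ltW sm) (mF _ eF).
  by rewrite scalerDr addrA -scalerDl subrK scale1r scalerA divfK// lt0r_neq0.
apply: (mulfI (_ : (2 : R) != 0)) => //.
rewrite mulrA divff// mul1r -sum_addable//; apply: eq_bigr => i _; apply: eq_bigr => j _.
rewrite mxE; case: (boolP (_ && _)) => [/andP[_ nij]|_]; rewrite ?mul0r// !mul1r.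
have ij : i != j by apply: contra nij => /eqP ->; exact: conn_refl.
rewrite finset.setUC edge_op_set2//; last by rewrite eq_sym.
(* The interpolated field at time s/m and the canonical field at strength s have equal
   covariance. *)
by apply/esym/(gf_unique gi gs CE)/rtame_row_laplacian.
Qed.

End Duhamel.

Lemma integrable_bounded d (T : measurableType d) {R : realType} (P : probability T R)
    (f : T -> R) (K : R) :
  measurable_fun setT f -> (forall x, `|f x| <= K) -> P.-integrable setT (EFin \o f).
Proof.
move=> mf fK; apply: (integrable_le mf fK).
exact: finite_measure_integrable_cst.
Qed.

(** * Uniform edge values *)

Section Uniform.
Context {R : realType} {d} {T : measurableType d} (P : probability T R) (U : T -> R).
Hypothesis lU : has_law P U (uniform_prob (@ltr01 R)).

Lemma Rintegral_uniform (f : R -> R) (m : R) : measurable_fun setT f -> 0 <= m <= 1 ->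
  \int[lebesgue_measure]_(s in `]0, m[) f s = \int[P]_w ((0 < U w < m)%R%:R * f (U w)).
Proof.
move=> mf /andP[m0 m1]; pose h s : R := (0 < s < m)%R%:R * f s.
have mh : measurable_fun setT h.
  apply: measurable_funM => //.
  rewrite (_ : (fun s => _) = (fun s => if (0 < s) && (s < m) then 1 else 0)); last first.
    by apply/funext => s; case: (_ && _).
  by apply: measurable_fun_ifT => //; apply: measurable_and; exact: measurable_fun_ltr.
have lU' : has_law P U (@uniform_prob R 0 1 ltr01 : probability (measurableTypeR R) R) by [].
rewrite -[RHS]/(\int[P]_w h (U w)) (Rintegral_has_law lU' mh).
rewrite (@integral_density _ _ _ (@lebesgue_measure R) _ (uniform_pdf 0 1))//.
- rewrite Rintegral_mkcond; apply: eq_Rintegral => s _; rewrite patchE mem_setE in_itv /= /h.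
  case: (boolP (_ && _)) => [/andP[s0 sm]|_]; last by rewrite !mul0r.
  by rewrite mul1r /uniform_pdf subr0 invr1 (ltW s0) (ltW (lt_le_trans sm m1)) mulr1.
- exact: measurable_uniform_pdf.
- by move=> s; exact: uniform_pdf_ge0.
Qed.

Lemma uniform_interior : {ae P, forall w, 0 < U w < 1}.
Proof.
exists (U @^-1` (~` `]0, 1[)); split.
- rewrite -[X in measurable X]setTI; apply: lU.1 => //; exact/measurableC.
- rewrite lU.2; last exact/measurableC.
  have -> : uniform_prob (@ltr01 R) (~` `]0%R, 1%R[) = (1 - uniform_prob (@ltr01 R) `]0%R, 1%R[)%E.
    exact: probability_setC.
  have -> : uniform_prob (@ltr01 R) `]0%R, 1%R[ =
    (\int[lebesgue_measure]_(s in `]0%R, 1%R[) (uniform_pdf 0 1 s)%:E)%E by [].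
  rewrite (eq_integral (cst 1%E)); last first.
    move=> s; rewrite inE/= in_itv/= => /andP[s0 s1].
    by rewrite /uniform_pdf subr0 invr1 (ltW s0) (ltW s1).
  by rewrite integral_cst//= lebesgue_measure_itv/= lte_fin ltr01 mul1e sube0 subee.
- by move=> w /= h h'; apply: h; move: h'; rewrite /= in_itv.
Qed.

Lemma uniform_atom (y : R) : \int[P]_w (U w == y)%:R = 0.
Proof.
have lU' : has_law P U (@uniform_prob R 0 1 ltr01 : probability (measurableTypeR R) R) by [].
have h : (fun s : R => (s == y)%:R : R) = \1_[set y].
  apply/funext => s; rewrite indicE; congr (_%:R); congr nat_of_bool.
  by apply/eqP/idP => [->|]; rewrite inE.
have mh : measurable_fun setT (fun s : R => (s == y)%:R : R) by rewrite h; exact: measurable_indic.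
rewrite (Rintegral_has_law lU' mh) h /Rintegral integral_indic// setIT.
rewrite -[RHS]/(fine 0%E); congr fine.
have /null_content_dominatesP := dominates_uniform_prob (@ltr01 R); apply => //.
exact: lebesgue_measure_set1.
Qed.

End Uniform.

Section Measurability.
Context {R : realType} {k n : nat} {cT : eqType}.
Variables (c : 'I_k -> cT) (k0 : (0 < k)%N).
Context d (T : measurableType d) (P : probability T R) (Z : T -> 'M[R]_(k, n)).
Hypothesis gZ : gaussian_field P Z 1%:M.
Implicit Types (F : {set {set 'I_k}}) (e : {set 'I_k}).

Lemma measurable_gam d' (S : measurableType d') F (X : {set 'I_k} -> S -> R) (V : S -> R) f :
  (forall e, measurable_fun setT (X e)) -> measurable_fun setT V ->
  rtame f ->
  measurable_fun setT (fun w => gam c P Z F (X^~ w) (V w) f).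
Proof.
move=> mX mV tf.
pose h (p : S * T) := f (sqrt_wt F (X^~ p.1) (V p.1) c *m Z p.2).
apply: (measurable_fun_Rintegral P (f := h)).
apply: (measurable_comp_continuous (rtame_continuous tf)) => i j.
under eq_fun do rewrite mxE.
apply: measurable_sum => l; apply: measurable_funM; last first.
  exact: (measurableT_comp (gf_meas gZ l j) measurable_snd).
apply: (@measurableT_comp _ _ _ _ _ _ (fun w => sqrt_wt F (X^~ w) (V w) c i l) _ fst) => //.
apply: measurable_sqrt_pd => a b.
under eq_fun do rewrite mxE.
exact: measurable_wt.
Qed.

(** The bound is uniform because the entries of the square root are at most 1; the factor k in the
    rate comes from multiplying matrices in the max norm. *)
Lemma gam_bound f : rtame f -> exists K, forall F x v,
  (forall e, 0 < x e < 1) -> 0 <= v < 1 -> colored F c -> `|gam c P Z F x v f| <= K.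
Proof.
move=> tf; have [c1 [c2 [c10 c20 gc]]] := rtame_growth tf.
exists (\int[P]_z (c1 * expR (c2 * k%:R * `|Z z|))) => F x v x01 v01 cF.
have fi := gf_integrable (gf_sqrt_wt k0 x01 v01 cF gZ) tf.
have gi : P.-integrable setT (EFin \o (fun z => c1 * expR (c2 * k%:R * `|Z z|))).
  by apply: integrableZlR; exact: gf_exp gZ _.
have le z : `|f (sqrt_wt F x v c *m Z z)| <= c1 * expR (c2 * k%:R * `|Z z|).
  rewrite (le_trans (gc _))// ler_wpM2l// ler_expR -mulrA ler_wpM2l//.
  rewrite (le_trans (mx_norm_mulmx _ _))// ler_wpM2r// -[leRHS]mulr1 ler_wpM2l//.
  exact: norm_sqrt_wt.
rewrite (le_trans (le_normr_Rintegral measurableT fi))//.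
apply: le_Rintegral => //.
apply: (integrable_le _ _ gi); last by move=> z; rewrite normr_id.
have mf : measurable_fun setT (fun z => f (sqrt_wt F x v c *m Z z)).
  by apply/measurable_EFinP; case/integrableP: fi.
exact: measurableT_comp.
Qed.

(** Values outside ]0, 1[, a null event, are replaced by 1/2, so that the bounds hold at every
    sample point. *)
Definition cl (x : {set 'I_k} -> R) e : R := if 0 < x e < 1 then x e else 2^-1.

Lemma cl01 x e : 0 < cl x e < 1.
Proof.
rewrite /cl; case: (boolP (0 < x e < 1)) => // _.
by rewrite invr_gt0 ltr0n invf_lt1 ?ltr0n// ltr1n.
Qed.

Lemma clE x : (forall e, 0 < x e < 1) -> cl x = x.
Proof. by move=> x01; apply/funext => e; rewrite /cl x01. Qed.

Lemma measurable_cl d' (S : measurableType d') (X : {set 'I_k} -> S -> R) e :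
  measurable_fun setT (X e) -> measurable_fun setT (fun w => cl (X^~ w) e).
Proof.
move=> mX; apply: measurable_fun_ifT => //.
by apply: measurable_and; exact: measurable_fun_ltr.
Qed.

End Measurability.

Lemma measurable_sumP d (T : measurableType d) {R : realType} (I : Type) (r : seq I) (p : pred I)
    (f : I -> T -> R) : (forall i, p i -> measurable_fun setT (f i)) ->
  measurable_fun setT (fun x => \sum_(i <- r | p i) f i x).
Proof.
move=> mf; under eq_fun do rewrite big_mkcond.
by apply: measurable_sum => i; case: (boolP (p i)) => [/mf//|_]; exact: measurable_cst.
Qed.

(** * The one-step identity in expectation *)

Section ForestFormula.
Context {R : realType} {k n : nat} {cT : eqType}.
Variables (c : 'I_k -> cT) (k0 : (0 < k)%N).
Context d (T : measurableType d) (P : probability T R) (Z : T -> 'M[R]_(k, n)).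
Hypothesis gZ : gaussian_field P Z 1%:M.
Context d0 (T0 : measurableType d0) (P0 : probability T0 R) (X0 : T0 -> 'M[R]_(k, n)).
Hypothesis gX0 : gaussian_field P0 X0 (\matrix_(i, j) (c i == c j)%:R).
Variable g : 'M[R]_(k, n) -> R.
Hypothesis tg : rtame g.
Context dQ (Q : measurableType dQ) (PQ : probability Q R) (U : {set 'I_k} -> Q -> R).
Hypothesis iidU : iid_with_law PQ [set: {set 'I_k}]%SET U (uniform_prob (@ltr01 R)).
Implicit Types (F : {set {set 'I_k}}) (x : {set 'I_k} -> R) (e : {set 'I_k}).

Let tamF F : rtame (forest_op F g). Proof. exact: rtame_forest_op. Qed.

Definition forest_term F x := gam c P Z F (cl x) 0 (forest_op F g).

(* The value of the interpolation of [F] at the top of its range, where the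
   strength of the interaction across components is the least [x e]; for the
   empty forest the interpolation reaches the degenerate covariance of [X0]. *)
Definition top_term F x :=
  if F == finset.set0 then \int[P0]_z g (X0 z)
  else gam c P Z F (cl x) (mn F (cl x)) (forest_op F g).

Lemma mn_cl_bounds F x : F != finset.set0 -> 0 <= mn F (cl x) < 1.
Proof.
move=> /finset.set0Pn[e eF]; have /andP[e0 e1] := cl01 x e.
by rewrite (mn_lt1 eF)// ltW// mn_gt0// => e'; case/andP: (cl01 x e').
Qed.

(** By [wt_mx_upd] each term of the derivative of [F] at strength s is the top term of a larger
    forest, so the top terms satisfy a recursion among themselves. *)
Lemma top_term_ftc F x : colored_forest c F -> (forall e, 0 < x e < 1) ->
  top_term F x = forest_term F x +
    \int[lebesgue_measure]_(s in `]0, mn F x[) \sum_(e in addable c F) top_term (e |: F) (upd x e s).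
Proof.
move=> FF x01; have /colored_forestP[fF cF] := FF.
have m01 : 0 < mn F x <= 1 by rewrite mn_gt0 ?mn_le1// => e; case/andP: (x01 e).
have -> : \int[lebesgue_measure]_(s in `]0, mn F x[) \sum_(e in addable c F) top_term (e |: F) (upd x e s)
    = \int[lebesgue_measure]_(s in `]0, mn F x[) \sum_(e in addable c F) gam c P Z F x s (edge_op e (forest_op F g)).
  apply: eq_Rintegral => s; rewrite inE /= in_itv /= => s0m.
  have s01 : 0 < s < 1.
    by case/andP: s0m => -> /lt_le_trans; apply; exact: mn_le1.
  apply: eq_bigr => e; rewrite inE => /andP[eF /colored_forestP[fe ce]].
  rewrite /top_term ifF; last by apply/negbTE/finset.set0Pn; exists e; exact: setU11.
  rewrite clE; last by move=> e'; rewrite /upd; case: ifP.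
  by rewrite /gam /sqrt_wt (wt_mx_upd fe)// forest_op_add.
rewrite /forest_term clE// /top_term; case: (eqVneq F finset.set0) => [F0|F0].
  rewrite -(gam_ftc k0 gZ FF x01 m01 (fun e => @mn_le _ _ F x e) (X2 := X0) (P2 := P0))//.
    by rewrite F0 forest_op0.
  rewrite (_ : wt_mx _ _ _ _ = \matrix_(i, j) (c i == c j)%:R)//.
  apply/matrixP => i j; rewrite !mxE /wt F0 /mn !big_pred0 => [|e|e]; rewrite ?inE//.
  by case: (eqVneq i j) => [->|_]; [rewrite eqxx|case: ifP].
rewrite clE//; apply: (gam_ftc k0 gZ FF x01 m01 (fun e => @mn_le _ _ F x e)) => //.
apply: gf_sqrt_wt => //; have := mn_cl_bounds x F0; rewrite clE//.
Qed.

Lemma measurable_mn d' (S : measurableType d') F (X : {set 'I_k} -> S -> R) :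
  (forall e, measurable_fun setT (X e)) -> measurable_fun setT (fun w => mn F (X^~ w)).
Proof. by move=> mX; apply: measurable_bigmin => //; exact: measurable_cst. Qed.

Lemma measurable_forest_term d' (S : measurableType d') F (X : {set 'I_k} -> S -> R) :
  (forall e, measurable_fun setT (X e)) ->
  measurable_fun setT (fun w => forest_term F (X^~ w)).
Proof.
move=> mX; apply: (measurable_gam c gZ F (X := fun e w => cl (X^~ w) e) (V := cst 0)) => //.
by move=> e; exact: measurable_cl.
Qed.

Lemma measurable_top_term d' (S : measurableType d') F (X : {set 'I_k} -> S -> R) :
  (forall e, measurable_fun setT (X e)) ->
  measurable_fun setT (fun w => top_term F (X^~ w)).
Proof.
move=> mX; rewrite /top_term; case: (eqVneq F finset.set0) => // F0.
apply: (measurable_gam c gZ F (X := fun e w => cl (X^~ w) e)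
   (V := fun w => mn F (cl (X^~ w)))) => //.
- by move=> e; exact: measurable_cl.
- by apply: (measurable_mn F (X := fun e w => cl (X^~ w) e)) => e; exact: measurable_cl.
Qed.

Lemma forest_term_bound F : colored_forest c F -> exists K, forall x, `|forest_term F x| <= K.
Proof.
move=> /colored_forestP[_ cF]; have [K HK] := gam_bound c k0 gZ (tamF F).
exists K => x; apply: HK => // [e|]; first exact: cl01.
by rewrite lexx ltr01.
Qed.

Lemma top_term_bound F : colored_forest c F -> exists K, forall x, `|top_term F x| <= K.
Proof.
move=> /colored_forestP[_ cF]; rewrite /top_term; case: (eqVneq F finset.set0) => F0.
  by eexists => x; exact: lexx.
have [K HK] := gam_bound c k0 gZ (tamF F).
exists K => x; apply: HK => // [e|]; first exact: cl01.
exact: mn_cl_bounds.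
Qed.

(** Indicator of the event that [e] lies below all edges of [F], that is, that [e] comes last when e
    |: F is built by decreasing values. *)
Definition cut F e x : R := (0 < x e < mn F (cl x))%R%:R.

Lemma measurable_cut d' (S : measurableType d') F e (X : {set 'I_k} -> S -> R) :
  (forall e, measurable_fun setT (X e)) -> measurable_fun setT (fun w => cut F e (X^~ w)).
Proof.
move=> mX.
rewrite (_ : (fun w => _) = (fun w => if (0 < X e w) && (X e w < mn F (cl (X^~ w))) then 1 else 0)); last first.
  by apply/funext => w; rewrite /cut; case: (_ && _).
apply: measurable_fun_ifT => //; apply: measurable_and; apply: measurable_fun_ltr => //.
by apply: (measurable_mn F (X := fun e w => cl (X^~ w) e)) => e'; exact: measurable_cl.
Qed.

Lemma cut_top_bound F e : colored_forest c (e |: F) ->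
  exists K, forall x, `|cut F e x * top_term (e |: F) x| <= K.
Proof.
move=> /top_term_bound[K HK]; exists K => x; rewrite normrM /cut.
by case: (_ && _); rewrite ?normr1 ?mul1r ?normr0 ?mul0r// (le_trans _ (HK x)).
Qed.

Let mU e : measurable_fun setT (U e). Proof. by have [] := iidU.1 e (finset.in_setT e). Qed.
Let lU e : has_law PQ (U e) (uniform_prob (@ltr01 R)). Proof. exact: iidU.1 e (finset.in_setT e). Qed.

Lemma cl_upd x e s : cl (upd (cl x) e s) = cl (upd x e s).
Proof.
apply/funext => e'; rewrite /cl /upd; case: (e' == e) => //.
by rewrite -/(cl x e') cl01.
Qed.

Lemma eq_top_term F x y : cl x = cl y -> top_term F x = top_term F y.
Proof. by rewrite /top_term => ->. Qed.

Lemma measurable_upd x e e' : measurable_fun setT (fun s : R => upd x e s e').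
Proof. by rewrite /upd; case: (e' == e). Qed.

Lemma mn_upd F x e s : e \notin F -> mn F (cl (upd x e s)) = mn F (cl x).
Proof.
move=> eF; apply: eq_bigr => e' e'F; rewrite /cl /upd.
by case: eqVneq => // E; rewrite E (negbTE eF) in e'F.
Qed.

(** The integral over the strength becomes an expectation over a fresh uniform value for the new
    edge, with [cut] for the range of integration. *)
Lemma top_term_step F x : colored_forest c F ->
  top_term F x = forest_term F x + \sum_(e in addable c F)
    \int[PQ]_w (cut F e (upd x e (U e w)) * top_term (e |: F) (upd x e (U e w))).
Proof.
move=> FF; have clcl : cl (cl x) = cl x by apply: clE => e; exact: cl01.
have cfA e : e \in addable c F -> colored_forest c (e |: F) by rewrite inE => /andP[].
rewrite -(eq_top_term F clcl) top_term_ftc//; last by move=> e; exact: cl01.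
have -> : forest_term F (cl x) = forest_term F x by rewrite /forest_term clcl.
apply: (congr1 (+%R (forest_term F x))).
have m01 : 0 <= mn F (cl x) <= 1.
  by rewrite mn_le1 ltW// mn_gt0// => e; case/andP: (cl01 x e).
have mt e : e \in addable c F -> measurable_fun setT (fun s : R => top_term (e |: F) (upd (cl x) e s)).
  move=> eA; apply: (measurable_top_term (e |: F) (X := fun e' s => upd (cl x) e s e')).
  by move=> e'; exact: measurable_upd.
pose ind e w : R := (0 < U e w < mn F (cl x))%R%:R.
have mc e : measurable_fun setT (ind e).
  rewrite (_ : ind e = (fun w => if (0 < U e w) && (U e w < mn F (cl x)) then 1 else 0)).
    by apply: measurable_fun_ifT => //; apply: measurable_and; exact: measurable_fun_ltr.
  by apply/funext => w; rewrite /ind; case: (_ && _).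
(* Any uniform variable serves to move the finite sum out of the integral; the one indexed by the
   empty set is at hand. Each summand then passes to its own [U e]. *)
rewrite (Rintegral_uniform (lU finset.set0))//; last exact: measurable_sumP.
under eq_Rintegral => w _ do rewrite mulr_sumr.
rewrite Rintegral_sum; last first.
  move=> e eA; have [K HK] := top_term_bound (cfA _ eA).
  apply: (@integrable_bounded _ _ _ _ _ K).
    by apply: measurable_funM; [exact: mc|exact: measurableT_comp (mt _ eA) (mU _)].
  move=> w; rewrite normrM; case: (_ && _); rewrite ?normr1 ?mul1r ?normr0 ?mul0r//.
  by rewrite (le_trans _ (HK x)).
apply: eq_bigr => e eA.
apply: etrans (esym (Rintegral_uniform (lU finset.set0) (mt _ eA) m01)) _.
apply: etrans (Rintegral_uniform (lU e) (mt _ eA) m01) _.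
apply: eq_Rintegral => w _; rewrite (eq_top_term _ (cl_upd x e (U e w))) /cut mn_upd.
  by have -> : upd x e (U e w) e = U e w by rewrite /upd eqxx.
by move: eA; rewrite inE => /andP[].
Qed.

Lemma Rintegral_bound (f : Q -> R) K : measurable_fun setT f -> (forall w, `|f w| <= K) ->
  `|\int[PQ]_w f w| <= K.
Proof.
move=> mf fK; rewrite (le_trans (le_normr_Rintegral measurableT (integrable_bounded PQ mf fK)))//.
rewrite (le_trans (le_Rintegral measurableT _ (finite_measure_integrable_cst PQ K measurableT) (fun w _ => fK w)))//.
  by apply: (@integrable_bounded _ _ _ _ _ K) => [|w]; [exact: measurableT_comp|rewrite normr_id].
rewrite Rintegral_cst// (_ : fine _ = 1) ?mulr1//.
exact: (congr1 fine (probability_setT PQ)).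
Qed.

Lemma measurable_cut_top d' (S : measurableType d') F e (X : {set 'I_k} -> S -> R) :
  (forall e, measurable_fun setT (X e)) ->
  measurable_fun setT (fun w => cut F e (X^~ w) * top_term (e |: F) (X^~ w)).
Proof.
by move=> mX; apply: measurable_funM; [exact: measurable_cut|exact: measurable_top_term].
Qed.

(** Replacing [U e] by an independent redraw does not change the law of the family, so the fresh
    value of the new edge may be taken to be [U e] itself. *)
Lemma resample F e : colored_forest c (e |: F) ->
  let h x := cut F e x * top_term (e |: F) x in
  PQ.-integrable setT (EFin \o (fun w => \int[PQ]_w' h (upd (U^~ w) e (U e w')))) /\
  \int[PQ]_w \int[PQ]_w' h (upd (U^~ w) e (U e w')) = \int[PQ]_w h (U^~ w).
Proof.
move=> FF h; have [K HK] := cut_top_bound FF.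
pose X e' (z : Q * Q) := if e' \in [set e]%SET then U e' z.2 else U e' z.1.
have mX e' : measurable_fun setT (X e').
  rewrite /X; case: (e' \in _); first exact: measurableT_comp (mU _) measurable_snd.
  exact: measurableT_comp (mU _) measurable_fst.
have XE w w' : h (upd (U^~ w) e (U e w')) = h (X^~ (w, w')).
  congr h; apply/funext => e'; rewrite /upd /X !inE.
  by case: eqVneq => [->|].
have mh : measurable_fun setT (fun z => h (X^~ z)) by exact: measurable_cut_top.
have mhx w : measurable_fun setT (fun w' => h (X^~ (w, w'))).
  by apply: measurable_cut_top => // e'; exact: measurableT_comp (mX e') (measurable_pair1 w).
have -> : (fun w => \int[PQ]_w' h (upd (U^~ w) e (U e w'))) = fun w => \int[PQ]_w' h (X^~ (w, w')).
  by apply/funext => w; apply: eq_Rintegral => w' _; exact: XE.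
split.
  apply: (@integrable_bounded _ _ _ _ _ K).
    exact: (measurable_fun_Rintegral PQ mh).
  by move=> w; apply: (Rintegral_bound (mhx w)) => w'; exact: HK.
rewrite -(Rfubini12 (f := fun z => h (X^~ z))).
- rewrite /Rintegral; congr fine; apply/esym.
  apply: (@integral_family_decouple R _ _ _ _ [set: _]%SET [set e]%SET U (EFin \o h)).
  + by move=> e' _.
  + exact: iidU.2.
  + exact: finset.subsetT.
  + apply/multi_measurableP => d' S Y mY; apply/measurable_EFinP.
    exact: measurable_cut_top.
  + by move=> x y xy; congr ((EFin \o h) _); apply/funext => e'; apply: xy; rewrite finset.in_setT.
- by apply: (@integrable_bounded _ _ _ (PQ \x PQ)%E _ K mh) => z; exact: HK.
- by move=> w; apply: (@integrable_bounded _ _ _ _ _ K (mhx w)) => w'; exact: HK.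
Qed.

Lemma expectation_top_term F : colored_forest c F ->
  \int[PQ]_w top_term F (U^~ w) = \int[PQ]_w forest_term F (U^~ w) +
    \sum_(e in addable c F) \int[PQ]_w (cut F e (U^~ w) * top_term (e |: F) (U^~ w)).
Proof.
move=> FF; have cfA e : e \in addable c F -> colored_forest c (e |: F) by rewrite inE => /andP[].
under eq_Rintegral => w _ do rewrite top_term_step//.
rewrite RintegralD//; last 2 first.
- have [K HK] := forest_term_bound FF; apply: (@integrable_bounded _ _ _ _ _ K) => //.
  exact: measurable_forest_term.
- by apply: integrable_sumR => e /cfA /resample[].
congr (_ + _); rewrite Rintegral_sum => [|e /cfA /resample[]//].
by apply: eq_bigr => e /cfA /resample[_ ->].
Qed.

End ForestFormula.

Section NoTies.
Context {R : realType} {I : finType} dQ (Q : measurableType dQ) (PQ : probability Q R).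
Variable U : I -> Q -> R.
Hypothesis iidU : iid_with_law PQ [set: I]%SET U (uniform_prob (@ltr01 R)).

Let mU e : measurable_fun setT (U e). Proof. by have [] := iidU.1 e (finset.in_setT e). Qed.
Let lU e : has_law PQ (U e) (uniform_prob (@ltr01 R)). Proof. exact: iidU.1 e (finset.in_setT e). Qed.

Let meq d (T : measurableType d) (X Y : T -> R) :
  measurable_fun setT X -> measurable_fun setT Y ->
  measurable_fun setT (fun w => (X w == Y w)%:R : R).
Proof.
move=> mX mY.
rewrite (_ : (fun w => _) = (fun w => if (X w <= Y w) && (Y w <= X w) then 1 else 0)); last first.
  by apply/funext => w; rewrite eq_le; case: (_ && _).
by apply: measurable_fun_ifT => //; apply: measurable_and; exact: measurable_fun_ler.
Qed.

(** With one value fixed, the other is uniform and has no atoms; Fubini applies after decoupling. *)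
Lemma iid_uniform_no_ties e e' : e != e' -> {ae PQ, forall w, U e w != U e' w}.
Proof.
move=> ee'; pose h (x : I -> R) : R := (x e == x e')%:R.
have b01 (b : bool) : `|b%:R : R| <= 1 by case: b; rewrite ?normr1 ?normr0.
have h0 : \int[PQ]_w h (U^~ w) = 0.
  pose H (z : Q * Q) : R := (U e z.2 == U e' z.1)%:R.
  have mH : measurable_fun setT H.
    by apply: meq; [exact: measurableT_comp (mU _) measurable_snd|exact: measurableT_comp (mU _) measurable_fst].
  transitivity (\int[(PQ \x PQ)%E]_z H z).
    rewrite /Rintegral; congr fine.
    rewrite (@integral_family_decouple R _ _ _ PQ [set: _]%SET [set e]%SET U (EFin \o h)).
    - by apply: eq_integral => z _ /=; rewrite /h /H !inE eqxx [e' == e]eq_sym (negbTE ee').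
    - by move=> i _.
    - exact: iidU.2.
    - exact: finset.subsetT.
    - by apply/multi_measurableP => d' S Y mY; apply/measurable_EFinP; exact: meq.
    - by move=> x y xy; rewrite /= /h !xy ?finset.in_setT.
  rewrite (Rfubini12 (f := H)).
  - rewrite (@eq_Rintegral _ _ _ PQ setT (fun=> 0)); first by rewrite Rintegral_cst// mul0r.
    by move=> w _; exact: (uniform_atom (lU e) (U e' w)).
  - by apply: (@integrable_bounded _ _ _ (PQ \x PQ)%E _ 1 mH) => z; exact: b01.
  - move=> w; apply: (@integrable_bounded _ _ _ _ _ 1) => [|w']; last exact: b01.
    by apply: meq => //; exact: (@measurable_cst _ _ Q _ setT (U e' w)).
have mA : measurable [set w | U e w == U e' w].
  have -> : [set w | U e w == U e' w] = (fun w => h (U^~ w)) @^-1` [set 1].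
    apply/seteqP; split=> w /=; rewrite /h; first by move=> ->.
    by case: (_ == _) => // /eqP; rewrite eq_sym oner_eq0.
  by rewrite -[_ @^-1` _]setTI; apply: (meq (mU e) (mU e')).
exists [set w | U e w == U e' w]; split => //; last first.
  by move=> w /= /negP; rewrite negbK.
move: h0; rewrite /Rintegral (eq_integral (EFin \o \1_[set w | U e w == U e' w])); last first.
  by move=> w _; rewrite /h /= indicE mem_setE.
rewrite integral_indic// setIT => h0.
by apply/eqP; rewrite -(fineK (fin_num_measure PQ _ mA)) h0.
Qed.

End NoTies.

(** * Summation over all forests *)

Section ForestSum.
Context {R : realType} {k n : nat} {cT : eqType}.
Variables (c : 'I_k -> cT) (k0 : (0 < k)%N).
Context d (T : measurableType d) (P : probability T R) (Z : T -> 'M[R]_(k, n)).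
Hypothesis gZ : gaussian_field P Z 1%:M.
Context d0 (T0 : measurableType d0) (P0 : probability T0 R) (X0 : T0 -> 'M[R]_(k, n)).
Hypothesis gX0 : gaussian_field P0 X0 (\matrix_(i, j) (c i == c j)%:R).
Variable g : 'M[R]_(k, n) -> R.
Hypothesis tg : rtame g.
Context dQ (Q : measurableType dQ) (PQ : probability Q R) (U : {set 'I_k} -> Q -> R).
Hypothesis iidU : iid_with_law PQ [set: {set 'I_k}]%SET U (uniform_prob (@ltr01 R)).
Implicit Types (F : {set {set 'I_k}}) (x : {set 'I_k} -> R) (e : {set 'I_k}).

Let mU e : measurable_fun setT (U e). Proof. by have [] := iidU.1 e (finset.in_setT e). Qed.

(* Exactly one edge of a nonempty forest carries the smallest value. *)
Lemma sum_cut F x : F != finset.set0 -> (forall e, 0 < x e < 1) ->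
  (forall e e', e != e' -> x e != x e') -> \sum_(e in F) cut (F :\ e)%SET e x = 1.
Proof.
move=> /finset.set0Pn[e0 e0F] x01 xinj.
pose e := [arg min_(e < e0 in F) x e]%O.
have [eF emin] : e \in F /\ forall e', e' \in F -> x e <= x e' by rewrite /e; case: arg_minP.
rewrite (bigD1 e)//= big1 ?addr0 => [|e' /andP[e'F e'e]]; last first.
  rewrite /cut clE//; case: (boolP (_ && _)) => // /andP[_ h].
  have h2 : mn (F :\ e')%SET x <= x e by apply: mn_le; rewrite !inE eq_sym e'e eF.
  by have := lt_le_trans h h2; rewrite ltNge emin.
rewrite /cut clE//; case/andP: (x01 e) => -> xe1 /=.
rewrite (_ : x e < _)//; apply/bigmin_gtP; split=> // e'; rewrite !inE => /andP[e'e e'F].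
by rewrite lt_neqAle emin// andbT xinj// eq_sym.
Qed.

(** The one-step identity is summed over all colored forests, and the pairs (F, e) are regrouped by
    the enlarged forest. By [sum_cut] each nonempty forest then recovers its own top term; these
    cancel, and the top term of the empty forest remains. *)
Lemma forest_sum :
  \sum_(F | colored_forest c F) \int[PQ]_w forest_term c P Z g F (U^~ w) = \int[P0]_z g (X0 z).
Proof.
pose B F := \int[PQ]_w top_term c P Z P0 X0 g F (U^~ w).
pose Phi F e := \int[PQ]_w (cut F e (U^~ w) * top_term c P Z P0 X0 g (e |: F) (U^~ w)).
have reorg (Psi : {set {set 'I_k}} -> {set 'I_k} -> R) :
    \sum_(F | colored_forest c F) \sum_(e in addable c F) Psi F e =
    \sum_(F | colored_forest c F) \sum_(e in F) Psi (F :\ e)%SET e.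
  rewrite (exchange_big_dep predT)//= [RHS](exchange_big_dep predT)//=.
  apply: eq_bigr => e _.
  (* A forest with an addable edge corresponds to a forest with a marked edge. *)
  rewrite (reindex_onto (fun F => F :\ e)%SET (fun F => e |: F))/=; last first.
    by move=> F /andP[_]; rewrite inE => /andP[eF _]; rewrite finset.setU1K.
  apply: eq_bigl => F; rewrite inE !inE eqxx /=.
  case: (boolP (e \in F)) => eF; last first.
    by rewrite andbF (_ : (_ == F) = false) ?andbF//; apply/negbTE; apply: contra eF => /eqP <-; rewrite setU11.
  rewrite finset.setD1K// eqxx !andbT; apply/andP/idP => [[]//|FF]; split=> //.
  move/colored_forestP: FF => [fF cF]; apply/colored_forestP; split.
    by apply: forest_sub fF; exact: finset.subsetDl.
  by move=> i j; rewrite /adjacent /= !inE => /andP[_]; exact: cF.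
have cf0 : colored_forest c finset.set0.
  apply/colored_forestP; split; first exact: forest0.
  by move=> i j; rewrite /adjacent /= inE.
have -> : \int[P0]_z g (X0 z) = B finset.set0.
  rewrite /B /top_term eqxx Rintegral_cst// (_ : fine _ = 1) ?mulr1//.
  exact: (congr1 fine (probability_setT PQ)).
have BE F : colored_forest c F -> B F = \int[PQ]_w forest_term c P Z g F (U^~ w) +
    \sum_(e in addable c F) Phi F e by exact: expectation_top_term.
have PhiE F : colored_forest c F -> F != finset.set0 -> \sum_(e in F) Phi (F :\ e)%SET e = B F.
  move=> FF F0; rewrite -Rintegral_sum => [|e eF]; last first.
    have FF' : colored_forest c (e |: F :\ e) by rewrite finset.setD1K.
    have [K HK] := cut_top_bound k0 gZ P0 X0 tg FF'.
    apply: (@integrable_bounded _ _ _ _ _ K); last by move=> w; exact: HK.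
    exact: measurable_cut_top.
  rewrite /B /Rintegral; congr fine; apply: ae_eq_integral => //.
  - apply/measurable_EFinP; apply: measurable_sumP => e eF.
    have FF' : colored_forest c (e |: F :\ e) by rewrite finset.setD1K.
    exact: measurable_cut_top.
  - by apply/measurable_EFinP; exact: measurable_top_term.
  have a1 : {ae PQ, forall w, forall e, 0 < U e w < 1}.
    by apply: filter_forall => e; exact: uniform_interior (iidU.1 e (finset.in_setT e)).
  have a2 : {ae PQ, forall w, forall p : {set 'I_k} * {set 'I_k}, p.1 != p.2 -> U p.1 w != U p.2 w}.
    apply: filter_forall => p; case: (boolP (p.1 != p.2)) => ee.
      by apply: filterS (iid_uniform_no_ties iidU ee) => w h _.
    by apply: filterS filterT.
  apply: filterS2 a1 a2 => w w1 w2 _ /=; congr EFin.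
  rewrite (eq_bigr (fun e => cut (F :\ e)%SET e (U^~ w) * top_term c P Z P0 X0 g F (U^~ w))).
    by rewrite -mulr_suml sum_cut ?mul1r// => e e' ee'; exact: (w2 (e, e')).
  by move=> e eF; rewrite finset.setD1K.
have : \sum_(F | colored_forest c F) B F =
  \sum_(F | colored_forest c F) \int[PQ]_w forest_term c P Z g F (U^~ w) +
  \sum_(F | colored_forest c F) \sum_(e in F) Phi (F :\ e)%SET e.
  apply: etrans (eq_bigr _ BE) _; apply: etrans (big_split _ _ _ _ _) _; apply: (congr1 (+%R _)).
  exact: reorg.
have S : \sum_(F | colored_forest c F) \sum_(e in F) Phi (F :\ e)%SET e =
    \sum_(F | colored_forest c F && (F != finset.set0)) B F.
  apply: etrans (bigD1 _ cf0) _; apply: etrans (congr1 (+%R^~ _) (big_set0 _ _ _)) _.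
  apply: etrans (add0r _) _; apply: eq_bigr => F /andP[FF F0]; exact: PhiE.
rewrite S => H; have H' := etrans (esym (bigD1 _ cf0)) H.
exact: esym (addIr _ H').
Qed.

End ForestSum.

(** * Cumulants *)

Section ComplexTame.
Context {R : realType}.

Definition re_part k n (f : 'M[R]_(k, n) -> R[i]) x : R := complex.Re (f x).
Definition im_part k n (f : 'M[R]_(k, n) -> R[i]) x : R := complex.Im (f x).

Lemma frobenius_norm_le k n (x : 'M[R]_(k, n)) : frobenius_norm x <= k%:R * n%:R * `|x|.
Proof.
have h0 : 0 <= k%:R * n%:R * `|x| by rewrite !mulr_ge0.
rewrite /frobenius_norm -[leRHS]ger0_norm// -sqrtr_sqr ler_wsqrtr//.
apply: (@le_trans _ _ (\sum_(i < n) \sum_(j < k) `|x| ^+ 2)).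
  apply: ler_sum => i _; rewrite mxE; apply: ler_sum => j _.
  by rewrite mxE -expr2 -[leLHS]real_normK ?num_real// lerXn2r ?nnegrE// le_mx_norm.
rewrite sumr_const sumr_const !card_ord -mulrnA -[leLHS]mulr_natl exprMn.
rewrite ler_wpM2r ?sqr_ge0// -!natrM -natrX ler_nat.
by case: (k * n)%N => // m; rewrite expnS expn1 leq_pmulr.
Qed.

Lemma normc_Re_le (z : R[i]) (r : R) : `|z| <= r%:C -> `|complex.Re z| <= r.
Proof.
move=> h; rewrite -lecR; apply: le_trans h.
by rewrite [leLHS](_ : _ = `|complex.Re z|%:C)// normc_ge_Re.
Qed.

Lemma normc_Im_le (z : R[i]) (r : R) : `|z| <= r%:C -> `|complex.Im z| <= r.
Proof.
case: z => a b; rewrite normc_def lecR /=; apply: le_trans.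
by rewrite -sqrtr_sqr ler_wsqrtr// lerDr sqr_ge0.
Qed.

Lemma Re_iter_partial k n s (f : 'M[R]_(k, n) -> R[i]) :
  re_part (iter_partial s f) = iterD s (re_part f) /\ im_part (iter_partial s f) = iterD s (im_part f).
Proof.
elim: s => [//|ij s [IH1 IH2]] /=; rewrite -IH1 -IH2.
by split.
Qed.

Lemma tame_rtame k n (f : 'M[R]_(k, n) -> R[i]) : tame f -> rtame (re_part f) /\ rtame (im_part f).
Proof.
move=> [df gf].
have growth (a c1 c2 : R) (x : 'M[R]_(k, n)) : a <= c1 * expR (c2 * frobenius_norm x) ->
    a <= `|c1| * expR (`|c2| * (k%:R * n%:R) * `|x|).
  move=> h; apply: (le_trans h); apply: (@le_trans _ _ (`|c1| * expR (c2 * frobenius_norm x))).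
    by rewrite ler_wpM2r ?expR_ge0// ler_norm.
  rewrite ler_wpM2l// ler_expR -mulrA.
  apply: (@le_trans _ _ (`|c2| * frobenius_norm x)).
    by rewrite ler_wpM2r ?sqrtr_ge0// ler_norm.
  by rewrite ler_wpM2l// frobenius_norm_le.
split=> s; have [rE iE] := Re_iter_partial s f.
  rewrite -rE; split; first by move=> x; exact: (df s x).1.
  have [c1 [c2 h]] := gf s; exists `|c1|, (`|c2| * (k%:R * n%:R)); split; rewrite ?mulr_ge0// => x.
  exact: growth (normc_Re_le (h x)).
rewrite -iE; split; first by move=> x; exact: (df s x).2.
have [c1 [c2 h]] := gf s; exists `|c1|, (`|c2| * (k%:R * n%:R)); split; rewrite ?mulr_ge0// => x.
exact: growth (normc_Im_le (h x)).
Qed.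

Definition ctame k n (f : 'M[R]_(k, n) -> R[i]) := rtame (re_part f) /\ rtame (im_part f).

Lemma ctame_cst k n (z : R[i]) : ctame (fun _ : 'M[R]_(k, n) => z).
Proof. by split; exact: rtame_cst. Qed.

Lemma ctameM k n (f g : 'M[R]_(k, n) -> R[i]) :
  ctame f -> ctame g -> ctame (fun x => f x * g x).
Proof.
move=> [f1 f2] [g1 g2]; split.
  rewrite (_ : re_part _ = (re_part f \* re_part g) \+ (fun x => -1 * (im_part f \* im_part g) x)).
    by apply: rtameD; [exact: rtameM|apply: rtameZ; exact: rtameM].
  apply/funext => x; rewrite /re_part /im_part /=; case: (f x) => a b; case: (g x) => a' b' /=.
  by rewrite mulN1r.
rewrite (_ : im_part _ = (re_part f \* im_part g) \+ (im_part f \* re_part g)).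
  by apply: rtameD; exact: rtameM.
by apply/funext => x; rewrite /re_part /im_part /=; case: (f x) => a b; case: (g x) => a' b' /=.
Qed.

Lemma ctame_prod k n (I : Type) (r : seq I) (p : pred I) (f : I -> 'M[R]_(k, n) -> R[i]) :
  (forall i, p i -> ctame (f i)) -> ctame (fun x => \prod_(i <- r | p i) f i x).
Proof.
move=> tf; elim: r => [|i r IH].
  rewrite (_ : (fun x => _) = fun=> 1); first exact: ctame_cst.
  by apply/funext => x; rewrite big_nil.
case: (boolP (p i)) => pi.
  rewrite (_ : (fun x => _) = fun x => f i x * \prod_(i <- r | p i) f i x).
    by apply: ctameM => //; exact: tf.
  by apply/funext => x; rewrite big_cons pi.
by under eq_fun do rewrite big_cons (negbTE pi).
Qed.

Lemma ctame_mulmx k n m (A : 'M[R]_(k, m)) (f : 'M[R]_(k, n) -> R[i]) :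
  ctame f -> ctame (fun x : 'M[R]_(m, n) => f (A *m x)).
Proof.
have E (g : 'M[R]_(k, n) -> R) : rtame g -> rtame (fun x : 'M[R]_(m, n) => g (A *m x)).
  move=> /(rtame_affine 0 A); congr rtame; apply/funext => x /=; by rewrite add0r.
by move=> [f1 f2]; split; [exact: (E _ f1)|exact: (E _ f2)].
Qed.

Lemma ctame_row k n i (f : 'rV[R]_n -> R[i]) :
  ctame f -> ctame (fun x : 'M[R]_(k, n) => f (row i x)).
Proof.
move=> /(ctame_mulmx (delta_mx 0 i : 'rV[R]_k)); congr ctame.
by apply/funext => x; rewrite -rowE.
Qed.

Lemma ctame_tensor k n (f : 'I_k -> 'rV[R]_n -> R[i]) :
  (forall i, ctame (f i)) -> ctame (tensor f).
Proof. by move=> tf; apply: ctame_prod => i _; exact: ctame_row. Qed.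

Lemma Re_edge_operator k n e (f : 'M[R]_(k, n) -> R[i]) :
  re_part (edge_operator e f) = edge_op e (re_part f) /\ im_part (edge_operator e f) = edge_op e (im_part f).
Proof.
rewrite /edge_operator /edge_op; case: (enum e) => [//|i [//|i' [|//]]].
split; apply/funext => x.
  exact: (raddf_sum (@complex.Re R)).
exact: (raddf_sum (@complex.Im R)).
Qed.

Lemma Re_tree_operator k n E (f : 'M[R]_(k, n) -> R[i]) :
  re_part (tree_operator E f) = forest_op E (re_part f) /\ im_part (tree_operator E f) = forest_op E (im_part f).
Proof.
rewrite /tree_operator /forest_op; elim: (enum E) => [//|e s [IH1 IH2]] /=.
by have [-> ->] := Re_edge_operator e (foldr (@edge_operator R k n) f s); rewrite IH1 IH2.
Qed.

End ComplexTame.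

Section ComplexExpectation.
Context {R : realType}.

Lemma complex_expectationE d (T : measurableType d) (P : probability T R) (X : T -> R[i]) :
  complex_expectation P X =
  (\int[P]_w complex.Re (X w)) +i* (\int[P]_w complex.Im (X w)).
Proof. by rewrite /complex_expectation unlock. Qed.

Section Product.
Context d1 d2 (T1 : measurableType d1) (T2 : measurableType d2)
  (P1 : probability T1 R) (P2 : probability T2 R).

Lemma Rintegral_prodM (u : T1 -> R) (v : T2 -> R) :
  P1.-integrable setT (EFin \o u) -> P2.-integrable setT (EFin \o v) ->
  \int[(P1 \x P2)%E]_z (u z.1 * v z.2) = (\int[P1]_x u x) * (\int[P2]_y v y).
Proof.
move=> iu iv; rewrite (Rfubini12 (f := fun z => u z.1 * v z.2)) /=; last 2 first.
- exact: integrable_prodM.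
- by move=> x; exact: integrableZlR.
rewrite -RintegralZr//; apply: eq_Rintegral => x _.
by rewrite RintegralZl.
Qed.

Lemma complex_expectation_prod (u : T1 -> R[i]) (v : T2 -> R[i]) :
  P1.-integrable setT (EFin \o (fun w => complex.Re (u w))) ->
  P1.-integrable setT (EFin \o (fun w => complex.Im (u w))) ->
  P2.-integrable setT (EFin \o (fun w => complex.Re (v w))) ->
  P2.-integrable setT (EFin \o (fun w => complex.Im (v w))) ->
  complex_expectation (P1 \x P2)%E (fun z => u z.1 * v z.2) =
  complex_expectation P1 u * complex_expectation P2 v.
Proof.
move=> u1 u2 v1 v2; rewrite !complex_expectationE.
pose a w := complex.Re (u w); pose b w := complex.Im (u w).
pose a' w := complex.Re (v w); pose b' w := complex.Im (v w).
have i1 := integrable_prodM u1 v1; have i2 := integrable_prodM u2 v2.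
have i3 := integrable_prodM u1 v2; have i4 := integrable_prodM u2 v1.
rewrite [LHS](_ : _ = (\int[(P1 \x P2)%E]_z (a z.1 * a' z.2 - b z.1 * b' z.2)) +i*
    (\int[(P1 \x P2)%E]_z (a z.1 * b' z.2 + b z.1 * a' z.2))); last first.
  by congr (_ +i* _); apply: eq_Rintegral => z _; rewrite /a /b /a' /b'; case: (u z.1) => ? ?; case: (v z.2).
rewrite RintegralB// RintegralD//.
have e1 : \int[(P1 \x P2)%E]_z (a z.1 * a' z.2) = _ := Rintegral_prodM u1 v1.
have e2 : \int[(P1 \x P2)%E]_z (b z.1 * b' z.2) = _ := Rintegral_prodM u2 v2.
have e3 : \int[(P1 \x P2)%E]_z (a z.1 * b' z.2) = _ := Rintegral_prodM u1 v2.
have e4 : \int[(P1 \x P2)%E]_z (b z.1 * a' z.2) = _ := Rintegral_prodM u2 v1.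
by rewrite e1 e2 e3 e4.
Qed.

End Product.

Lemma complex_expectation_gf k n d1 d2 (T1 : measurableType d1) (T2 : measurableType d2)
    (P1 : probability T1 R) (P2 : probability T2 R) (X1 : T1 -> 'M[R]_(k, n)) (X2 : T2 -> 'M[R]_(k, n))
    C1 C2 f :
  gaussian_field P1 X1 C1 -> gaussian_field P2 X2 C2 -> C1 = C2 -> ctame f ->
  complex_expectation P1 (fun w => f (X1 w)) = complex_expectation P2 (fun w => f (X2 w)).
Proof.
move=> g1 g2 C12 [f1 f2]; rewrite !complex_expectationE; congr (_ +i* _).
  exact: (gf_unique g1 g2 C12 f1).
exact: (gf_unique g1 g2 C12 f2).
Qed.

(** * Independence of the rows *)

Section Rows.
Context {k n : nat} d (T : measurableType d) (P : probability T R) (Z : T -> 'M[R]_(k, n)).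
Hypothesis gZ : gaussian_field P Z 1%:M.

(* Row [r] of an independent copy may be substituted for row [r] of [Z]. *)
Lemma complex_expectation_split_row (r : 'I_k) (f : 'rV[R]_n -> R[i]) (h : 'M[R]_(k, n) -> R[i]) :
  ctame f -> ctame h ->
  (forall x y, (forall l, l != r -> row l x = row l y) -> h x = h y) ->
  complex_expectation P (fun w => f (row r (Z w)) * h (Z w)) =
  complex_expectation P (fun w => f (row r (Z w))) * complex_expectation P (fun w => h (Z w)).
Proof.
move=> tf th hE.
pose E : 'M[R]_k := delta_mx r r.
have ET : E^T = E by rewrite trmx_delta.
have EE : E *m E = E by rewrite mul_delta_mx.
have g1 := gf_linear (1%:M - E) gZ; have g2 := gf_linear E gZ.
have gc := gf_combo g2 g1 1 1.
have tfh : ctame (fun x : 'M[R]_(k, n) => f (row r x) * h x) by apply: ctameM => //; exact: ctame_row.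
rewrite (complex_expectation_gf gZ gc _ tfh); last first.
  rewrite !mulmx1 linearB /= trmx1 ET EE expr1n !scale1r.
  by rewrite mulmxBl mul1mx mulmxBr mulmx1 EE subrr subr0 addrC subrK.
have rE x : row r (E *m x : 'M[R]_(k, n)) = row r x.
  by rewrite !rowE mulmxA mul_delta_mx.
have lE l x : l != r -> row l (E *m x : 'M[R]_(k, n)) = 0.
  by move=> lr; rewrite rowE mulmxA mul_delta_mx_0// mul0mx.
have -> : (fun z => f (row r (combo (fun w => E *m Z w) (fun w => (1%:M - E) *m Z w) 1 1 z)) *
    h (combo (fun w => E *m Z w) (fun w => (1%:M - E) *m Z w) 1 1 z)) =
    (fun z : T * T => f (row r (Z z.1)) * h (Z z.2)).
  apply/funext => z; rewrite /combo !scale1r; congr (f _ * _).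
    by rewrite linearD /= rE mulmxBl mul1mx linearB /= rE subrr addr0.
  apply: hE => l lr.
  by rewrite linearD /= lE// add0r mulmxBl mul1mx linearB /= lE// subr0.
have tfr : ctame (fun x : 'M[R]_(k, n) => f (row r x)) by exact: ctame_row.
apply: (@complex_expectation_prod _ _ _ _ P P (fun w => f (row r (Z w))) (fun w => h (Z w))).
- exact: (gf_integrable gZ tfr.1).
- exact: (gf_integrable gZ tfr.2).
- exact: (gf_integrable gZ th.1).
- exact: (gf_integrable gZ th.2).
Qed.

Lemma complex_expectation_rows (I : eqType) (s : seq I) (rho : I -> 'I_k) (Phi : I -> 'rV[R]_n -> R[i]) :
  uniq (map rho s) -> (forall i, ctame (Phi i)) ->
  complex_expectation P (fun w => \prod_(i <- s) Phi i (row (rho i) (Z w))) =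
  \prod_(i <- s) complex_expectation P (fun w => Phi i (row (rho i) (Z w))).
Proof.
move=> + tP; elim: s => [_|i s IH /= /andP[ri us]].
  under eq_fun do rewrite big_nil.
  rewrite big_nil complex_expectationE /= !Rintegral_cst// mul0r mul1r.
  by rewrite (congr1 fine (probability_setT P) : fine (P setT) = 1).
under eq_fun do rewrite big_cons.
rewrite big_cons -IH//.
apply: (complex_expectation_split_row (f := Phi i) (h := fun x => \prod_(j <- s) Phi j (row (rho j) x))) => //.
  by apply: (@ctame_prod _ _ _ _ _ _ (fun j x => Phi j (row (rho j) x))) => j _; exact: (ctame_row (rho j) (tP j)).
move=> x y xy; apply: eq_big_seq => j js; rewrite xy//.
by apply: contraNneq ri => <-; exact: map_f.
Qed.

End Rows.

Lemma complex_expectation_block k n d (T : measurableType d) (P : probability T R)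
    (zeta : T -> 'rV[R]_n) (Z : T -> 'M[R]_(k, n)) (r : 'I_k) (f : 'rV[R]_n -> R[i]) :
  gaussian_field P zeta 1%:M -> gaussian_field P Z 1%:M -> ctame f ->
  complex_expectation P (fun w => f (row r (Z w))) = complex_expectation P (fun w => f (zeta w)).
Proof.
move=> gz gZ tf; have gr := gf_linear (delta_mx 0 r : 'rV[R]_k) gZ.
under eq_fun do rewrite rowE.
apply: (complex_expectation_gf gr gz) => //.
by rewrite mulmx1 trmx_delta mul_delta_mx; apply/matrixP => i j; rewrite !ord1 !mxE.
Qed.

End ComplexExpectation.

(** * Gaussian fields with equal rows in each block *)

Section BlockRows.
Context {R : realType} {k n : nat} (k0 : (0 < k)%N) (Pi : {set {set 'I_k}}).
Hypothesis pPi : finset.partition Pi [set: 'I_k]%SET.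

Definition block_rep (A : {set 'I_k}) : 'I_k := odflt (Ordinal k0) [pick i in A].

Lemma block_rep_in A : A \in Pi -> block_rep A \in A.
Proof.
move=> AP; rewrite /block_rep; case: pickP => [//|/= A0].
case/and3P: pPi => _ _ /negP[]; rewrite (_ : finset.set0 = A)//.
by apply/esym/setP => i; rewrite inE A0.
Qed.

Lemma pblock_block_rep A : A \in Pi -> finset.pblock Pi (block_rep A) = A.
Proof. by move=> AP; case/and3P: pPi => _ tr _; apply: def_pblock => //; exact: block_rep_in. Qed.

Let pblock_in i : finset.pblock Pi i \in Pi.
Proof. by apply: pblock_mem; case/and3P: pPi => /eqP -> _ _; rewrite inE. Qed.

(** Row i is replaced by the row of a representative of its block. Applied to [Z], it realises the
    singular covariance of the partition on the given sample space. *)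
Definition block_mx : 'M[R]_k := \matrix_(i, l) (l == block_rep (finset.pblock Pi i))%:R.

Lemma block_mx_cov : block_mx *m block_mx^T =
  \matrix_(i, j) (finset.pblock Pi i == finset.pblock Pi j)%:R.
Proof.
apply/matrixP => i j; rewrite !mxE (bigD1 (block_rep (finset.pblock Pi i)))//= big1 => [|l lr].
  rewrite !mxE eqxx mul1r addr0; congr (_%:R); congr nat_of_bool.
  apply/eqP/eqP => [E|->//].
  by rewrite -(pblock_block_rep (pblock_in i)) E pblock_block_rep.
by rewrite !mxE (negbTE lr) mul0r.
Qed.

Lemma row_block_mx i (x : 'M[R]_(k, n)) :
  row i (block_mx *m x) = row (block_rep (finset.pblock Pi i)) x.
Proof.
apply/rowP => j; rewrite !mxE (bigD1 (block_rep (finset.pblock Pi i)))//= big1 => [|l lr].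
  by rewrite !mxE eqxx mul1r addr0.
by rewrite !mxE (negbTE lr) mul0r.
Qed.

Lemma tensor_block_mx (f : 'I_k -> 'rV[R]_n -> R[i]) x :
  tensor f (block_mx *m x) = \prod_(A <- enum Pi) \prod_(i in A) f i (row (block_rep A) x).
Proof.
rewrite big_enum /= /tensor.
rewrite (eq_bigl (mem [set: 'I_k]%SET)); last by move=> i; rewrite /= inE.
rewrite (set_partition_big _ pPi) /=; apply: eq_bigr => A AP; apply: eq_bigr => i iA.
by rewrite row_block_mx (def_pblock _ AP iA)//; case/and3P: pPi.
Qed.

(** Distinct blocks read distinct rows of [Z], which are independent, and each row is distributed as
    [zeta]. *)
Lemma expectation_blocks d (T : measurableType d) (P : probability T R)
    (zeta : T -> 'rV[R]_n) (Z : T -> 'M[R]_(k, n)) (f : 'I_k -> 'rV[R]_n -> R[i]) :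
  gaussian_field P zeta 1%:M -> gaussian_field P Z 1%:M -> (forall i, ctame (f i)) ->
  \prod_(A in Pi) complex_expectation P (fun w => \prod_(i in A) f i (zeta w)) =
  complex_expectation P (fun w => tensor f (block_mx *m Z w)).
Proof.
move=> gz gZ tf.
have tP (A : {set 'I_k}) : ctame (fun y : 'rV[R]_n => \prod_(i in A) f i y) by exact: ctame_prod.
under [in RHS]eq_fun do rewrite tensor_block_mx.
rewrite (@complex_expectation_rows _ _ _ _ _ _ _ gZ _ _ block_rep
  (fun A y => \prod_(i in A) f i y))//; last first.
  rewrite map_inj_in_uniq ?enum_uniq// => A B; rewrite !mem_enum => AP BP E.
  by rewrite -(pblock_block_rep AP) E pblock_block_rep.
rewrite big_enum /=; apply: eq_bigr => A _.
exact: (esym (complex_expectation_block (block_rep A) gz gZ (tP A))).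
Qed.

End BlockRows.

Section Cumulant.
Context {R : realType} {k n : nat} (k0 : (0 < k)%N).
Context d (T : measurableType d) (P : probability T R).
Variables (zeta : T -> 'rV[R]_n) (Z : T -> 'M[R]_(k, n)) (f : 'I_k -> 'rV[R]_n -> R[i]).
Hypotheses (gz : gaussian_field P zeta 1%:M) (gZ : gaussian_field P Z 1%:M).
Hypothesis tf : forall i, ctame (f i).
Context dQ (Q : measurableType dQ) (PQ : probability Q R) (U : {set 'I_k} -> Q -> R).
Hypothesis iidU : iid_with_law PQ [set: {set 'I_k}]%SET U (uniform_prob (@ltr01 R)).
Implicit Types F : {set {set 'I_k}}.

(* With no interaction across components the weights do not see the coloring. *)
Lemma forest_term_color (cT cT' : eqType) (c : 'I_k -> cT) (c' : 'I_k -> cT') g F x :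
  forest_term c P Z g F x = forest_term c' P Z g F x.
Proof.
have E : wt_mx F (cl x) 0 c = wt_mx F (cl x) 0 c'.
  apply/matrixP => i j; rewrite !mxE /wt.
  by case: (i == j) => //; case: (c i == c j); case: (c' i == c' j).
by rewrite /forest_term /gam /sqrt_wt E.
Qed.

(** The coloring [id] is a neutral choice: by [forest_term_color] the value is the same for every
    coloring. *)
Definition forest_mean F : R[i] :=
  (\int[PQ]_w forest_term id P Z (re_part (tensor f)) F (U^~ w)) +i*
  (\int[PQ]_w forest_term id P Z (im_part (tensor f)) F (U^~ w)).

Lemma sum_complex (I : finType) (p : pred I) (a b : I -> R) :
  \sum_(i | p i) (a i +i* b i) = (\sum_(i | p i) a i) +i* (\sum_(i | p i) b i).
Proof. by apply/esym; apply: (big_rec3 (fun x y z => x +i* y = z)) => // i x y _ _ <-. Qed.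

Lemma block_expansion Pi : finset.partition Pi [set: 'I_k]%SET ->
  \prod_(A in Pi) complex_expectation P (fun w => \prod_(i in A) f i (zeta w)) =
  \sum_(F | forest F && compat F Pi) forest_mean F.
Proof.
move=> pPi; rewrite (expectation_blocks k0 pPi gz gZ tf) complex_expectationE.
have gB : gaussian_field P (fun w => block_mx k0 Pi *m Z w)
    (\matrix_(i, j) (finset.pblock Pi i == finset.pblock Pi j)%:R).
  by rewrite -(block_mx_cov _ pPi); have := gf_linear (block_mx k0 Pi) gZ; rewrite mulmx1.
have [t1 t2] := ctame_tensor tf.
rewrite sum_complex; congr (_ +i* _).
  rewrite -[LHS](forest_sum k0 gZ gB t1 iidU); apply: eq_bigr => F _.
  by apply: eq_Rintegral => w _; exact: forest_term_color.
rewrite -[LHS](forest_sum k0 gZ gB t2 iidU); apply: eq_bigr => F _.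
by apply: eq_Rintegral => w _; exact: forest_term_color.
Qed.

Lemma joint_cumulant_trees :
  joint_cumulant P (fun i w => f i (zeta w)) = \sum_(E | spanning_tree E) forest_mean E.
Proof.
transitivity (\sum_(Pi | finset.partition Pi [set: 'I_k]%SET)
    \sum_(F | forest F && compat F Pi) moebius_to_top R Pi * forest_mean F).
  by apply: eq_bigr => Pi pPi; rewrite block_expansion// mulr_sumr.
rewrite (exchange_big_dep (fun F => forest F)) /=; last by move=> Pi F _ /andP[].
rewrite [RHS](eq_bigl (fun F => forest F && (#|F| == k.-1))); last first.
  by move=> F; exact: spanning_tree_forest.
rewrite [RHS]big_mkcondr; apply: eq_bigr => F fF.
rewrite -mulr_suml (eq_bigl (fun Pi => finset.partition Pi [set: 'I_k]%SET && compat F Pi)).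
  by rewrite sum_moebius//; case: ifP => _; rewrite ?mul1r ?mul0r.
by move=> Pi; rewrite fF.
Qed.

End Cumulant.

(** * Independence of the weights *)

Section AlmostEverywhere.
Import HBNNSimple.
Context d (T : measurableType d) {R : realType} (mu : measure T R).

(* No measurability is assumed of [f] and [g]: the integral is a supremum over
   simple functions, each of which can be cut off on the null set. *)
Lemma ae_eq_Rintegral (N : set T) (f g : T -> R) : measurable N -> mu N = 0 ->
  (forall w, ~ N w -> f w = g w) -> \int[mu]_w f w = \int[mu]_w g w.
Proof.
move=> mN N0.
have mN' : measurable (~` N) by exact: measurableC.
have le (u v : T -> \bar R) : (forall w, 0 <= u w)%E -> (forall w, 0 <= v w)%E ->
    (forall w, ~ N w -> u w = v w) -> (\int[mu]_w u w <= \int[mu]_w v w)%E.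
  move=> u0 v0 uv; rewrite ge0_integralTE// ge0_integralTE//.
  apply: ge_ereal_sup => _ [h /= hu <-].
  apply: ereal_sup_ubound; exists (mul_nnsfun h (indic_nnsfun R mN')) => /=.
    move=> w; change ((h w * \1_(~` N) w)%:E <= v w)%E; rewrite indicE; case: (boolP (w \in ~` N)) => wN.
      by rewrite mulr1 -uv//; move: wN; rewrite inE.
    by rewrite mulr0.
  have E (h' : {nnsfun T >-> R}) : sintegral mu h' = (\int[mu]_w (h' w)%:E)%E.
    by rewrite integral_nnsfun//= ; congr sintegral; apply/funext => w; rewrite patchE in_setT.
  rewrite !E; apply: ae_eq_integral => //; try exact/measurable_EFinP.
  exists N; split => // w /= nw; apply: contrapT => nN; apply: nw => _.
  change ((h w * \1_(~` N) w)%:E = (h w)%:E).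
  by rewrite indicE mem_set ?mulr1.
move=> fg; congr fine.
have fgE w : ~ N w -> (EFin \o f) w = (EFin \o g) w by move=> nw /=; rewrite fg.
rewrite integralE [RHS]integralE; congr (_ - _)%E; apply/eqP; rewrite eq_le; apply/andP; split;
  apply: le => // w nw; rewrite ?funeposE ?funenegE /= fg//.
Qed.

End AlmostEverywhere.

(** * From Borel sets of matrices to coordinates *)

Section BorelCoordinates.
Context {R : realType} (m n : nat).

Let M := g_sigma_algebraType (@open 'M[R]_(m, n)).

Lemma borel_mx_coord (i : 'I_m) (j : 'I_n) : measurable_fun [set: M] (fun x : M => (x : 'M[R]_(m, n)) i j).
Proof.
apply: (measurability _ (RGenOInfty.measurableE R)) => //.
move=> _ [_ [r ->] <-]; rewrite setTI; apply: sub_sigma_algebra.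
apply: open_comp; last exact: rray_open.
by move=> x _; exact: (rtame_continuous (rtame_coord i j)).
Qed.

Definition mx_coords (x : 'M[R]_(m, n)) := of_coords (fun ij : 'I_m * 'I_n => x ij.1 ij.2).

(** Independence is assumed for Borel sets of matrices and used for events in the coordinates; this
    inclusion of sigma-algebras is the passage. *)
Lemma borel_mx_coords A : measurable A -> borel_mx (mx_coords @^-1` A).
Proof.
move=> mA; rewrite -[_ @^-1` A]setTI.
exact: (@measurable_of_coords R _ _ M (fun ij x => (x : 'M[R]_(m, n)) ij.1 ij.2) (fun ij => borel_mx_coord ij.1 ij.2)).
Qed.

Definition of_mx_coords (t : #|{: 'I_m * 'I_n}|.-tuple R) : 'M[R]_(m, n) :=
  \matrix_(i, j) coords t (i, j).

Lemma mx_coordsK : cancel mx_coords of_mx_coords.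
Proof. by move=> x; apply/matrixP => i j; rewrite mxE of_coordsK. Qed.

Lemma measurable_of_mx_coords i j : measurable_fun setT (fun t => of_mx_coords t i j).
Proof.
under eq_fun do rewrite mxE.
exact: measurable_tnth.
Qed.

End BorelCoordinates.

Section Decouple.
Context d (T : measurableType d) {R : realType} (P : probability T R) {m n p q : nat}.
Variables (W : T -> 'M[R]_(m, n)) (V : T -> 'M[R]_(p, q)).
Hypotheses (mW : forall i j, measurable_fun setT (fun w => W w i j))
  (mV : forall i j, measurable_fun setT (fun w => V w i j)).
Hypothesis WV : independent_mx P W V.

Lemma Rintegral_decouple_mx (h : 'M[R]_(m, n) -> 'M[R]_(p, q) -> R) :
  (forall d' (S : measurableType d') (X : S -> 'M[R]_(m, n)) (Y : S -> 'M[R]_(p, q)),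
     (forall i j, measurable_fun setT (fun s => X s i j)) ->
     (forall i j, measurable_fun setT (fun s => Y s i j)) ->
     measurable_fun setT (fun s => h (X s) (Y s))) ->
  \int[P]_w h (W w) (V w) = \int[(P \x P)%E]_z h (W z.1) (V z.2).
Proof.
move=> mh.
have mcW : measurable_fun setT (fun w => mx_coords (W w)) by apply: measurable_of_coords => ij.
have mcV : measurable_fun setT (fun w => mx_coords (V w)) by apply: measurable_of_coords => ij.
have indep A B : measurable A -> measurable B ->
    P ((fun w => mx_coords (W w)) @^-1` A `&` (fun w => mx_coords (V w)) @^-1` B) =
    (P ((fun w => mx_coords (W w)) @^-1` A) * P ((fun w => mx_coords (V w)) @^-1` B))%E.
  by move=> mA mB; exact: (WV (borel_mx_coords mA) (borel_mx_coords mB)).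
pose h' (z : #|{: 'I_m * 'I_n}|.-tuple R * #|{: 'I_p * 'I_q}|.-tuple R) :=
  (h (of_mx_coords z.1) (of_mx_coords z.2))%:E.
have mh' : measurable_fun setT h'.
  apply/measurable_EFinP; apply: mh => i j.
    exact: measurableT_comp (measurable_of_mx_coords i j) measurable_fst.
  exact: measurableT_comp (measurable_of_mx_coords i j) measurable_snd.
have hE w w' : h' (mx_coords (W w), mx_coords (V w')) = (h (W w) (V w'))%:E.
  by rewrite /h' /= (mx_coordsK (W w)) (mx_coordsK (V w')).
congr fine; apply: etrans (eq_integral _ _ (fun w _ => esym (hE w w))) _.
apply: etrans (integral_decouple mcW mcV indep mh') _.
by apply: eq_integral => z _; exact: hE.
Qed.

End Decouple.

(** * The expectation attached to one tree *)

Section TreeTerm.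
Context {R : realType} {k n : nat} (k0 : (0 < k)%N).
Context d (T : measurableType d) (P : probability T R) (Z : T -> 'M[R]_(k, n)).
Hypothesis gZ : gaussian_field P Z 1%:M.
Variables (E : {set {set 'I_k}}) (x : {set 'I_k} -> T -> R).
Hypotheses (tE : spanning_tree E) (iidx : iid_with_law P E x (uniform_prob (@ltr01 R))).
Hypothesis indep : independent_mx P (fun w => tree_weight E (x^~ w)) Z.
Context dQ (Q : measurableType dQ) (PQ : probability Q R) (U : {set 'I_k} -> Q -> R).
Hypothesis iidU : iid_with_law PQ [set: {set 'I_k}]%SET U (uniform_prob (@ltr01 R)).

Lemma tree_path_edges_sub i j e : i != j -> e \in tree_path_edges E i j -> e \in E.
Proof.
move=> ij; have pE : path (adjacent E) i (tree_path E i j).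
  rewrite /tree_path; case: xgetP => [p -> [] //|_ //].
by move=> /pairmap_mem[p1 [b [p2 [pE' ->]]]]; move: pE; rewrite pE' cat_path /= => /and3P[].
Qed.

Lemma eq_tree_weight (y y' : {set 'I_k} -> R) : {in E, y =1 y'} ->
  tree_weight E y = tree_weight E y'.
Proof.
move=> yy'; apply/matrixP => i j; rewrite !mxE; case: (eqVneq i j) => // ij.
have h e : e \in tree_path_edges E i j -> y e = y' e by move=> /(tree_path_edges_sub ij)/yy'.
have hd : tree_path_edges E i j != [::].
  rewrite /tree_path_edges /tree_path; case: xgetP => [[|a p] _ [_ pj _]|none] //.
    by move: ij; rewrite -pj eqxx.
  have /and3P[_ _ /forallP /(_ i) /forallP /(_ j) /connectP[p pE pj]] := tE.
  by case: (shortenP pE) pj => p' p'E up' _ pj; have [] := none p'.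
case: (tree_path_edges E i j) hd h => [//|e s] _ h /=.
rewrite (h e (mem_head _ _)); apply: eq_big_seq => e' e's; exact: h.
Qed.

(** The variables off [E] are not known to be measurable. A constant replaces them, without effect
    on the weight by [eq_tree_weight]. *)
Let y e w : R := if e \in E then x e w else 2^-1.

Let my e : measurable_fun setT (y e).
Proof. by rewrite /y; case: (boolP (e \in E)) => // eE; have [] := iidx.1 e eE. Qed.

Let W w := tree_weight E (x^~ w).

Let mW i j : measurable_fun setT (fun w => W w i j).
Proof.
have -> : (fun w => W w i j) = (fun w => if i == j then 1 else
    \big[Num.min/y (head finset.set0 (tree_path_edges E i j)) w]_(e <- tree_path_edges E i j) y e w).
  apply/funext => w; rewrite /W (@eq_tree_weight _ (y^~ w)) ?mxE// => e eE.
  by rewrite /y eE.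
by case: (i == j) => //; exact: measurable_bigmin.
Qed.

Let good w := forall e, e \in E -> 0 < x e w < 1.

Let good_ae : {ae P, forall w, good w}.
Proof.
apply: filter_forall => e; case: (boolP (e \in E)) => eE.
  by apply: filterS (uniform_interior (iidx.1 e eE)) => w h _.
by apply: filterS filterT.
Qed.

(* A tree is connected, so all vertices share one color. *)
Let c0 (_ : 'I_k) := tt.

Let goodW w : good w -> W w = wt_mx E (cl (x^~ w)) 0 c0.
Proof.
move=> gw; rewrite /W (@eq_tree_weight _ (cl (x^~ w))); last first.
  by move=> e eE; rewrite /cl gw.
apply/matrixP => i j; rewrite [RHS]mxE; apply: tree_weightE => // e.
by case/andP: (cl01 (x^~ w) e) => *; rewrite !ltW.
Qed.

Let colE : colored E c0. Proof. by []. Qed.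

(* Truncating the square root costs nothing on the event that all [x e] lie in
   (0, 1), and makes the integrand integrable everywhere. *)
Let S (A : 'M[R]_k) : 'M[R]_k := if `|sqrt_pd k%:R A| <= 1 then sqrt_pd k%:R A else 0.

Let S1 A : `|S A| <= 1.
Proof. by rewrite /S; case: ifP => // _; rewrite normr0. Qed.

Let SW w : good w -> S (W w) = sqrt_wt E (cl (x^~ w)) 0 c0.
Proof.
move=> gw; rewrite /S goodW// -/(sqrt_wt E (cl (x^~ w)) 0 c0) norm_sqrt_wt//.
- by move=> e; exact: cl01.
- by rewrite lexx ltr01.
Qed.

Let sqrtW w : good w -> sqrt_mx (W w) = S (W w).
Proof.
move=> gw; rewrite SW// goodW// sqrt_mx_wt//.
- by move=> e; exact: cl01.
- by rewrite lexx ltr01.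
Qed.

Let measurable_S d' (M : measurableType d') (X : M -> 'M[R]_k) :
  (forall i j, measurable_fun setT (fun s => X s i j)) ->
  forall i j, measurable_fun setT (fun s => S (X s) i j).
Proof.
move=> mX i j; have mS a b : measurable_fun setT (fun s => sqrt_pd k%:R (X s) a b) by exact: measurable_sqrt_pd.
rewrite (_ : (fun s => _) = (fun s => if `|sqrt_pd k%:R (X s)| <= 1 then sqrt_pd k%:R (X s) i j else 0)).
  apply: measurable_fun_ifT => //; apply: measurable_fun_ler => //.
  exact: measurable_mx_norm.
by apply/funext => s; rewrite /S; case: (`|_| <= 1) => //; rewrite mxE.
Qed.

(** Independence from [Z] is assumed for the weight matrix only, so the integrand is written as a
    function of [W w] and [Z w] before the two are decoupled. Fubini leaves a function of the edge
    values of [E], which is carried over to the auxiliary family. *)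
Lemma Rintegral_tree_term (g : 'M[R]_(k, n) -> R) : rtame g ->
  \int[P]_w forest_op E g (sqrt_mx (tree_weight E (x^~ w)) *m Z w) =
  \int[PQ]_w forest_term c0 P Z g E (U^~ w).
Proof.
move=> tg; set f := forest_op E g; have tf : rtame f by exact: rtame_forest_op.
have [c1 [c2 [c10 c20 gc]]] := rtame_growth tf.
have [N [mN N0 subN]] := good_ae.
have goodN w : ~ N w -> good w by move=> nN; apply: contrapT => /subN.
pose B z := c1 * expR (c2 * k%:R * `|Z z|).
have iB : P.-integrable setT (EFin \o B).
  by apply: integrableZlR; exact: gf_exp gZ _.
have fB A z : `|f (S A *m Z z)| <= B z.
  rewrite (le_trans (gc _))// ler_wpM2l// ler_expR -mulrA ler_wpM2l//.
  by rewrite (le_trans (mx_norm_mulmx _ _))// ler_wpM2r// -[leRHS]mulr1 ler_wpM2l.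
have mf d' (M : measurableType d') (X : M -> 'M[R]_k) (Y : M -> 'M[R]_(k, n)) :
    (forall i j, measurable_fun setT (fun s => X s i j)) ->
    (forall i j, measurable_fun setT (fun s => Y s i j)) ->
    measurable_fun setT (fun s => f (S (X s) *m Y s)).
  move=> mX mY; apply: (measurable_comp_continuous (rtame_continuous tf)) => i j.
  under eq_fun do rewrite mxE.
  by apply: measurable_sum => l; apply: measurable_funM => //; exact: measurable_S.
transitivity (\int[P]_w f (S (W w) *m Z w)).
  by apply: (ae_eq_Rintegral mN N0) => w /goodN gw; rewrite -sqrtW.
transitivity (\int[(P \x P)%E]_z f (S (W z.1) *m Z z.2)).
  exact: (Rintegral_decouple_mx mW (gf_meas gZ) indep (h := fun A Y => f (S A *m Y)) mf).
have mz : measurable_fun setT (fun z : T * T => f (S (W z.1) *m Z z.2)).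
  apply: mf => i j; first exact: measurableT_comp (mW i j) measurable_fst.
  exact: measurableT_comp (gf_meas gZ i j) measurable_snd.
have i1 : P.-integrable setT (EFin \o (fun=> 1 : R)) by exact: finite_measure_integrable_cst.
rewrite (Rfubini12 (f := fun z => f (S (W z.1) *m Z z.2))); last 2 first.
- apply: (integrable_le mz _ (integrable_prodM i1 iB)) => z; rewrite mul1r; exact: fB.
- by move=> w; exact: gf_integrable (gf_linear (S (W w)) gZ) tf.
transitivity (\int[P]_w forest_term c0 P Z g E (x^~ w)).
  apply: (ae_eq_Rintegral mN N0) => w /goodN gw.
  by rewrite /= SW.
rewrite /Rintegral; congr fine.
apply: (@eq_integral_iid R _ _ _ _ _ P PQ E x U _ (fun y => (forest_term c0 P Z g E y)%:E) iidx).
- split=> [e eE|J A JE mA]; first exact: iidU.1 e (finset.in_setT e).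
  by apply: iidU.2 => //; exact: finset.subsetT.
- apply/multi_measurableP => d' M X mX; apply/measurable_EFinP.
  exact: (measurable_forest_term c0 gZ tg E mX).
- move=> a b ab.
  have clE' e : e \in E -> cl a e = cl b e by move=> eE; rewrite /cl ab.
  have wE : wt_mx E (cl a) 0 c0 = wt_mx E (cl b) 0 c0.
    apply/matrixP => i j; rewrite !mxE /wt; case: (i == j) => //.
    have lE u : level E (cl a) u = level E (cl b) u.
      by apply/setP => e; rewrite !inE; case: (boolP (e \in E)) => // /clE' ->.
    apply: eq_big => [e|e /andP[eE _]]; last exact: clE'.
    by case: (boolP (e \in E)) => //= eE; rewrite lE clE'.
  by rewrite /forest_term /gam /sqrt_wt wE.
Qed.

End TreeTerm.

Local Close Scope classical_set_scope.

Theorem theorem2p4p5 (R : realType) (k n : nat) (hk : (1 <= k)%N)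
    (hn : (1 <= n)%N) (d : measure_display) (T : measurableType d)
    (P : probability T R)
    (zeta : T -> 'rV[R]_n) (Z : T -> 'M[R]_(k, n))
    (hzeta : standard_gaussian_mx P zeta) (hZ : standard_gaussian_mx P Z)
    (x : {set {set 'I_k}} -> {set 'I_k} -> T -> R)
    (hx : forall E : {set {set 'I_k}}, spanning_tree E ->
       iid_with_law P E (x E) (uniform_prob (@ltr01 R)))
    (hindep : forall E : {set {set 'I_k}}, spanning_tree E ->
       independent_mx P (fun w => tree_weight E (fun e => x E e w)) Z)
    (f : 'I_k -> 'rV[R]_n -> R[i]) (hf : forall i, tame (f i)) :
  joint_cumulant P (fun i w => f i (zeta w)) =
  \sum_(E : {set {set 'I_k}} | spanning_tree E)
    complex_expectation P (fun w =>
      tree_operator E (tensor f)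
        (sqrt_mx (tree_weight E (fun e => x E e w)) *m Z w)).
Proof.
have gz := standard_gaussian_field hzeta; have gZ := standard_gaussian_field hZ.
have tf i : ctame (f i) by exact: tame_rtame.
have [tre tim] := ctame_tensor tf.
have [dQ [Q [PQ [U iidU]]]] :=
  exists_iid {set 'I_k} (@uniform_prob R 0 1 ltr01 : probability (measurableTypeR R) R).
rewrite (joint_cumulant_trees hk gz gZ tf iidU); apply: eq_bigr => E tE.
have [reE imE] := Re_tree_operator E (tensor f).
(* Each tree passes from the common auxiliary edge values back to its own, separately for the real
   and imaginary parts. *)
have term g : rtame g -> \int[PQ]_w forest_term id P Z g E (U^~ w) =
    \int[P]_w forest_op E g (sqrt_mx (tree_weight E (fun e => x E e w)) *m Z w).
  move=> tg; apply: etrans (esym (Rintegral_tree_term hk gZ tE (hx E tE) (hindep E tE) iidU tg)).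
  by apply: eq_Rintegral => w _; exact: forest_term_color.
rewrite complex_expectationE /forest_mean (term _ tre) (term _ tim).
congr (_ +i* _); apply: eq_Rintegral => w _.
  by rewrite -reE.
by rewrite -imE.
Qed.
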